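(* Let $n\ge2$, $R>0$, let $f$ be holomorphic on the Lie ball $\widehat{B_R}$, let $f_{k,l}$ ($k\in\mathbb{N}_0$, $l=1,\dots,a_k$) be the Laplace-Fourier coefficients of the restriction of $f$ to $B_R$, and let $p_{k,l}(r^2):=r^{-k}f_{k,l}(r)$. Then (the functions $p_{k,l}$ extend holomorphically to $\mathbb{D}_{R^2}=\{\zeta\in\mathbb{C}:|\zeta|<R^2\}$ and, denoting the extensions again by $p_{k,l}$) the series $$\sum_{k=0}^\infty\sum_{l=1}^{a_k}p_{k,l}(q(z))\,Y_{k,l}(z)$$ converges compactly and absolutely in $\widehat{B_R}$ to $f(z)$.
   Context: $B_R=\{x\in\mathbb{R}^n:|x|<R\}$ with $|\cdot|$ the Euclidean norm; $\mathbb{S}^{n-1}$ is the unit sphere with surface measure $d\theta$. For each $k\in\mathbb{N}_0$, $a_k$ is the dimension of the space of harmonic homogeneous polynomials of degree $k$ on $\mathbb{R}^n$, and $Y_{k,l}$, $l=1,\dots,a_k$, is a fixed basis of this space that is orthonormal with respect to $\langle f,g\rangle=\int_{\mathbb{S}^{n-1}}f(\theta)\overline{g(\theta)}\,d\theta$; as polynomials, the $Y_{k,l}$ are also evaluated at points of $\mathbb{C}^n$. The Laplace-Fourier coefficients of $g\in C^\infty(B_R)$ are $g_{k,l}(r)=\int_{\mathbb{S}^{n-1}}g(r\theta)\overline{Y_{k,l}(\theta)}\,d\theta$ for $0\le r<R$. It is known that $r^{-k}g_{k,l}(r)$ depends only on $r^2$ and that there is a unique $p_{k,l}\in C^\infty[0,R^2)$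 with $p_{k,l}(r^2)=r^{-k}g_{k,l}(r)$. For $z\in\mathbb{C}^n$ put $|z|^2=|z_1|^2+\dots+|z_n|^2$ and $q(z)=z_1^2+\dots+z_n^2$. The Lie ball is $$\widehat{B_R}=\{z\in\mathbb{C}^n:|z|^2+\sqrt{|z|^4-|q(z)|^2}<R^2\},$$ a domain in $\mathbb{C}^n$ containing $B_R$; for $z\in\widehat{B_R}$ one has $|q(z)|<R^2$. Converging compactly means converging uniformly on compact subsets. *)

(* Defs.v *)
From HB Require Import structures.
From mathcomp Require Import all_boot all_order all_algebra.
From mathcomp Require Import all_classical all_reals all_analysis.
From mathcomp Require Import complex.
(* not imported: the notations of mpoly clash with those of MathComp-Analysis *)
From mathcomp Require mpoly.
Import (coercions, canonicals) mpoly.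

Set Implicit Arguments.
Unset Strict Implicit.
Unset Printing Implicit Defensive.

Import Order.TTheory GRing.Theory Num.Theory.
Import numFieldNormedType.Exports.

Local Open Scope classical_set_scope.
Local Open Scope ring_scope.

(* The structure of normed module over itself that MathComp-Analysis gives to
   the alias R[i]^o, transported to R[i]; it induces the one of 'rV[R[i]]_n. *)
HB.instance Definition _ (R : rcfType) := GRing.ComAlgebra.copy R[i] R[i]^o.
HB.instance Definition _ (R : rcfType) := Vector.copy R[i] R[i]^o.
HB.instance Definition _ (R : rcfType) := NormedModule.copy R[i] R[i]^o.

(* The surface integral over the unit sphere S^m of R^(m+1), in hyperspherical
   coordinates: theta = (cos t, sin t * omega) with t in [0, pi] and omega in
   S^(m-1), for which dtheta = (sin t)^(m-1) dt domega. The recursion starts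
   at S^0 = {1, -1} with the counting measure. *)
Fixpoint sphere_int_succ (R : realType) (m : nat) :
    ('rV[R]_m.+1 -> R) -> R :=
  match m return ('rV[R]_m.+1 -> R) -> R with
  | 0 => fun g => g (const_mx 1) + g (const_mx (- 1))
  | m'.+1 => fun g =>
      \int[lebesgue_measure]_(t in `[0, pi])
        (sin t ^+ m' *
         sphere_int_succ (fun omega : 'rV[R]_m'.+1 =>
           g (row_mx ((cos t)%:M : 'rV[R]_1) (sin t *: omega))))
  end.

(* The surface integral over the unit sphere of R^n (0 by convention if
   n = 0). *)
Definition sphere_int (R : realType) (n : nat) : ('rV[R]_n -> R) -> R :=
  match n return ('rV[R]_n -> R) -> R with
  | 0 => fun _ => 0
  | m.+1 => @sphere_int_succ R m
  end.

Definition sphere_intC (R : realType) (n : nat) (g : 'rV[R]_n -> R[i]) : R[i] :=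
  (sphere_int (fun x => complex.Re (g x)) +i*
   sphere_int (fun x => complex.Im (g x)))%C.

Definition real_point (R : realType) (n : nat) (x : 'rV[R]_n) : 'rV[R[i]]_n :=
  map_mx (fun t : R => (t%:C)%C) x.

Definition peval (R : realType) (n : nat) (p : mpoly.mpoly n R[i])
    (z : 'rV[R[i]]_n) : R[i] :=
  mpoly.meval (fun i => z 0 i) p.

Definition laplacian (R : realType) (n : nat) (p : mpoly.mpoly n R[i]) :
    mpoly.mpoly n R[i] :=
  \sum_(i < n) mpoly.mderiv i (mpoly.mderiv i p).

Definition harmonic_homogeneous (R : realType) (n k : nat)
    (p : mpoly.mpoly n R[i]) : Prop :=
  p \is mpoly.ishomog1 k mpoly.mdeg /\ laplacian p = 0.

Definition sphere_dot (R : realType) (n : nat) (p q : mpoly.mpoly n R[i]) :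
    R[i] :=
  sphere_intC (fun x => peval p (real_point x) * (peval q (real_point x))^*).

(* Y is an orthonormal basis of the complex vector space of harmonic homogeneous
   polynomials of degree k; hence a is the dimension of that space. *)
Definition orthonormal_harmonic_basis (R : realType) (n k a : nat)
    (Y : 'I_a -> mpoly.mpoly n R[i]) : Prop :=
  [/\ forall l, harmonic_homogeneous k (Y l),
      forall h, harmonic_homogeneous k h ->
        exists! c : 'rV[R[i]]_a, h = \sum_(l < a) c 0 l *: Y l
    & forall l l', sphere_dot (Y l) (Y l') = (l == l')%:R].

Definition laplace_fourier (R : realType) (n : nat) (g : 'rV[R]_n -> R[i])
    (Y : mpoly.mpoly n R[i]) (r : R) : R[i] :=
  sphere_intC (fun theta => g (r *: theta) * (peval Y (real_point theta))^*).

(* |z|^2 for the Hermitian norm; the norm of the library on 'rV is the sup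
   norm, which only serves for the topology and for differentiability. *)
Definition sqnorm (R : realType) (n : nat) (z : 'rV[R[i]]_n) : R :=
  \sum_(i < n) Normc.normc (z 0 i) ^+ 2.

Definition quad (R : realType) (n : nat) (z : 'rV[R[i]]_n) : R[i] :=
  \sum_(i < n) z 0 i ^+ 2.

Definition lie_ball (R : realType) (n : nat) (rho : R) : set 'rV[R[i]]_n :=
  [set z | sqnorm z + Num.sqrt (sqnorm z ^+ 2 - Normc.normc (quad z) ^+ 2)
           < rho ^+ 2].

Definition disc (R : realType) (s : R) : set R[i] :=
  [set zeta | Normc.normc zeta < s].

(* Holomorphy on an open set: Frechet differentiability over the complex
   field at every point. *)
Definition holomorphic_on (R : realType) (V : normedModType R[i])
    (D : set V) (f : V -> R[i]) : Prop :=
  forall z, D z -> differentiable f z.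

(* P is a holomorphic extension to the disc of radius rho^2 of the function
   p on [0, rho^2[ given by p (r^2) = r^-k * g r. The point r = 0, where this
   formula makes no sense for k > 0, is left to the continuity of p and P. *)
Definition radial_extension (R : realType) (rho : R) (k : nat) (g : R -> R[i])
    (P : R[i] -> R[i]) : Prop :=
  holomorphic_on (@disc R (rho ^+ 2)) P /\
  forall r : R, 0 < r < rho -> P ((r ^+ 2)%:C)%C = ((r ^- k)%:C)%C * g r.

Definition lf_term (R : realType) (n : nat) (a : nat -> nat)
    (Y : forall k, 'I_(a k) -> mpoly.mpoly n R[i])
    (P : forall k, 'I_(a k) -> R[i] -> R[i])
    (k : nat) (l : 'I_(a k)) (z : 'rV[R[i]]_n) : R[i] :=
  P k l (quad z) * peval (Y k l) z.

(* Main.v *)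
(* Write L(z)^2 = |z|^2 + sqrt (|z|^4 - |q(z)|^2), so that the Lie ball is
   {L < R}.  On complex lines through 0 Cauchy's formula gives f = sum_d F_d
   with F_d homogeneous of degree d and |f - sum_(d < N) F_d| = O(t^N) on
   {L <= r}, for some t < 1.  Decomposing F_d = sum_j q^j h_(d - 2 j) with h_k
   harmonic and expanding h_k in the basis yields p_(k, l) as the power series
   whose coefficients are the integrals of F_(k + 2 j) times the conjugate of
   Y_(k, l) over the sphere; Cauchy's estimates bound them.
   The other ingredient is |Y_(k, l)(z)| <= B_k L(z)^k with B_k of polynomial
   growth.  The reproducing kernel shows that sum_l |Y_(k, l)(z)|^2 is a
   polynomial in |z|^2 and |q(z)|^2, equal to L^(2 k) g(w) for a polynomial g of
   degree at most 2 k in w = |q| / L^2 <= 1; on the circle |w| = 1 the values of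
   g are bounded by the value of the kernel at coinciding points of the sphere,
   hence so are its coefficients.
   The partial sums of the two series then differ by tails of the p_(k, l), of
   total size O(N^D t^N). *)
Require Import Defs.
From HB Require Import structures.
From mathcomp Require Import all_boot all_order all_algebra.
From mathcomp Require Import complex.
From mathcomp Require Import ring lra zify.
From mathcomp Require mpoly ssrcomplements.

Set Implicit Arguments.
Unset Strict Implicit.
Unset Printing Implicit Defensive.

Import Order.TTheory GRing.Theory Num.Theory.

Local Open Scope ring_scope.

(** * Harmonic decomposition of polynomials *)

Section HarmonicPolynomials.
Import mpoly.
Context {F : numFieldType} {n : nat}.
Implicit Types (p g h : {mpoly F[n]}) (x : 'I_n -> F).

(** Two features of the statement shape the proof. Holomorphy is mere differentiability, with no
    continuity of the derivative, so Cauchy's formula has to come from Goursat's subdivision; it is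
    applied on a square of parameters that contracts the circle to the point w. And the surface
    integral is an iterated integral that does not show its rotation invariance. What is used of it
    are the moments of monomials, whose recursion is the divergence theorem, and its continuity
    under uniform convergence. The divergence theorem yields the orthogonality of different degrees
    and the integral of (x . theta)^k h(theta) for harmonic h, hence the reproducing kernel. That
    F_d is a polynomial does not come from a Taylor expansion in several variables: restrictions to
    complex lines are expanded in one variable, and interpolation in one coordinate at a time shows
    that the d-th coefficient is a polynomial in z. Limits are mostly replaced by bounds C x^N valid
    for all N. The factors 2 in the bounds arise from estimating real and imaginary parts
    separately. *)

Definition lap p : {mpoly F[n]} := \sum_(i < n) (p^`M(i))^`M(i).
Definition sqpoly : {mpoly F[n]} := \sum_(i < n) 'X_i ^+ 2.

Lemma mderiv_sum (I : Type) (s : seq I) (G : I -> {mpoly F[n]}) i :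
  (\sum_(j <- s) G j)^`M(i) = \sum_(j <- s) (G j)^`M(i).
Proof. exact: raddf_sum. Qed.

Lemma lapD p g : lap (p + g) = lap p + lap g.
Proof. by rewrite /lap -big_split; apply: eq_bigr => i _; rewrite !mderivD. Qed.

Lemma lapZ c p : lap (c *: p) = c *: lap p.
Proof. by rewrite /lap scaler_sumr; apply: eq_bigr => i _; rewrite !mderivZ. Qed.

Lemma lap0 : lap 0 = 0.
Proof. by rewrite /lap big1// => i _; rewrite !mderiv0. Qed.

Lemma lap_sum (I : Type) (s : seq I) (G : I -> {mpoly F[n]}) :
  lap (\sum_(j <- s) G j) = \sum_(j <- s) lap (G j).
Proof. by elim/big_rec2: _ => [|j a b _ <-]; [exact: lap0|rewrite lapD]. Qed.

Lemma lapM p g : lap (p * g) =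
  lap p * g + (\sum_(i < n) p^`M(i) * g^`M(i)) *+ 2 + p * lap g.
Proof.
rewrite /lap mulr_suml mulr_sumr -sumrMnl -!big_split /=; apply: eq_bigr => i _.
rewrite mderivM mderivD !mderivM; ring.
Qed.

Lemma lap_mderiv i p : lap (p^`M(i)) = (lap p)^`M(i).
Proof.
rewrite /lap mderiv_sum; apply: eq_bigr => j _.
by rewrite [p^`M(i)^`M(j)]mderiv_comm [in LHS]mderiv_comm.
Qed.

Lemma mderivXU i j : ('X_j : {mpoly F[n]})^`M(i) = (i == j)%:R.
Proof.
rewrite mderivX mnm1E eq_sym; case: eqP => [->|_]; last by rewrite scale0r.
rewrite scale1r; have -> : forall k, (U_(k) - U_(k))%MM = 0%MM :> 'X_{1.. n}.
  by move=> k; apply/mnmP => l; rewrite mnmBE subnn mnm0E.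
exact: mpolyX0.
Qed.

Lemma mderiv_sqpoly i : sqpoly^`M(i) = 'X_i *+ 2.
Proof.
rewrite /sqpoly mderiv_sum (bigD1 i)//= big1 => [|j ji].
  by rewrite addr0 expr2 mderivM mderivXU eqxx mul1r mulr1 mulr2n.
by rewrite expr2 mderivM mderivXU eq_sym (negbTE ji) mul0r mulr0 addr0.
Qed.

Lemma lap_sqpoly : lap sqpoly = (2 * n)%:R.
Proof.
rewrite /lap (eq_bigr (fun=> 2%:R)) => [|i _]; last first.
  by rewrite mderiv_sqpoly mderivMn mderivXU eqxx.
by rewrite sumr_const card_ord -mulrnA.
Qed.

Lemma mnm_neq0_sub1 (m : 'X_{1.. n}) i : m i != 0%N -> (m - U_(i) + U_(i))%MM = m.
Proof.
move=> mi; apply/mnmP => j; rewrite mnmDE mnmBE mnm1E.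
by case: eqP => [<-|_]; rewrite ?addn0 ?subn0// subnK// lt0n.
Qed.

Lemma mpoly_euler p d : p \is d.-homog ->
  \sum_(i < n) 'X_i * p^`M(i) = d%:R *: p.
Proof.
move=> /dhomogP hp.
rewrite [in RHS](mpolyE p) scaler_sumr.
rewrite (eq_bigr (fun i => \sum_(m <- msupp p) p@_m *: ('X_i * ('X_[m])^`M(i)))); last first.
  move=> i _; rewrite {1}(mpolyE p) mderiv_sum mulr_sumr.
  by apply: eq_bigr => m _; rewrite mderivZ scalerAr.
rewrite exchange_big /= big_seq [RHS]big_seq; apply: eq_bigr => m mp.
rewrite -scaler_sumr [RHS]scalerA mulrC -scalerA; congr (_ *: _).
have e : mdeg m = d := hp m mp.
rewrite -e mdegE natr_sum scaler_suml; apply: eq_bigr => i _.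
rewrite mderivX -scalerAr; have [->|mi] := eqVneq (m i) 0%N; first by rewrite !scale0r.
by rewrite -mpolyXD addmC mnm_neq0_sub1.
Qed.

Lemma dhomog_deriv p d i : p \is d.+1.-homog -> p^`M(i) \is d.-homog.
Proof.
move=> /dhomogP hp; rewrite (mpolyE p) mderiv_sum; apply: rpred_sum => m _.
rewrite mderivZ mderivX scalerA; have [->|mi] := eqVneq (m i) 0%N.
  by rewrite mulr0 scale0r rpred0.
have [mp|] := boolP (m \in msupp p); last first.
  by rewrite -mcoeff_eq0 => /eqP ->; rewrite mul0r scale0r rpred0.
have e : mdeg m = d.+1 := hp m mp.
by rewrite rpredZ// dhomogX /= -eqSS -e -{2}(mnm_neq0_sub1 mi) mdegD mdeg1 addn1.
Qed.

Lemma dhomog0_deriv p i : p \is 0.-homog -> p^`M(i) = 0.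
Proof.
move=> /dhomogP hp; rewrite (mpolyE p) mderiv_sum big_seq big1// => m mp.
have /eqP e : mdeg m = 0%N := hp m mp; rewrite mderivZ mderivX; move: e.
by rewrite mdeg_eq0 => /eqP ->; rewrite mnm0E scale0r scaler0.
Qed.

Lemma dhomog_lap p d : p \is d.+2.-homog -> lap p \is d.-homog.
Proof. by move=> hp; apply: rpred_sum => i _; do 2 apply: dhomog_deriv. Qed.

Lemma dhomog_lap0 p d : (d < 2)%N -> p \is d.-homog -> lap p = 0.
Proof.
move=> d2 hp; rewrite /lap big1// => i _; case: d d2 hp => [|[|//]] _ hp.
  by rewrite (dhomog0_deriv _ hp) mderiv0.
by rewrite (dhomog0_deriv _ (dhomog_deriv i hp)).
Qed.

Lemma dhomog_sqpoly : sqpoly \is 2.-homog.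
Proof.
apply: rpred_sum => i _; rewrite mpolyXn dhomogX /=.
by rewrite mdegMn mdeg1.
Qed.

Lemma lap_sqpolyM e p : p \is e.-homog ->
  lap (sqpoly * p) = (2 * n + 4 * e)%:R *: p + sqpoly * lap p.
Proof.
move=> hp; rewrite lapM lap_sqpoly; congr (_ + _).
have -> : \sum_(i < n) sqpoly^`M(i) * p^`M(i) = (\sum_(i < n) 'X_i * p^`M(i)) *+ 2.
  rewrite -sumrMnl; apply: eq_bigr => i _.
  by rewrite mderiv_sqpoly mulrnAl.
rewrite (mpoly_euler hp) mulr_natl !scaler_nat -!mulrnA -mulrnDr.
congr (_ *+ _); lia.
Qed.

Lemma dhomog_sqpolyX j e p : p \is e.-homog -> sqpoly ^+ j * p \is (2 * j + e).-homog.
Proof. by move=> hp; apply: dhomogM => //; exact: dhomogMn dhomog_sqpoly. Qed.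

(** With e = m - 2 (j + 1) the scalar is the denominator in [hcoef]; it is non-zero as soon as n >
    0. *)
Lemma lap_sqpolyX j e p : p \is e.-homog -> lap (sqpoly ^+ j.+1 * p) =
  (2 * j.+1 * (2 * j + n + 2 * e))%:R *: (sqpoly ^+ j * p) + sqpoly ^+ j.+1 * lap p.
Proof.
move=> hp; elim: j => [|j IH].
  rewrite expr1 expr0 mul1r (lap_sqpolyM hp); congr (_%:R *: _ + _); ring.
rewrite [sqpoly ^+ j.+2]exprS -mulrA (lap_sqpolyM (dhomog_sqpolyX j.+1 hp)) IH.
rewrite mulrDr -scalerAr [sqpoly * (sqpoly ^+ j * p)]mulrA -exprS addrA -scalerDl.
by rewrite -natrD -[in RHS]mulrA; congr (_%:R *: _ + _); ring.
Qed.

(* The coefficients that make harm m p = sum_j hcoef m j * q^j * lap^j p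
   harmonic for p homogeneous of degree m. *)
Fixpoint hcoef (m j : nat) : F := match j with
  | 0 => 1
  | j'.+1 => - hcoef m j' / (2 * j'.+1 * (2 * j' + n + 2 * (m - 2 * j'.+1)))%:R
  end.

Definition harm m p : {mpoly F[n]} :=
  \sum_(j < (m./2).+1) hcoef m j *: (sqpoly ^+ j * iter j lap p).

Lemma dhomog_iter_lap m j p : (2 * j <= m)%N -> p \is m.-homog ->
  iter j lap p \is (m - 2 * j).-homog.
Proof.
elim: j => [|j IH] jm hp; first by rewrite muln0 subn0.
rewrite iterS; apply: dhomog_lap.
have -> : (m - 2 * j.+1).+2 = (m - 2 * j)%N by lia.
by apply: IH => //; lia.
Qed.

Lemma iter_lap_eq0 m p : p \is m.-homog -> iter (m./2).+1 lap p = 0.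
Proof.
move=> hp; rewrite iterS; have h2 : (2 * m./2 <= m)%N by lia.
by apply: dhomog_lap0 (dhomog_iter_lap h2 hp); lia.
Qed.

Lemma dhomog_harm m p : p \is m.-homog -> harm m p \is m.-homog.
Proof.
move=> hp; apply: rpred_sum => j _; apply: rpredZ.
have jm : (2 * j <= m)%N by have := ltn_ord j; lia.
by have := dhomog_sqpolyX j (dhomog_iter_lap jm hp); rewrite subnKC.
Qed.

Lemma lap_harm m p : (0 < n)%N -> p \is m.-homog -> lap (harm m p) = 0.
Proof.
(* The Laplacian of the summand j + 1 of [harm] is [T j.+1 - T j] and that of the summand 0 is
   [T 0]. The sum telescopes to [T m./2], which contains the vanishing iterate [m./2 + 1] of
   [lap]. *)
move=> n0 hp; pose T j := hcoef m j *: (sqpoly ^+ j * iter j.+1 lap p).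
rewrite /harm lap_sum big_ord_recl /= lapZ expr0 mul1r.
have -> : \sum_(j < m./2) lap (hcoef m (bump 0 j) *: (sqpoly ^+ bump 0 j * iter (bump 0 j) lap p))
  = \sum_(j < m./2) (T j.+1 - T j).
  apply: eq_bigr => j _; rewrite /bump /= add1n lapZ.
  have jm : (2 * j.+1 <= m)%N by have := ltn_ord j; lia.
  rewrite (lap_sqpolyX _ (dhomog_iter_lap jm hp)) scalerDr scalerA addrC.
  congr (_ + _); rewrite /T -scaleNr; congr (_ *: _).
  by rewrite /= mulfVK// pnatr_eq0 !muln_eq0 /=; lia.
rewrite -(big_mkord predT (fun j => T j.+1 - T j)) telescope_sumr//.
rewrite /T (iter_lap_eq0 hp) mulr0 scaler0 sub0r expr0 mul1r.
by rewrite subrr.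
Qed.

(** Only the term j = 0 of [harm m p], which is p itself, lacks the factor q. Hence p - [harm m p]
    is q times a polynomial of degree m - 2, to which the induction applies. *)
Lemma harmonic_decomposition m p : (0 < n)%N -> p \is m.-homog ->
  exists h : nat -> {mpoly F[n]},
    (forall j, (2 * j <= m)%N -> h j \is (m - 2 * j).-homog /\ lap (h j) = 0) /\
    p = \sum_(j < (m./2).+1) sqpoly ^+ j * h j.
Proof.
move=> n0; elim/ltn_ind: m p => m IH p hp.
pose r := \sum_(j < m./2) hcoef m j.+1 *: (sqpoly ^+ j * iter j.+1 lap p).
have pE : p = harm m p - sqpoly * r.
  rewrite /harm big_ord_recl /= scale1r expr0 mul1r mulr_sumr.
  rewrite [X in _ + X - _](eq_bigr (fun j : 'I_(m./2) =>
    sqpoly * (hcoef m j.+1 *: (sqpoly ^+ j * iter j.+1 lap p)))) ?addrK// => j _.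
  by rewrite /bump /= add1n exprS -mulrA -scalerAr.
have [m2|m2] := ltnP m 2.
  exists (fun _ => harm m p); split => [j jm|].
    have -> : j = 0%N by lia.
    by rewrite muln0 subn0; split; [exact: dhomog_harm|exact: lap_harm].
  have m20 : m./2 = 0%N by lia.
  by rewrite m20 big_ord1 expr0 mul1r {1}pE /r m20 big_ord0 mulr0 subr0.
have hr : - r \is (m - 2).-homog.
  rewrite rpredN; apply: rpred_sum => j _; apply: rpredZ.
  have jm : (2 * j.+1 <= m)%N by have := ltn_ord j; lia.
  have := dhomog_sqpolyX j (dhomog_iter_lap jm hp).
  by have -> : (2 * j + (m - 2 * j.+1))%N = (m - 2)%N by lia.
have m2m : (m - 2 < m)%N by lia.
have [h [hh rE]] := IH (m - 2)%N m2m (- r) hr.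
exists (fun j => if j is j'.+1 then h j' else harm m p); split => [[|j] jm|].
- by rewrite muln0 subn0; split; [exact: dhomog_harm|exact: lap_harm].
- have -> : (m - 2 * j.+1)%N = (m - 2 - 2 * j)%N by lia.
  by apply: hh; lia.
- have -> : m./2 = ((m - 2)./2).+1 by lia.
  rewrite big_ord_recl expr0 mul1r {1}pE -mulrN rE mulr_sumr; congr (_ + _).
  by apply: eq_bigr => j _; rewrite /= /bump /= add1n exprS mulrA.
Qed.

Definition lpoly x : {mpoly F[n]} := \sum_(i < n) x i *: 'X_i.

Lemma mderiv_lpoly x i : (lpoly x)^`M(i) = (x i)%:MP_[n].
Proof.
rewrite /lpoly mderiv_sum (bigD1 i)//= big1 => [|j ji].
  by rewrite addr0 mderivZ mderivXU eqxx -mul_mpolyC mulr1.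
by rewrite mderivZ mderivXU eq_sym (negbTE ji) scaler0.
Qed.

Lemma dhomog_lpoly x : lpoly x \is 1.-homog.
Proof. by apply: rpred_sum => i _; rewrite rpredZ// dhomogX /= mdeg1. Qed.

Lemma dhomog_lpolyX x k : lpoly x ^+ k \is k.-homog.
Proof. by have := dhomogMn k (dhomog_lpoly x); rewrite mul1n. Qed.

Lemma mderivXn p i k : (p ^+ k)^`M(i) = k%:R *: (p ^+ k.-1 * p^`M(i)).
Proof.
elim: k => [|k IH]; first by rewrite expr0 scale0r -mpolyC1 mderivC.
rewrite exprS mderivM IH /= -scalerAr mulrA.
case: k IH => [|k] IH; first by rewrite expr0 mul1r mulr1 scale0r addr0 scale1r.
by rewrite -exprS -[in RHS]natr1 scalerDl scale1r addrC [_ * p ^+ _]mulrC.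
Qed.

(** For k < 2 the scalar k (k - 1) vanishes, so the truncation in [k.-2] is harmless. *)
Lemma lap_lpolyX x k : lap (lpoly x ^+ k) =
  (k * k.-1)%:R *: ((\sum_(i < n) x i ^+ 2) *: lpoly x ^+ k.-2).
Proof.
rewrite /lap (eq_bigr (fun i => (k * k.-1)%:R *: (x i ^+ 2 *: lpoly x ^+ k.-2))).
  by rewrite -scaler_sumr -scaler_suml.
move=> i _; rewrite mderivXn mderiv_lpoly [_ * _%:MP_[n]]mulrC mul_mpolyC.
rewrite !mderivZ mderivXn mderiv_lpoly [_ * _%:MP_[n]]mulrC mul_mpolyC !scalerA.
by congr (_ *: _); rewrite natrM; ring.
Qed.

Lemma iter_lap_lpolyX x k j : iter j lap (lpoly x ^+ k) =
  (k ^_ (2 * j))%:R *: ((\sum_(i < n) x i ^+ 2) ^+ j *: lpoly x ^+ (k - 2 * j)).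
Proof.
elim: j => [|j IH]; first by rewrite muln0 ffactn0 expr0 subn0 !scale1r.
rewrite iterS IH !lapZ lap_lpolyX !scalerA.
have -> : (k - 2 * j).-2 = (k - 2 * j.+1)%N by lia.
have -> : (2 * j.+1)%N = (2 * j).+2 by lia.
rewrite !ffactnSr !natrM exprSr; congr (_ *: _).
have -> : (k - 2 * j).-1 = (k - (2 * j).+1)%N by lia.
ring.
Qed.

(** The harmonic part of (x . y)^k as a polynomial in y: up to a constant, the zonal harmonic with
    pole x. *)
Definition zonal k x : {mpoly F[n]} := harm k (lpoly x ^+ k).

Definition zcoef k j : F := hcoef k j * (k ^_ (2 * j))%:R.

Lemma zonalE k x : zonal k x = \sum_(j < (k./2).+1)
  (zcoef k j * (\sum_(i < n) x i ^+ 2) ^+ j) *: (sqpoly ^+ j * lpoly x ^+ (k - 2 * j)).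
Proof.
apply: eq_bigr => j _; rewrite iter_lap_lpolyX -!scalerAr !scalerA /zcoef.
by rewrite !mulrA.
Qed.

End HarmonicPolynomials.

(** * Linear functionals given by their values on monomials *)

Section MonomialFunctionals.
Import mpoly.
Context {F : numFieldType} {n : nat}.
Implicit Types (p : {mpoly F[n]}) (phi : 'X_{1.. n} -> F).

(** The surface integral of a polynomial will be recognised as such a functional, which makes its
    linearity purely algebraic. *)
Definition monlin phi p : F := \sum_(u <- msupp p) p@_u * phi u.

Lemma monlinwE phi p k : (msize p <= k)%N ->
  monlin phi p = \sum_(u : 'X_{1..n < k}) p@_u * phi u.
Proof.
move=> le_pk; rewrite /monlin (ssrcomplements.big_mksub 'X_{1..n < k}) /=; first last.
  by move=> x /msize_mdeg_lt/leq_trans/(_ le_pk).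
  by rewrite msupp_uniq.
by rewrite big_rmcond //= => j /memN_msupp_eq0 ->; rewrite mul0r.
Qed.

Lemma monlinD phi p q : monlin phi (p + q) = monlin phi p + monlin phi q.
Proof.
pose k := maxn (msize p) (maxn (msize q) (msize (p + q))).
rewrite !(@monlinwE _ _ k) ?leq_max ?leqnn ?orbT//.
by rewrite -big_split /=; apply: eq_bigr => u _; rewrite mcoeffD mulrDl.
Qed.

Lemma monlinZ phi c p : monlin phi (c *: p) = c * monlin phi p.
Proof.
pose k := maxn (msize p) (msize (c *: p)).
rewrite !(@monlinwE _ _ k) ?leq_max ?leqnn ?orbT//.
by rewrite mulr_sumr; apply: eq_bigr => u _; rewrite mcoeffZ mulrA.
Qed.

Lemma monlinX phi u : monlin phi 'X_[u] = phi u.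
Proof. by rewrite /monlin msuppX big_seq1 mcoeffX eqxx mul1r. Qed.

Lemma monlin0 phi : monlin phi 0 = 0.
Proof. by rewrite /monlin msupp0 big_nil. Qed.

Lemma dhomog_ind d (P : {mpoly F[n]} -> Prop) : P 0 ->
  (forall p q, P p -> P q -> P (p + q)) -> (forall c p, P p -> P (c *: p)) ->
  (forall u : 'X_{1.. n}, mdeg u = d -> P 'X_[u]) -> forall p, p \is d.-homog -> P p.
Proof.
move=> P0 PD PZ PX p /dhomogP hp; rewrite (mpolyE p) big_seq.
by apply: big_rec => // u q /hp hu Pq; apply: PD => //; apply: PZ; exact: PX.
Qed.

(** The matrix of coefficients with respect to the monomials of degree at most k is row-free, and
    these monomials inject into the maps from ['I_n] to ['I_k.+1]. The bound is crude; only
    polynomial growth in k matters. *)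
Lemma card_independent_dhomog k a (Y : 'I_a -> {mpoly F[n]}) :
  (forall l, Y l \is k.-homog) ->
  (forall c : 'rV[F]_a, \sum_(l < a) c 0 l *: Y l = 0 -> c = 0) ->
  (a <= k.+1 ^ n)%N.
Proof.
move=> hY indep.
pose T : finType := 'X_{1..n < k.+1}.
pose A : 'M[F]_(a, #|T|) := \matrix_(l, j) (Y l)@_(bmnm (enum_val j)).
have rA : row_free A.
  rewrite -kermx_eq0; apply/eqP/row_matrixP => i; rewrite row0.
  have : row i (kermx A) *m A = 0 by rewrite -row_mul mulmx_ker row0.
  set v := row i _ => vA; apply: indep; apply/mpolyP => u; rewrite mcoeff0.
  have [uk|uk] := boolP (mdeg u < k.+1)%N; last first.
    rewrite raddf_sum big1//= => l _; rewrite mcoeffZ (dhomog_nemf_coeff (hY l)) ?mulr0//=.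
    by apply: contraNneq uk => ->.
  have := congr1 (fun B : 'rV_ _ => B 0 (enum_rank (BMultinom uk : T))) vA.
  rewrite !mxE => <-; rewrite raddf_sum; apply: eq_bigr => l _.
  by rewrite /= mcoeffZ; congr (_ * _); rewrite mxE enum_rankK.
have : (a <= #|T|)%N by rewrite -(eqP rA); exact: rank_leq_col.
move/leq_trans; apply.
pose f (u : T) : {ffun 'I_n -> 'I_k.+1} := [ffun i => inord (u i)].
have finj : injective f.
  move=> u v /ffunP fuv; apply/val_inj/mnmP => i.
  have := congr1 val (fuv i); rewrite !ffunE /= !inordK//.
    by rewrite (leq_ltn_trans _ (bmdeg v))// mdegE (bigD1 i)//= leq_addr.
  by rewrite (leq_ltn_trans _ (bmdeg u))// mdegE (bigD1 i)//= leq_addr.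
by have := leq_card f finj; rewrite card_ffun !card_ord.
Qed.

Lemma meval_dhomog d p (t : F) (v : 'I_n -> F) : p \is d.-homog ->
  p.@[fun i => t * v i] = t ^+ d * p.@[v].
Proof.
move: p; apply: dhomog_ind => [|p q hp hq|c p hp|u hu].
- by rewrite !meval0 mulr0.
- by rewrite !mevalD hp hq mulrDr.
- by rewrite !mevalZ hp mulrCA.
- rewrite !mevalX -hu mdegE expr_sum -big_split /=; apply: eq_bigr => i _.
  by rewrite exprMn.
Qed.

End MonomialFunctionals.

From mathcomp Require Import all_classical all_reals all_analysis.
From mathcomp Require Import complex measurable_realfun.
Import (coercions, canonicals) mpoly.

Import Order.TTheory GRing.Theory Num.Theory.
Import numFieldNormedType.Exports.

Local Open Scope classical_set_scope.
Local Open Scope ring_scope.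

Local Notation nc := (@Normc.normc _).
Local Notation Re := complex.Re.
Local Notation Im := complex.Im.
Local Notation "x %:C" := (x%:C)%C : ring_scope.

(** * Functions of one complex variable *)

Lemma eqr_le (R : realType) (x y : R) : x = y -> x <= y.
Proof. by move=> ->. Qed.

Section ComplexModulus.
Context {R : realType}.
Implicit Types x y : R[i].

Lemma ncD x y : nc (x + y) <= nc x + nc y.
Proof. exact: le_normcD. Qed.

Lemma ncN x : nc (- x) = nc x.
Proof. exact: normcN. Qed.

Lemma ncB x y : nc (x - y) <= nc x + nc y.
Proof. by rewrite -(ncN y) ncD. Qed.

Lemma ncBC x y : nc (x - y) = nc (y - x).
Proof. by rewrite -ncN opprB. Qed.

Lemma ncM x y : nc (x * y) = nc x * nc y.
Proof. exact: Normc.normcM. Qed.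

Lemma nc0 : nc (0 : R[i]) = 0.
Proof. exact: Normc.normc0. Qed.

Lemma nc1 : nc (1 : R[i]) = 1.
Proof. exact: Normc.normc1. Qed.

Lemma ncX x n : nc (x ^+ n) = nc x ^+ n.
Proof. by elim: n => [|n IH]; rewrite ?expr0 ?nc1// !exprS ncM IH. Qed.

Lemma ncV x : nc x^-1 = (nc x)^-1.
Proof. exact: Normc.normcV. Qed.

Lemma nc_ge0 x : 0 <= nc x.
Proof. by case: x => a b /=; rewrite sqrtr_ge0. Qed.

Lemma nc_eq0 x : (nc x == 0) = (x == 0).
Proof.
apply/eqP/eqP => [|->]; last exact: nc0.
exact: Normc.eq0_normc.
Qed.

Lemma nc_gt0 x : (0 < nc x) = (x != 0).
Proof. by rewrite lt0r nc_eq0 nc_ge0 andbT. Qed.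

Lemma nc_Re x : `|Re x| <= nc x.
Proof.
case: x => a b /=; rewrite -(sqrtr_sqr a) ler_wsqrtr// lerDl sqr_ge0//.
Qed.

Lemma nc_Im x : `|Im x| <= nc x.
Proof.
case: x => a b /=; rewrite -(sqrtr_sqr b) ler_wsqrtr// lerDr sqr_ge0//.
Qed.

Lemma nc_real (a : R) : nc a%:C = `|a|.
Proof. by rewrite /= expr0n addr0 sqrtr_sqr. Qed.

Lemma nc_nat (n : nat) : nc (n%:R : R[i]) = n%:R.
Proof.
have -> : (n%:R : R[i]) = (n%:R : R)%:C by rewrite rmorph_nat.
by rewrite nc_real normr_nat.
Qed.

Lemma nc_le_ReIm x : nc x <= `|Re x| + `|Im x|.
Proof.
case: x => a b /=; rewrite -[leRHS]ger0_norm ?addr_ge0//.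
rewrite -sqrtr_sqr ler_wsqrtr// sqrrD !real_normK ?num_real//.
rewrite addrAC lerDl mulrn_wge0// mulr_ge0//.
Qed.

Lemma nc_sum (I : Type) (s : seq I) (P : pred I) (F : I -> R[i]) :
  nc (\sum_(i <- s | P i) F i) <= \sum_(i <- s | P i) nc (F i).
Proof.
elim/big_rec2: _ => [|i a b _ h]; first by rewrite nc0.
by rewrite (le_trans (ncD _ _))// lerD2l.
Qed.

Lemma normr_nc x : `|x| = (nc x)%:C.
Proof. by case: x. Qed.

Lemma nc_sqr x : ((nc x) ^+ 2)%:C = x * x^*.
Proof. by rewrite -normCK normr_nc -rmorphXn. Qed.

Lemma nc_conj x : nc x^* = nc x.
Proof. by case: x => a b; rewrite /= sqrrN. Qed.

Lemma Re_add x y : Re (x + y) = Re x + Re y.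
Proof. by case: x; case: y. Qed.

Lemma Im_add x y : Im (x + y) = Im x + Im y.
Proof. by case: x; case: y. Qed.

Lemma Re_opp x : Re (- x) = - Re x. Proof. by case: x. Qed.
Lemma Im_opp x : Im (- x) = - Im x. Proof. by case: x. Qed.

Lemma Re_mul x y : Re (x * y) = Re x * Re y - Im x * Im y.
Proof. by case: x; case: y. Qed.

Lemma Im_mul x y : Im (x * y) = Re x * Im y + Im x * Re y.
Proof. by case: x; case: y. Qed.

Lemma complex_ext x y : Re x = Re y -> Im x = Im y -> x = y.
Proof. by case: x => a b; case: y => c d /= -> ->. Qed.

End ComplexModulus.

(** * Derivatives and integrals of curves in the complex plane *)

Section CurveCalculus.
Context {R : realType}.
Implicit Types (u v V : R -> R[i]) (x : R).

(** Differentiation is taken componentwise, so that the mean value theorem and the fundamental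
    theorem of calculus for real functions apply. *)
Definition cderiv u x (d : R[i]) :=
  is_derive x 1 (fun t => Re (u t)) (Re d) /\
  is_derive x 1 (fun t => Im (u t)) (Im d).

Definition ccts u := continuous (fun t => Re (u t)) /\
  continuous (fun t => Im (u t)).

Lemma cderiv_eq u x d d' : cderiv u x d -> d = d' -> cderiv u x d'.
Proof. by move=> ? <-. Qed.

Lemma cderiv_cst (c : R[i]) x : cderiv (fun _ => c) x 0.
Proof. by split; exact: is_derive_cst. Qed.

Lemma cderivD u v x du dv : cderiv u x du -> cderiv v x dv ->
  cderiv (fun t => u t + v t) x (du + dv).
Proof.
move=> [a b] [c d]; split; rewrite ?Re_add ?Im_add.
  rewrite (_ : (fun t => _) = (fun t => Re (u t)) + (fun t => Re (v t))).
    exact: is_deriveD.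
  by apply/funext => t; rewrite Re_add.
rewrite (_ : (fun t => _) = (fun t => Im (u t)) + (fun t => Im (v t))).
  exact: is_deriveD.
by apply/funext => t; rewrite Im_add.
Qed.

Lemma cderivM u v x du dv : cderiv u x du -> cderiv v x dv ->
  cderiv (fun t => u t * v t) x (u x * dv + v x * du).
Proof.
move=> [a b] [c d]; split; rewrite ?Re_add ?Im_add ?Re_mul ?Im_mul.
  rewrite (_ : (fun t => _) = (fun t => Re (u t)) * (fun t => Re (v t)) -
     (fun t => Im (u t)) * (fun t => Im (v t))); last first.
    by apply/funext => t; rewrite Re_mul.
  apply: is_derive_eq (is_deriveB (is_deriveM a c) (is_deriveM b d)) _.
  by rewrite /GRing.scale /= opprD addrACA.
rewrite (_ : (fun t => _) = (fun t => Re (u t)) * (fun t => Im (v t)) +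
     (fun t => Im (u t)) * (fun t => Re (v t))); last first.
  by apply/funext => t; rewrite Im_mul.
apply: is_derive_eq (is_deriveD (is_deriveM a d) (is_deriveM b c)) _.
by rewrite /GRing.scale /= addrACA; congr (_ + _); exact: addrC.
Qed.

Lemma cderivZ (c : R[i]) u x du : cderiv u x du ->
  cderiv (fun t => c * u t) x (c * du).
Proof.
move=> h; apply: cderiv_eq; first by apply: cderivM h; exact: cderiv_cst.
by rewrite mulr0 addr0.
Qed.

Lemma cderiv_real (v : R -> R) x d : is_derive x 1 v d ->
  cderiv (fun t => (v t)%:C) x d%:C.
Proof. by move=> h; split => //; exact: is_derive_cst. Qed.

Lemma cctsD u v : ccts u -> ccts v -> ccts (fun t => u t + v t).
Proof.
move=> [a b] [c d]; split => x.
  under eq_fun do rewrite Re_add; exact: (cvgD (a x) (c x)).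
under eq_fun do rewrite Im_add; exact: (cvgD (b x) (d x)).
Qed.

Lemma cctsM u v : ccts u -> ccts v -> ccts (fun t => u t * v t).
Proof.
move=> [a b] [c d]; split => x.
  under eq_fun do rewrite Re_mul; apply: cvgB.
    exact: (cvgM (a x) (c x)).
  exact: (cvgM (b x) (d x)).
under eq_fun do rewrite Im_mul; apply: cvgD.
  exact: (cvgM (a x) (d x)).
exact: (cvgM (b x) (c x)).
Qed.

Lemma ccts_cst (c : R[i]) : ccts (fun _ => c).
Proof. by split => x; exact: cvg_cst. Qed.

Lemma ccts_real (v : R -> R) : continuous v -> ccts (fun t => (v t)%:C).
Proof. by move=> cv; split => // x; exact: cvg_cst. Qed.

Lemma cderiv_ccts u du : (forall x, cderiv u x (du x)) -> ccts u.
Proof.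
move=> h; split => x; have [[/derivable1_diffP a _] [/derivable1_diffP b _]] := h x.
  exact: differentiable_continuous.
exact: differentiable_continuous.
Qed.

Lemma ccts_eps u : (forall x e, 0 < e -> exists2 d, 0 < d &
  forall y, `|y - x| < d -> nc (u y - u x) < e) -> ccts u.
Proof.
move=> h; split => x; apply/cvgrPdist_lt => e e0; have [d d0 H] := h x e e0;
  near=> y; rewrite distrC.
- rewrite -Re_opp -Re_add (le_lt_trans (nc_Re _))//; apply: H.
  by rewrite distrC; near: y; apply/nbhs_normP; exists d.
- rewrite -Im_opp -Im_add (le_lt_trans (nc_Im _))//; apply: H.
  by rewrite distrC; near: y; apply/nbhs_normP; exists d.
Unshelve. all: by end_near. Qed.

Lemma ccts_epsE u : ccts u -> forall x e, 0 < e -> exists2 d, 0 < d &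
  forall y, `|y - x| < d -> nc (u y - u x) < e.
Proof.
move=> [a b] x e e0.
have e20 : 0 < e / 2 by rewrite divr_gt0.
have /cvgrPdist_lt/(_ _ e20) := a x; have /cvgrPdist_lt/(_ _ e20) := b x.
move=> /nbhs_ballP[d1 /= d10 h1] /nbhs_ballP[d2 /= d20 h2].
exists (Num.min d1 d2) => [|y]; first by rewrite lt_min d10.
rewrite lt_min => /andP[y1 y2]; rewrite (le_lt_trans (nc_le_ReIm _))//.
rewrite Re_add Re_opp Im_add Im_opp (splitr e) ltrD//.
  by rewrite distrC; apply: h2; rewrite /ball/= distrC.
by rewrite distrC; apply: h1; rewrite /ball/= distrC.
Qed.

(** Integrating from -1 gives a two-sided derivative on the whole of [0, +oo[, the end point 0
    included. *)
Lemma real_primitive (f : R -> R) : continuous f ->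
  exists F : R -> R, forall x, -1 < x -> is_derive x 1 F (f x).
Proof.
move=> cf; exists (fun x => \int[lebesgue_measure]_(t in `[-1, x]) f t) => x x0.
have [||||dF F'] := @continuous_FTC1_closed R f (-1) x (x + 1).
- by rewrite ltrDl.
- apply: continuous_compact_integrable; first exact: segment_compact.
  by apply: continuous_subspaceT.
- by [].
- exact: cf.
by apply: (DeriveDef dF); rewrite -derive1E; exact: F'.
Qed.

Lemma complex_primitive u : ccts u ->
  exists V, forall x, 0 <= x -> cderiv V x (u x).
Proof.
move=> [/real_primitive[F hF] /real_primitive[G hG]].
exists (fun x => (F x +i* G x)%C) => x x0; have x1 : -1 < x by lra.
by split; [exact: hF|exact: hG].
Qed.

Lemma real_increment_bound (V v : R -> R) M a b : a <= b ->
  (forall x, a <= x <= b -> is_derive x 1 V (v x)) ->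
  (forall x, a <= x <= b -> `|v x| <= M) -> `|V b - V a| <= M * (b - a).
Proof.
rewrite le_eqVlt => /predU1P[->|ab] dV hM; first by rewrite !subrr normr0 mulr0.
have [|x|c] := @MVT R V v a b ab.
- by move=> x /[!in_itv] /= /andP[h1 h2]; apply: dV; rewrite !ltW.
- apply: derivable_within_continuous => y /[!in_itv] /= /dV h.
  exact: (@ex_derive _ _ _ _ _ _ _ h).
- move=> /[!in_itv] /= /andP[h1 h2] ->.
  have ba : 0 <= b - a by rewrite subr_ge0 ltW.
  by rewrite normrM (ger0_norm ba) ler_wpM2r// hM// !ltW.
Qed.

(** The mean value theorem is applied to both components, whence the factor 2. *)
Lemma cderiv_bound V v M a b : a <= b ->
  (forall x, a <= x <= b -> cderiv V x (v x)) ->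
  (forall x, a <= x <= b -> nc (v x) <= M) -> nc (V b - V a) <= 2 * M * (b - a).
Proof.
move=> ab dV hM; rewrite (le_trans (nc_le_ReIm _))//.
rewrite Re_add Re_opp Im_add Im_opp -mulrA mulr2n mulrDl mul1r.
apply: lerD.
  apply: (@real_increment_bound (fun x => Re (V x)) (fun x => Re (v x))) => // x xab.
    by have [] := dV _ xab.
  by rewrite (le_trans (nc_Re _))// hM.
apply: (@real_increment_bound (fun x => Im (V x)) (fun x => Im (v x))) => // x xab.
  by have [] := dV _ xab.
by rewrite (le_trans (nc_Im _))// hM.
Qed.

Lemma cderiv0_eq V a b : a <= b -> (forall x, a <= x <= b -> cderiv V x 0) ->
  V b = V a.
Proof.
move=> ab dV; apply/eqP; rewrite -subr_eq0 -nc_eq0 eq_le nc_ge0 andbT.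
rewrite (le_trans (@cderiv_bound V (fun _ => 0) 0 a b ab dV _))//.
  by move=> x _; rewrite nc0.
by rewrite mulr0 mul0r.
Qed.

Lemma cderivB u v x du dv : cderiv u x du -> cderiv v x dv ->
  cderiv (fun t => u t - v t) x (du - dv).
Proof.
move=> hu hv; apply: cderivD => //.
have -> : - dv = -1 * dv by rewrite mulN1r.
have -> : (fun t => - v t) = (fun t => -1 * v t).
  by apply/funext => t; rewrite mulN1r.
exact: cderivZ.
Qed.

(** Integrals of curves are increments of a chosen primitive, so their properties follow from
    [cderiv0_eq]. For continuous u the default value of [xget] is never taken. *)
Definition cprim u : R -> R[i] :=
  xget (fun _ => 0) [set V | forall x, 0 <= x -> cderiv V x (u x)].

Lemma cprimP u : ccts u -> forall x, 0 <= x -> cderiv (cprim u) x (u x).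
Proof.
move=> cu; rewrite /cprim; case: xgetP => [V _ //|].
by have [V hV] := complex_primitive cu => /(_ V).
Qed.

Definition cint h u : R[i] := cprim u h - cprim u 0.

Lemma cint_primitive h u V : 0 <= h -> ccts u ->
  (forall x, 0 <= x <= h -> cderiv V x (u x)) -> cint h u = V h - V 0.
Proof.
move=> h0 cu hV.
suff : cprim u h - V h = cprim u 0 - V 0.
  move=> /eqP; rewrite subr_eq => /eqP e; rewrite /cint e; ring.
apply: (@cderiv0_eq (fun x => cprim u x - V x)) => // x xh.
apply: cderiv_eq; last exact: (subrr (u x)).
apply: cderivB (hV _ xh); apply: cprimP => //; by case/andP: xh.
Qed.

Lemma cint_bound h u M : 0 <= h -> ccts u ->
  (forall t, 0 <= t <= h -> nc (u t) <= M) -> nc (cint h u) <= 2 * M * h.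
Proof.
move=> h0 cu hM; rewrite -[X in _ * X]subr0; apply: (cderiv_bound h0 _ hM).
by move=> x /andP[x0 _]; exact: cprimP.
Qed.

Lemma cintD h u v : 0 <= h -> ccts u -> ccts v ->
  cint h (fun t => u t + v t) = cint h u + cint h v.
Proof.
move=> h0 cu cv.
rewrite (@cint_primitive h _ (fun x => cprim u x + cprim v x))//.
- by rewrite /cint; ring.
- exact: cctsD.
- by move=> x /andP[x0 _]; apply: cderivD; exact: cprimP.
Qed.

Lemma cintZ h c u : 0 <= h -> ccts u ->
  cint h (fun t => c * u t) = c * cint h u.
Proof.
move=> h0 cu; rewrite (@cint_primitive h _ (fun x => c * cprim u x))//.
- by rewrite -mulrBr.
- by apply: cctsM => //; exact: ccts_cst.
- by move=> x /andP[x0 _]; apply: cderivZ; exact: cprimP.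
Qed.

Lemma cint_cst h c : 0 <= h -> cint h (fun _ => c) = c * h%:C.
Proof.
move=> h0; rewrite (@cint_primitive h _ (fun x => c * x%:C))//.
- by rewrite mulr0 subr0.
- exact: ccts_cst.
- move=> x _; apply: cderiv_eq.
    apply: cderivZ; apply: cderiv_real; exact: is_derive_id.
  by rewrite mulr1.
Qed.

Lemma ccts_sum (I : Type) (s : seq I) (F : I -> R -> R[i]) :
  (forall i, ccts (F i)) -> ccts (fun t => \sum_(i <- s) F i t).
Proof.
move=> h; elim: s => [|i s IH].
  by under eq_fun do rewrite big_nil; exact: ccts_cst.
by under eq_fun do rewrite big_cons; exact: cctsD.
Qed.

Lemma cint_sum h (I : Type) (s : seq I) (F : I -> R -> R[i]) : 0 <= h ->
  (forall i, ccts (F i)) ->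
  cint h (fun t => \sum_(i <- s) F i t) = \sum_(i <- s) cint h (F i).
Proof.
move=> h0 cF; elim: s => [|i s IH].
  under eq_fun do rewrite big_nil.
  by rewrite cint_cst// mul0r big_nil.
rewrite big_cons -IH -cintD//; last exact: ccts_sum.
by congr cint; apply/funext => t; rewrite big_cons.
Qed.

End CurveCalculus.

(** * Goursat's subdivision for differential forms on a square *)

Section Goursat.
Context {R : realType}.

Lemma nested_intervals (x h : nat -> R) :
  (forall k, x k <= x k.+1) -> (forall k, x k.+1 + h k.+1 <= x k + h k) ->
  (forall k, 0 <= h k) -> exists l, forall k, x k <= l <= x k + h k.
Proof.
move=> hx hxh h0.
have mx : {homo x : i j / (i <= j)%N >-> i <= j} by exact: homo_leq le_trans hx.
have mh i j : (i <= j)%N -> x j + h j <= x i + h i.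
  elim: j => [|j IH]; first by rewrite leqn0 => /eqP ->.
  by rewrite leq_eqVlt => /predU1P[->//|/IH]; exact: le_trans.
have ub k : ubound (range x) (x k + h k).
  move=> _ [j _ <-]; have [kj|jk] := leqP k j.
    by rewrite (le_trans _ (mh _ _ kj))// lerDl.
  by rewrite (le_trans (mx _ _ (ltnW jk)))// lerDl.
exists (sup (range x)) => k; apply/andP; split.
  by apply: ub_le_sup; [exists (x 0%N + h 0%N); exact: ub|exists k].
by apply: ge_sup; [exists (x 0%N), 0%N|exact: ub].
Qed.

Variables P Q : R -> R -> R[i].

(** The integral of P ds + Q dt along the counterclockwise boundary of [s, s + h] x [t, t + h], each
    edge being the increment of a primitive. *)
Definition square_int (s t h : R) : R[i] :=
  (cprim (Q (s + h)) (t + h) - cprim (Q (s + h)) t) -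
  (cprim (Q s) (t + h) - cprim (Q s) t) -
  ((cprim (P^~ (t + h)) (s + h) - cprim (P^~ (t + h)) s) -
   (cprim (P^~ t) (s + h) - cprim (P^~ t) s)).

Lemma square_int_split s t h : square_int s t (h + h) =
  square_int s t h + square_int (s + h) t h + square_int s (t + h) h +
  square_int (s + h) (t + h) h.
Proof. rewrite /square_int !addrA; ring. Qed.

Hypothesis ctsP : forall t, ccts (P^~ t).
Hypothesis ctsQ : forall s, ccts (Q s).

(** Near (s0, t0) the form P ds + Q dt differs from an exact form du by at most e times the
    distance. For a pull-back of phi(z) dz / (z - w), linearising phi at one point provides u. *)
Definition nearly_exact (e s0 t0 d : R) := exists u P' Q',
  [/\ forall s t, 0 <= s -> 0 <= t -> cderiv (u^~ t) s (P' s t),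
      forall s t, 0 <= s -> 0 <= t -> cderiv (u s) t (Q' s t) &
      forall s t, 0 <= s -> 0 <= t -> `|s - s0| <= d -> `|t - t0| <= d ->
        nc (P s t - P' s t) <= e * (`|s - s0| + `|t - t0|) /\
        nc (Q s t - Q' s t) <= e * (`|s - s0| + `|t - t0|)].

(** The exact part contributes 0. On each of the four edges, of length h, the remainder is at most 2
    e h and its integral at most 2 (2 e h) h. *)
Lemma square_int_local e s0 t0 d s t h : 0 <= e -> nearly_exact e s0 t0 d ->
  0 <= s -> 0 <= t -> 0 <= h <= d -> s <= s0 <= s + h -> t <= t0 <= t + h ->
  nc (square_int s t h) <= 16 * e * h ^+ 2.
Proof.
move=> e0 [u [P' [Q' [dP dQ PQ]]]] s_ge0 t_ge0 /andP[h0 hd] /andP[s1 s2] /andP[t1 t2].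
have close s' t' : s <= s' <= s + h -> t <= t' <= t + h ->
    nc (P s' t' - P' s' t') <= e * (2 * h) /\ nc (Q s' t' - Q' s' t') <= e * (2 * h).
  move=> /andP[a b] /andP[c f].
  have h1 : `|s' - s0| <= h by rewrite ler_norml; apply/andP; split; lra.
  have h2 : `|t' - t0| <= h by rewrite ler_norml; apply/andP; split; lra.
  have [] := PQ s' t' _ _ (le_trans h1 hd) (le_trans h2 hd); try lra.
  have le : e * (`|s' - s0| + `|t' - t0|) <= e * (2 * h).
    by rewrite ler_wpM2l// mulr_natl mulr2n lerD.
  by move=> p q; split; exact: le_trans le.
have edgeQ s' : s <= s' <= s + h ->
    nc ((cprim (Q s') (t + h) - cprim (Q s') t) - (u s' (t + h) - u s' t)) <=
      2 * (e * (2 * h)) * h.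
  move=> hs'; have -> : forall a b c d : R[i], a - b - (c - d) = (a - c) - (b - d).
    by move=> *; ring.
  have := @cderiv_bound _ (fun x => cprim (Q s') x - u s' x)
     (fun x => Q s' x - Q' s' x) (e * (2 * h)) t (t + h).
  rewrite [t + h - t]addrAC subrr add0r; apply; first by rewrite lerDl.
    move=> x /andP[tx xt]; apply: cderivB; first by apply: cprimP => //; lra.
    by apply: dQ; case/andP: hs' => *; lra.
  by move=> x hx; case: (close s' x hs' hx).
have edgeP t' : t <= t' <= t + h ->
    nc ((cprim (P^~ t') (s + h) - cprim (P^~ t') s) - (u (s + h) t' - u s t')) <=
      2 * (e * (2 * h)) * h.
  move=> ht'; have -> : forall a b c d : R[i], a - b - (c - d) = (a - c) - (b - d).
    by move=> *; ring.
  have := @cderiv_bound _ (fun x => cprim (P^~ t') x - u x t')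
     (fun x => P x t' - P' x t') (e * (2 * h)) s (s + h).
  rewrite [s + h - s]addrAC subrr add0r; apply; first by rewrite lerDl.
    move=> x /andP[tx xt]; apply: cderivB; first by apply: cprimP => //; lra.
    by apply: dP; case/andP: ht' => *; lra.
  by move=> x hx; case: (close x t' hx ht').
have hs : s <= s <= s + h by rewrite lexx lerDl.
have hsh : s <= s + h <= s + h by rewrite lexx lerDl h0.
have ht : t <= t <= t + h by rewrite lexx lerDl.
have hth : t <= t + h <= t + h by rewrite lexx lerDl h0.
have -> : square_int s t h =
  ((cprim (Q (s + h)) (t + h) - cprim (Q (s + h)) t) - (u (s + h) (t + h) - u (s + h) t)) -
  ((cprim (Q s) (t + h) - cprim (Q s) t) - (u s (t + h) - u s t)) -
  (((cprim (P^~ (t + h)) (s + h) - cprim (P^~ (t + h)) s) - (u (s + h) (t + h) - u s (t + h))) -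
   ((cprim (P^~ t) (s + h) - cprim (P^~ t) s) - (u (s + h) t - u s t))).
  by rewrite /square_int; ring.
have -> : 16 * e * h ^+ 2 = 2 * (e * (2 * h)) * h + 2 * (e * (2 * h)) * h +
  (2 * (e * (2 * h)) * h + 2 * (e * (2 * h)) * h) by ring.
apply: (le_trans (ncB _ _)); apply: lerD.
  by apply: (le_trans (ncB _ _)); apply: lerD; exact: edgeQ.
by apply: (le_trans (ncB _ _)); apply: lerD; exact: edgeP.
Qed.

(** One of the four quarters carries at least a quarter of the integral. Iterating, the squares
    shrink to a point (s0, t0), where [square_int_local] bounds the k-th integral by 16 e (h /
    2^k)^2; this compensates the factor 4^k, and e is arbitrary. *)
Lemma goursat h : 0 <= h ->
  (forall s0 t0 e, 0 <= s0 -> 0 <= t0 -> 0 < e ->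
     exists2 d, 0 < d & nearly_exact e s0 t0 d) ->
  square_int 0 0 h = 0.
Proof.
move=> h0 loc.
(* The triple consists of the corner (s, t) and the side; the guard on the side makes the statement
   true for all triples, as [choice] requires. *)
have step (x : R * R * R) : exists y : R * R * R,
    y.2 = x.2 / 2 /\ (0 <= x.2 ->
    [/\ x.1.1 <= y.1.1 <= x.1.1 + x.2 / 2, x.1.2 <= y.1.2 <= x.1.2 + x.2 / 2 &
      nc (square_int x.1.1 x.1.2 x.2) <= 4 * nc (square_int y.1.1 y.1.2 y.2)]).
  case: x => -[s t] k /=.
  have [k0|k0] := leP 0 k; last first.
    by exists (s, t, k / 2) => /=; split => //; rewrite leNgt k0.
  have := square_int_split s t (k / 2); rewrite -splitr.
  set a := square_int s t (k / 2); set b := square_int _ t (k / 2).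
  set c := square_int s _ (k / 2); set d := square_int _ _ (k / 2) => e.
  have : nc (square_int s t k) <= nc a + nc b + nc c + nc d.
    rewrite e (le_trans (ncD _ _))// lerD2r (le_trans (ncD _ _))// lerD2r.
    exact: ncD.
  have [ha|ha] := lerP (nc (square_int s t k)) (4 * nc a).
    by exists (s, t, k / 2) => /=; split => // _; split; lra.
  have [hb|hb] := lerP (nc (square_int s t k)) (4 * nc b).
    by exists (s + k / 2, t, k / 2) => /=; split => // _; split; lra.
  have [hc|hc] := lerP (nc (square_int s t k)) (4 * nc c).
    by exists (s, t + k / 2, k / 2) => /=; split => // _; split; lra.
  by exists (s + k / 2, t + k / 2, k / 2) => /=; split => // _; rewrite -/d; split; lra.
have [F HF] := choice step.
pose x k := iter k F (0, 0, h).
have xh k : (x k).2 = h / 2 ^+ k.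
  elim: k => [|k IH]; first by rewrite expr0 divr1.
  by rewrite /x iterS -/(x k); have [-> _] := HF (x k); rewrite IH exprSr invfM mulrA.
have xh0 k : 0 <= (x k).2 by rewrite xh divr_ge0// exprn_ge0.
have S1 k : (x k).1.1 <= (x k.+1).1.1 <= (x k).1.1 + (x k).2 / 2.
  by have [_ /(_ (xh0 k))[]] := HF (x k).
have T1 k : (x k).1.2 <= (x k.+1).1.2 <= (x k).1.2 + (x k).2 / 2.
  by have [_ /(_ (xh0 k))[]] := HF (x k).
have H1 k : (x k.+1).2 = (x k).2 / 2 by have [] := HF (x k).
have J1 k : nc (square_int 0 0 h) <= 4 ^+ k *
    nc (square_int (x k).1.1 (x k).1.2 (x k).2).
  elim: k => [|k IH]; first by rewrite expr0 mul1r.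
  rewrite (le_trans IH)// exprSr -mulrA ler_wpM2l// ?exprn_ge0//.
  by have [_ /(_ (xh0 k))[]] := HF (x k).
have [s0 hs0] : exists l, forall k, (x k).1.1 <= l <= (x k).1.1 + (x k).2.
  apply: (@nested_intervals (fun k => (x k).1.1) (fun k => (x k).2)) => // k.
  - by have /andP[] := S1 k.
  - by rewrite H1; have /andP[_] := S1 k; lra.
have [t0 ht0] : exists l, forall k, (x k).1.2 <= l <= (x k).1.2 + (x k).2.
  apply: (@nested_intervals (fun k => (x k).1.2) (fun k => (x k).2)) => // k.
  - by have /andP[] := T1 k.
  - by rewrite H1; have /andP[_] := T1 k; lra.
have x0 k : 0 <= (x k).1.1 /\ 0 <= (x k).1.2.
  elim: k => [//|k [a b]]; split.
    by have /andP[+ _] := S1 k; exact: le_trans.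
  by have /andP[+ _] := T1 k; exact: le_trans.
have small e : 0 < e -> nc (square_int 0 0 h) <= 16 * e * h ^+ 2.
  move=> e0.
  have [||d d0 near] := loc s0 t0 e _ _ e0.
  - by have /andP[+ _] := hs0 0%N; apply: le_trans; case: (x0 0%N).
  - by have /andP[+ _] := ht0 0%N; apply: le_trans; case: (x0 0%N).
  have [k hk] : exists k, h / 2 ^+ k <= d.
    have [k hk] : exists k : nat, h / d < k%:R.
      by have [k _ /(_ _ (leqnn k))] := nbhs_infty_gtr (h / d); exists k.
    exists k; rewrite ler_pdivrMr ?exprn_gt0// mulrC -ler_pdivrMr//.
    rewrite (le_trans (ltW hk))// -natrX ler_nat ltnW//; exact: ltn_expl.
  rewrite (le_trans (J1 k))//.
  have [a b] := x0 k.
  have hx : 0 <= (x k).2 <= d by rewrite xh0 xh.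
  have := square_int_local (ltW e0) near a b hx (hs0 k) (ht0 k).
  move=> /(ler_wpM2l (exprn_ge0 k (ler0n R 4))) /le_trans; apply.
  rewrite xh expr_div_n -exprM mulnC exprM.
  have -> : (2 : R) ^+ 2 = 4 by ring.
  have : (4 : R) ^+ k != 0 by rewrite expf_neq0.
  by move: (4 ^+ k) => q q0; apply: eqr_le; field.
apply/eqP; rewrite -nc_eq0 eq_le nc_ge0 andbT leNgt; apply/negP => Jpos.
(* Then 16 e h^2 is half the integral times h^2 / (h^2 + 1), hence smaller than the integral; the
   summand 1 covers h = 0. *)
pose e := nc (square_int 0 0 h) / (32 * (h ^+ 2 + 1)).
have hh : 0 < h ^+ 2 + 1 by rewrite ltr_wpDl// sqr_ge0.
have /small : 0 < e by rewrite divr_gt0// mulr_gt0.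
rewrite leNgt => /negP; apply.
rewrite /e; set J := nc _ in Jpos *.
have -> : 16 * (J / (32 * (h ^+ 2 + 1))) * h ^+ 2 = (J / 2) * (h ^+ 2 / (h ^+ 2 + 1)).
  by field; rewrite gt_eqF.
apply: (@le_lt_trans _ _ (J / 2 * 1)); last by lra.
rewrite ler_wpM2l//; first by lra.
by rewrite ler_pdivrMr// mul1r lerDl.
Qed.

End Goursat.

(** * Cauchy's formula on a circle *)

Section CauchyFormula.
Context {R : realType}.
Implicit Types (phi : R[i] -> R[i]) (z w : R[i]).

(** Complex differentiability with real epsilons and the real-valued modulus; [differentiable_line]
    and [cdiff_differentiable] relate it to [differentiable]. *)
Definition cdiff phi z := exists d : R[i], forall e : R, 0 < e ->
  exists2 r, 0 < r & forall x, nc (x - z) < r ->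
    nc (phi x - phi z - d * (x - z)) <= e * nc (x - z).

Lemma cdiff_continuous phi z : cdiff phi z -> forall e, 0 < e ->
  exists2 r, 0 < r & forall x, nc (x - z) < r -> nc (phi x - phi z) < e.
Proof.
move=> [d hd] e e0; have [r r0 H] := hd 1 ltr01.
have d1 : 0 < nc d + 1 by rewrite ltr_wpDl// nc_ge0.
exists (Num.min r (e / (nc d + 1))) => [|x]; first by rewrite lt_min r0 divr_gt0.
rewrite lt_min ltr_pdivlMr// => /andP[/H h1 h2].
rewrite -(subrK (d * (x - z)) (phi x - phi z)).
rewrite (le_lt_trans (ncD _ _))// (le_lt_trans _ h2)//.
by move: h1; rewrite [nc (d * _)]ncM; set a := nc _; set b := nc (x - z); nra.
Qed.

Lemma ccts_comp phi (u : R -> R[i]) : ccts u -> (forall x, cdiff phi (u x)) ->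
  ccts (fun x => phi (u x)).
Proof.
move=> cu dphi; apply: ccts_eps => x e e0.
have [r r0 h1] := cdiff_continuous (dphi x) e0.
have [d d0 h2] := ccts_epsE cu x r0.
by exists d => // y /h2/h1.
Qed.

Lemma nc_i : nc ('i%C : R[i]) = 1.
Proof. by rewrite /= expr0n /= add0r expr1n sqrtr1. Qed.

Definition circ (r t : R) : R[i] := (r%:C * ((cos t) +i* (sin t))%C).
(** The inverse of [circ r t] in closed form, so that its derivative comes from those of cos and
    sin. *)
Definition circV (r t : R) : R[i] := ((r^-1)%:C * ((cos t) +i* (- sin t))%C).

Lemma nc_circ r t : 0 <= r -> nc (circ r t) = r.
Proof.
move=> r0; rewrite /circ ncM nc_real ger0_norm//=.
by rewrite cos2Dsin2 sqrtr1 mulr1.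
Qed.

Lemma circK r t : r != 0 -> circ r t * circV r t = 1.
Proof.
move=> r0; rewrite /circ /circV mulrACA -rmorphM divff// rmorph1 mul1r.
apply: complex_ext; rewrite ?Re_mul ?Im_mul /=; last by ring.
by rewrite mulrN opprK -!expr2 cos2Dsin2.
Qed.

Lemma circ_neq0 r t : r != 0 -> circ r t != 0.
Proof.
move=> r0; apply/eqP => c0; have := circK t r0.
by rewrite c0 mul0r => /eqP; rewrite eq_sym oner_eq0.
Qed.

Lemma circVE r t : r != 0 -> circV r t = (circ r t)^-1.
Proof.
move=> r0; have c0 := circ_neq0 t r0; apply: (mulfI c0).
by rewrite circK// mulfV.
Qed.

Lemma cderiv_circ r t : cderiv (circ r) t ('i%C * circ r t).
Proof.
have h : cderiv (fun s => (cos s +i* sin s)%C) t (- sin t +i* cos t)%C.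
  by split; [exact: is_derive_cos|exact: is_derive_sin].
apply: (cderiv_eq (cderivZ _ h)).
rewrite /circ mulrCA; congr (_ * _).
by apply: complex_ext; rewrite ?Re_mul ?Im_mul /=; ring.
Qed.

Lemma cderiv_circV r t : cderiv (circV r) t (- 'i%C * circV r t).
Proof.
have h : cderiv (fun s => (cos s +i* - sin s)%C) t (- sin t +i* - cos t)%C.
  split; first exact: is_derive_cos.
  exact: (is_deriveN (is_derive_sin t)).
apply: (cderiv_eq (cderivZ _ h)).
rewrite /circV mulrCA; congr (_ * _).
by apply: complex_ext; rewrite ?Re_mul ?Im_mul /=; ring.
Qed.

Lemma ccts_circ r : ccts (circ r).
Proof. by apply: cderiv_ccts => t; exact: cderiv_circ. Qed.

Lemma ccts_circV r : ccts (circV r).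
Proof. by apply: cderiv_ccts => t; exact: cderiv_circV. Qed.

Let tau : R := pi *+ 2.

Lemma tau_gt0 : 0 < tau.
Proof. by rewrite /tau pmulrn_lgt0// pi_gt0. Qed.

Lemma circ_tau r : circ r tau = circ r 0.
Proof. by rewrite /circ cos2pi sin2pi cos0 sin0. Qed.

Lemma circV_tau r : circV r tau = circV r 0.
Proof. by rewrite /circV cos2pi sin2pi cos0 sin0. Qed.

Lemma cctsX (u : R -> R[i]) n : ccts u -> ccts (fun t => u t ^+ n).
Proof.
move=> cu; elim: n => [|n IH].
  by under eq_fun do rewrite expr0; exact: ccts_cst.
by under eq_fun do rewrite exprS; exact: cctsM.
Qed.

Lemma cderiv_exp_powers (c : R[i]) u n t : cderiv u t (c * u t) ->
  cderiv (fun s => u s ^+ n) t (c * n%:R * u t ^+ n).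
Proof.
move=> du; elim: n => [|n IH].
  under eq_fun do rewrite expr0.
  by rewrite mulr0 mul0r; exact: cderiv_cst.
under eq_fun do rewrite exprS.
apply: (cderiv_eq (cderivM du IH)).
rewrite exprS -natr1; ring.
Qed.

Lemma cint_exp_powers (c : R[i]) u m : c != 0 -> (forall t, cderiv u t (c * u t)) ->
  u tau = u 0 -> cint tau (fun t => u t ^+ m) = (m == 0)%:R * tau%:C.
Proof.
move=> c0 du per; have t0 := ltW tau_gt0.
case: m => [|m]; first by under eq_fun do rewrite expr0; rewrite cint_cst.
have cm : c * m.+1%:R != 0 :> R[i] by rewrite mulf_neq0// pnatr_eq0.
rewrite (@cint_primitive _ _ _ (fun t => (c * m.+1%:R)^-1 * u t ^+ m.+1))//.
- by rewrite per subrr mul0r.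
- by apply: cctsX; exact: cderiv_ccts du.
- move=> x _; apply: (cderiv_eq (cderivZ _ (cderiv_exp_powers m.+1 (du x)))).
  by rewrite mulrA mulVf// mul1r.
Qed.

Lemma i_neq0 : 'i%C != 0 :> R[i].
Proof. by rewrite eq_complex /= oner_eq0 andbF. Qed.

Lemma cint_circX r m : cint tau (fun t => circ r t ^+ m) = (m == 0)%:R * tau%:C.
Proof. by apply: cint_exp_powers i_neq0 (cderiv_circ r) _; exact: circ_tau. Qed.

Lemma cint_circVX r m : cint tau (fun t => circV r t ^+ m) = (m == 0)%:R * tau%:C.
Proof.
apply: cint_exp_powers (cderiv_circV r) _; last exact: circV_tau.
by rewrite oppr_eq0 i_neq0.
Qed.

Section fixed_center.
Variables (phi : R[i] -> R[i]) (r : R) (w : R[i]).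
Hypothesis r0 : 0 < r.
Hypothesis wr : nc w < r.
Hypothesis dphi : forall z, nc z <= r -> cdiff phi z.

(** For z = [circ r t] one has dz = i z dt, so that i [ker t] dt is the Cauchy kernel dz / (z -
    w). *)
Let ker t := circ r t * (circ r t - w)^-1.

Let den_neq0 t : circ r t - w != 0.
Proof.
apply/eqP => /eqP; rewrite subr_eq0 => /eqP e.
by move: wr; rewrite -e nc_circ ?ltxx// ltW.
Qed.

Lemma nc_circB t : r - nc w <= nc (circ r t - w).
Proof.
rewrite lerBlDr -{1}(nc_circ t (ltW r0)) -{1}(subrK w (circ r t)).
exact: ncD.
Qed.

Lemma nc_ker t : nc (ker t) <= r / (r - nc w).
Proof.
rewrite /ker ncM ncV (nc_circ t (ltW r0)) (ler_wpM2l (ltW r0))//.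
by rewrite lef_pV2 ?posrE ?nc_gt0 ?subr_gt0// nc_circB.
Qed.

Lemma cctsV (u : R -> R[i]) : (forall t, u t != 0) -> ccts u ->
  ccts (fun t => (u t)^-1).
Proof.
move=> u0 [cr ci].
have sq_gt0 x : 0 < Re (u x) ^+ 2 + Im (u x) ^+ 2.
  rewrite lt0r addr_ge0 ?sqr_ge0// andbT; apply/eqP => e.
  have /eqP : nc (u x) = 0 by case: (u x) e => a b /= ->; rewrite sqrtr0.
  by rewrite nc_eq0 (negbTE (u0 x)).
have csq x : (fun x => Re (u x) ^+ 2 + Im (u x) ^+ 2) @ x --> Re (u x) ^+ 2 + Im (u x) ^+ 2.
  apply: cvgD.
    by under eq_fun do rewrite expr2; rewrite expr2; exact: (cvgM (cr x) (cr x)).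
  by under eq_fun do rewrite expr2; rewrite expr2; exact: (cvgM (ci x) (ci x)).
split => x.
  rewrite (_ : (fun _ => _) =
    (fun t => Re (u t) * (Re (u t) ^+ 2 + Im (u t) ^+ 2)^-1)); last first.
    by apply/funext => y; case: (u y).
  apply: (cvgM (cr x)); apply: cvgV (csq x); by rewrite gt_eqF.
rewrite (_ : (fun _ => _) =
  (fun t => (- Im (u t)) * (Re (u t) ^+ 2 + Im (u t) ^+ 2)^-1)); last first.
  by apply/funext => y; case: (u y) => a b /=; rewrite mulNr.
apply: (cvgM (cvgN (ci x))); apply: cvgV (csq x); by rewrite gt_eqF.
Qed.

Lemma ccts_ker : ccts ker.
Proof.
apply: cctsM; first exact: ccts_circ.
apply: cctsV => //; apply: cctsD; [exact: ccts_circ|exact: ccts_cst].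
Qed.

(* The circle of radius r is contracted to w along segments; the parameter s
   enters through exp (- k s^2) to stay on the segments for all real s. *)
Let sigma (k s : R) : R := expR (- k * s ^+ 2).
Let gam (k s t : R) : R[i] := w + (sigma k s)%:C * (circ r t - w).

Let sigma_gt0 (k s : R) : 0 < sigma k s. Proof. exact: expR_gt0. Qed.

Let sigma_le1 (k s : R) : 0 <= k -> sigma k s <= 1.
Proof.
by move=> k0; rewrite /sigma expR_le1 mulNr oppr_le0 mulr_ge0// sqr_ge0.
Qed.

Let nc_gam (k s t : R) : 0 <= k -> nc (gam k s t) <= r.
Proof.
move=> k0; have s1 := sigma_le1 s k0; have s0 := ltW (sigma_gt0 k s).
have -> : gam k s t = (1 - sigma k s)%:C * w + (sigma k s)%:C * circ r t.
  by rewrite /gam rmorphB rmorph1; ring.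
rewrite (le_trans (ncD _ _))// [nc (_ * w)]ncM [nc (_ * circ _ _)]ncM !nc_real.
rewrite (nc_circ t (ltW r0)).
rewrite (ger0_norm s0) ger0_norm ?subr_ge0//.
have : (1 - sigma k s) * nc w <= (1 - sigma k s) * r.
  by rewrite ler_wpM2l ?subr_ge0// ltW.
lra.
Qed.

Let dquad (k s : R) : is_derive s 1 (fun s : R => - k * s ^+ 2) (- (2 * k * s)).
Proof.
rewrite (_ : (fun s : R => _) = (fun _ : R => - k) * ((@id R) ^+ 2)); last first.
  by apply/funext => y.
apply: is_derive_eq (is_deriveM (is_derive_cst _ _ _) (is_deriveX _ (is_derive_id _ _))) _.
by rewrite /GRing.scale /= mulr0 addr0 expr1 mulr1; ring.
Qed.

Let dsigma (k s : R) : is_derive s 1 (sigma k) (- (2 * k * s) * sigma k s).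
Proof.
rewrite (_ : sigma k = expR \o (fun s => - k * s ^+ 2)) //.
apply: is_derive_eq (is_derive1_comp (is_derive_expR _) (dquad k s)) _.
by rewrite mulrC.
Qed.

Let gam_ds (k t s : R) : cderiv (gam k ^~ t) s
  ((- (2 * k * s) * sigma k s)%:C * (circ r t - w)).
Proof.
apply: cderiv_eq.
  apply: cderivD; first exact: cderiv_cst.
  apply: cderivM; last exact: cderiv_cst.
  exact: (cderiv_real (dsigma k s)).
by rewrite add0r mulr0 add0r mulrC.
Qed.

Let gam_dt (k s t : R) : cderiv (gam k s) t ((sigma k s)%:C * ('i%C * circ r t)).
Proof.
apply: cderiv_eq.
  apply: cderivD; first exact: cderiv_cst.
  apply: cderivZ; apply: cderivB; last exact: cderiv_cst.
  exact: cderiv_circ.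
by rewrite add0r subr0.
Qed.

Lemma cderiv_lip (V v : R -> R[i]) M a x y : 0 <= a ->
  (forall x, 0 <= x <= a -> cderiv V x (v x)) ->
  (forall x, 0 <= x <= a -> nc (v x) <= M) ->
  0 <= x <= a -> 0 <= y <= a -> nc (V y - V x) <= 2 * M * `|y - x|.
Proof.
move=> a0 dV hM; wlog xy : x y / x <= y => [hw hx hy|/andP[x0 xa] /andP[y0 ya]].
  have [/hw|/ltW /hw] := leP x y; first exact.
  by rewrite ncBC distrC; apply.
rewrite ger0_norm ?subr_ge0//; apply: (cderiv_bound xy) => z /andP[xz zy].
  by apply: dV; rewrite (le_trans x0)// (le_trans zy).
by apply: hM; rewrite (le_trans x0)// (le_trans zy).
Qed.

(** P ds + Q dt is the pull-back of phi(z) dz / (z - w) under z = [gam k s t]; the factor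
    [sigma k s] cancels in the quotient. *)
Let P (k s t : R) : R[i] := (- (2 * k * s))%:C * phi (gam k s t).
Let Q (k s t : R) : R[i] := phi (gam k s t) * ('i%C * ker t).

Let dphi_gam k s t : 0 <= k -> cdiff phi (gam k s t).
Proof. by move=> k0; apply: dphi; exact: nc_gam. Qed.

Let ctsP k t : 0 <= k -> ccts (P k ^~ t).
Proof.
move=> k0; apply: cctsM.
  apply: ccts_real => x; apply: cvgN; apply: cvgM; first exact: cvg_cst.
  exact: cvg_id.
apply: ccts_comp => [|x]; last exact: dphi_gam.
by apply: cderiv_ccts => x; exact: gam_ds.
Qed.

Let ctsQ k s : 0 <= k -> ccts (Q k s).
Proof.
move=> k0; apply: cctsM; last first.
  by apply: cctsM; [exact: ccts_cst|exact: ccts_ker].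
apply: ccts_comp => [|x]; last exact: dphi_gam.
by apply: cderiv_ccts => x; exact: gam_dt.
Qed.

Let gam_lip k s0 t0 s t : 0 <= k -> 0 <= s0 -> 0 <= t0 -> 0 <= s -> 0 <= t ->
  s <= s0 + 1 ->
  nc (gam k s t - gam k s0 t0) <=
    (8 * k * (s0 + 1) * r + 2 * r) * (`|s - s0| + `|t - t0|).
Proof.
move=> k0 s00 t00 s_ge0 t_ge0 ss0.
have -> : gam k s t - gam k s0 t0 =
  (gam k s t - gam k s0 t) + (gam k s0 t - gam k s0 t0) by ring.
apply: (le_trans (ncD _ _)).
have h1 : nc (gam k s t - gam k s0 t) <= 2 * (2 * k * (s0 + 1) * (2 * r)) * `|s - s0|.
  apply: (@cderiv_lip (gam k ^~ t) _ _ (s0 + 1)) => //; try lra.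
  - by move=> x _; exact: gam_ds.
  - move=> x /andP[x0 xs]; rewrite ncM nc_real normrM normrN.
    have sx0 := ltW (sigma_gt0 k x).
    rewrite !ger0_norm ?mulr_ge0//.
    apply: ler_pM; rewrite ?mulr_ge0// ?nc_ge0//.
      have h : 2 * k * x <= 2 * k * (s0 + 1) by rewrite ler_wpM2l// mulr_ge0.
      rewrite (le_trans _ h)// -[leRHS]mulr1 ler_wpM2l ?mulr_ge0//.
      exact: sigma_le1.
    rewrite (le_trans (ncB _ _))// (nc_circ t (ltW r0)) mulr_natl mulr2n lerD2l.
    exact: ltW.
have h2 : nc (gam k s0 t - gam k s0 t0) <= 2 * r * `|t - t0|.
  apply: (@cderiv_lip (gam k s0) _ _ (t + t0)) => //; try lra.
  - by move=> x _; exact: gam_dt.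
  - move=> x _; rewrite ncM nc_real [nc ('i%C * _)]ncM nc_i mul1r.
    rewrite ger0_norm ?(ltW (sigma_gt0 _ _))//.
    rewrite (nc_circ x (ltW r0)).
    by rewrite -[leRHS]mul1r ler_wpM2r ?sigma_le1// ltW.
apply: le_trans (lerD h1 h2) _.
set a := `|s - s0|; set b := `|t - t0|.
have a0 : 0 <= a by rewrite normr_ge0.
have b0 : 0 <= b by rewrite normr_ge0.
have s01 : 0 <= s0 + 1 by rewrite addr_ge0.
have c0 : 0 <= k * (s0 + 1) * r by rewrite (mulr_ge0 (mulr_ge0 k0 s01) (ltW r0)).
have : 0 <= (k * (s0 + 1) * r) * b by rewrite mulr_ge0.
have : 0 <= r * a by rewrite mulr_ge0// ltW.
lra.
Qed.

Let nc_iker t : nc ('i%C * ker t) <= r / (r - nc w).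
Proof.
by rewrite ncM nc_i mul1r; exact: nc_ker.
Qed.

(** With d the derivative of phi at [g0], phi(z) is close to A + d (z - w), where A is the value at
    w of the affine approximation. The form (A + d (z - w)) dz / (z - w) is exact: its primitive is
    A times a logarithm of z - w, here - k s^2 plus a primitive of i [ker], plus d z. L is the
    Lipschitz constant of [gam], and M bounds the factors of phi in P and Q. *)
Let loc k s0 t0 e : 0 <= k -> 0 <= s0 -> 0 <= t0 -> 0 < e ->
  exists2 d, 0 < d & nearly_exact (P k) (Q k) e s0 t0 d.
Proof.
move=> k0 s00 t00 e0.
have [d hd] := dphi_gam s0 t0 k0.
set g0 := gam k s0 t0 in hd.
pose L := 8 * k * (s0 + 1) * r + 2 * r.
pose M := 2 * k * (s0 + 1) + r / (r - nc w).
have s01 : 0 <= s0 + 1 by rewrite addr_ge0.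
have L0 : 0 < L.
  by rewrite ltr_wpDl ?mulr_gt0// (mulr_ge0 _ (ltW r0))// !mulr_ge0.
have rw : 0 < r / (r - nc w) by rewrite divr_gt0// subr_gt0.
have ks : 0 <= 2 * k * (s0 + 1) by rewrite !mulr_ge0.
have M0 : 0 < M by rewrite ltr_wpDl.
have [dl dl0 hdl] := hd (e / (L * M)) (divr_gt0 e0 (mulr_gt0 L0 M0)).
(* The bound 1 gives the range s <= s0 + 1 that [gam_lip] requires; 3 instead of 2 keeps [gam]
   strictly within [dl] of [g0]. *)
exists (Num.min 1 (dl / (3 * L))) => [|].
  by rewrite lt_min ltr01 divr_gt0// mulr_gt0.
pose A := phi g0 + d * (w - g0).
exists (fun s t => A * ((- k * s ^+ 2)%:C + cprim (fun t => 'i%C * ker t) t) +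
  d * gam k s t).
exists (fun s t => (- (2 * k * s))%:C * (A + d * (gam k s t - w))).
exists (fun s t => (A + d * (gam k s t - w)) * ('i%C * ker t)).
split.
- move=> s t s1 t1; apply: cderiv_eq.
    apply: cderivD; last by apply: cderivZ; exact: gam_ds.
    apply: cderivZ; apply: cderivD; last exact: cderiv_cst.
    exact: (cderiv_real (dquad k s)).
  rewrite /gam.
  rewrite [w + _]addrC addrK [in X in _ + X]rmorphM /=.
  move: (- (2 * k * s))%:C (sigma k s)%:C (circ r t) => x y c.
  by ring.
- move=> s t s1 t1; apply: cderiv_eq.
    apply: cderivD; last by apply: cderivZ; exact: gam_dt.
    apply: cderivZ; apply: cderivD; first exact: cderiv_cst.
    apply: cprimP => //.
    by apply: cctsM; [exact: ccts_cst|exact: ccts_ker].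
  rewrite /gam [w + _]addrC addrK add0r /ker; have := den_neq0 t.
  by move: (circ r t) ((sigma k s)%:C) => c x c0; field.
- move=> s t s1 t1 hs ht.
  have [hs1 hsd] : `|s - s0| <= 1 /\ `|s - s0| <= dl / (3 * L).
    by split; rewrite (le_trans hs)// ge_min lexx ?orbT.
  have htd : `|t - t0| <= dl / (3 * L).
    by rewrite (le_trans ht)// ge_min lexx ?orbT.
  have ss0 : s <= s0 + 1 by move: hs1; rewrite ler_norml => /andP[_]; lra.
  have hg := gam_lip k0 s00 t00 s1 t1 ss0; rewrite -/L -/g0 in hg.
  have hgd : nc (gam k s t - g0) < dl.
    apply: (le_lt_trans hg); apply: (@le_lt_trans _ _ (L * (2 * (dl / (3 * L))))).
      by rewrite ler_wpM2l ?(ltW L0)// mulr_natl mulr2n lerD.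
    have -> : L * (2 * (dl / (3 * L))) = dl * (2 / 3) by field; rewrite gt_eqF.
    by rewrite gtr_pMr//; lra.
  have err := hdl _ hgd.
  have eA : phi (gam k s t) - (A + d * (gam k s t - w)) =
    phi (gam k s t) - phi g0 - d * (gam k s t - g0) by rewrite /A; ring.
  have key : nc (phi (gam k s t) - (A + d * (gam k s t - w))) * M <=
      e * (`|s - s0| + `|t - t0|).
    rewrite eA -ler_pdivlMr//; apply: (le_trans err).
    rewrite -!mulrA ler_wpM2l ?(ltW e0)// invfM -!mulrA ler_pdivrMl//.
    rewrite mulrA [leLHS]mulrC ler_wpM2r ?invr_ge0 ?(ltW M0)//.
  have n0 := nc_ge0 (phi (gam k s t) - (A + d * (gam k s t - w))).
  split; apply: le_trans key.
    rewrite /P -mulrBr ncM mulrC ler_wpM2l// nc_real normrN.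
    rewrite ger0_norm ?mulr_ge0// /M; apply: (@le_trans _ _ (2 * k * (s0 + 1))).
      by rewrite ler_wpM2l// mulr_ge0.
    by rewrite lerDl ltW.
  rewrite /Q -mulrBl ncM ler_wpM2l//.
  by rewrite (le_trans (nc_iker t))// /M lerDr.
Qed.

(** The circle is closed, so P takes the same values on the edges t = 0 and t = tau and their
    contributions cancel. The range of s is [0, tau] only to have a square. *)
Let homotopy k : 0 <= k -> cint tau (Q k 0) = cint tau (Q k tau).
Proof.
move=> k0; have t0 := ltW tau_gt0.
have := goursat (fun t => ctsP t k0) (fun s => ctsQ s k0) t0
  (fun s0 t0 e => @loc k s0 t0 e k0).
rewrite /square_int !add0r.
have -> : P k ^~ tau = P k ^~ 0.
  by apply/funext => s; rewrite /P /gam circ_tau.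
rewrite [X in _ - X]subrr [LHS]subr0 => /eqP; rewrite subr_eq0 => /eqP h.
exact: esym h.
Qed.

(** The circle (s = 0) can be replaced by the contracted curve (s = tau), on which phi is within e
    of [phi w]. The speed k is chosen after e, and the integral over the circle does not depend on
    it. *)
Lemma cauchy_kernel : cint tau (fun t => phi (circ r t) * ker t) =
  phi w * cint tau ker.
Proof.
have t0 := ltW tau_gt0.
have cker := ccts_ker.
have cik : ccts (fun t => 'i%C * ker t) by apply: cctsM => //; exact: ccts_cst.
have ccirc : ccts (fun t => phi (circ r t)).
  apply: ccts_comp => [|x]; first exact: ccts_circ.
  by apply: dphi; rewrite (nc_circ x (ltW r0)).
suff : cint tau (fun t => phi (circ r t) * ('i%C * ker t)) =
       phi w * cint tau (fun t => 'i%C * ker t).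
  rewrite (@cintZ _ tau)//; under eq_fun do rewrite mulrCA.
  rewrite cintZ//; last exact: cctsM.
  by rewrite mulrCA => /(mulfI i_neq0).
apply/eqP; rewrite -subr_eq0 -nc_eq0 eq_le nc_ge0 andbT leNgt; apply/negP => D0.
set D := nc _ in D0.
pose K := r / (r - nc w).
have K0 : 0 < K by rewrite divr_gt0// subr_gt0.
(* K bounds the kernel, so the difference of the integrals is at most 2 e K tau = D / 2, which
   contradicts D > 0. *)
pose e := D / (4 * K * tau).
have tp : 0 < tau := tau_gt0.
have e0 : 0 < e by rewrite (divr_gt0 D0)// (mulr_gt0 _ tp)// (mulr_gt0 _ K0).
have [dl dl0 hdl] := cdiff_continuous (dphi (ltW wr)) e0.
(* Since exp (- x) <= 1 / (1 + x) with x = k tau^2 = 2 r / dl, the contracted curve stays within 2 r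
   / (1 + 2 r / dl) < dl of w. *)
pose k := 2 * r / dl / tau ^+ 2.
have k0 : 0 <= k by rewrite !divr_ge0 ?mulr_ge0// ?exprn_ge0// ltW.
have Q0 : Q k 0 = (fun t => phi (circ r t) * ('i%C * ker t)).
  apply/funext => t; rewrite /Q /gam /sigma expr0n mulr0 expR0 mul1r.
  by rewrite addrC subrK.
have close t : nc (gam k tau t - w) < dl.
  rewrite /gam addrC addKr ncM nc_real ger0_norm ?(ltW (sigma_gt0 _ _))//.
  have h1 : nc (circ r t - w) <= 2 * r.
    by rewrite (le_trans (ncB _ _))// (nc_circ t (ltW r0)) mulr_natl mulr2n lerD2l ltW.
  have h2 : sigma k tau <= (1 + 2 * r / dl)^-1.
    rewrite /sigma mulNr expRN lef_pV2 ?posrE ?expR_gt0//; last first.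
      by rewrite ltr_wpDr// divr_ge0// ?mulr_ge0// ltW.
    rewrite (_ : 2 * r / dl = k * tau ^+ 2) ?expR_ge1Dx//.
    by rewrite /k divfK// expf_neq0// gt_eqF// tau_gt0.
  apply: (@le_lt_trans _ _ ((1 + 2 * r / dl)^-1 * (2 * r))).
    by apply: ler_pM => //; [exact: ltW|exact: nc_ge0].
  have r2 : 0 < 2 * r / dl by rewrite divr_gt0// mulr_gt0.
  rewrite mulrC ltr_pdivrMr; last by lra.
  rewrite mulrDr mulr1 mulrCA mulfV ?gt_eqF// mulr1; lra.
have : cint tau (Q k tau) - phi w * cint tau (fun t => 'i%C * ker t) =
   cint tau (fun t => (phi (gam k tau t) - phi w) * ('i%C * ker t)).
  under [in RHS]eq_fun do rewrite mulrBl -mulNr.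
  rewrite cintD//; last first.
  - by apply: cctsM => //; exact: ccts_cst.
  - exact: ctsQ.
  by rewrite (cintZ (- phi w) t0 cik) mulNr.
rewrite -homotopy// Q0 => E.
have : D <= 2 * (e * K) * tau.
  rewrite /D E; apply: cint_bound => //.
    apply: cctsM => //; apply: cctsD; last exact: ccts_cst.
    apply: ccts_comp => [|x]; last exact: dphi_gam.
    by apply: cderiv_ccts => x; exact: gam_dt.
  move=> t _; rewrite ncM; apply: ler_pM; rewrite ?nc_ge0//.
  by apply: ltW; apply: hdl.
have -> : 2 * (e * K) * tau = D / 2.
  rewrite /e; have := gt_eqF tp; have := gt_eqF K0.
  by move: (tau) (K) => a b b0 a0; field; rewrite a0 b0.
by lra.
Qed.

End fixed_center.
End CauchyFormula.

(** * Taylor coefficients and Cauchy estimates *)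

Section TaylorSeries.
Context {R : realType}.
Implicit Types (phi : R[i] -> R[i]) (z w : R[i]) (c : nat -> R[i]).

Lemma pow_cvg0 (x e : R) : 0 <= x < 1 -> 0 < e -> exists N : nat,
  forall n, (N <= n)%N -> x ^+ n < e.
Proof.
move=> /andP[x0 x1] e0.
have : (fun n => x ^+ n) @ \oo --> 0 by apply: cvg_expr; rewrite ger0_norm.
move=> /cvgrPdist_lt/(_ _ e0)[N _ h]; exists N => n Nn.
by have := h n Nn; rewrite sub0r normrN ger0_norm// exprn_ge0.
Qed.

(** The usual substitute for a passage to the limit in what follows: two sums are equal when their
    distance is at most C x^N for every N. *)
Lemma le_geom_eq0 (a C x : R) : 0 <= x < 1 -> 0 <= a ->
  (forall N : nat, a <= C * x ^+ N) -> a = 0.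
Proof.
move=> x01 a0 h; apply/eqP; rewrite eq_le a0 andbT leNgt; apply/negP => apos.
have C0 : 0 < C + 1.
  by have := h 0%N; rewrite expr0 mulr1 => aC; lra.
have [N /(_ N (leqnn N)) hN] := pow_cvg0 x01 (divr_gt0 apos C0).
have := h N; rewrite leNgt => /negP; apply.
have /andP[x0 _] := x01.
apply: (@le_lt_trans _ _ ((C + 1) * x ^+ N)).
  by rewrite ler_wpM2r ?exprn_ge0//; lra.
by rewrite mulrC -ltr_pdivlMr.
Qed.

Lemma geometric_remainder (z w : R[i]) N : z != 0 -> z != w ->
  z * (z - w)^-1 = \sum_(m < N) w ^+ m * z^-1 ^+ m +
    (w * z^-1) ^+ N * (z * (z - w)^-1).
Proof.
move=> z0; rewrite -subr_eq0 => zw; elim: N => [|N IH].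
  by rewrite big_ord0 add0r expr0 mul1r.
rewrite big_ord_recr /= [LHS]IH -addrA; congr (_ + _).
rewrite [in RHS]exprSr -exprMn; move: ((w * z^-1) ^+ N) => x.
by field; rewrite z0 zw.
Qed.

(** The kernel z / (z - w) is expanded into a geometric series with remainder under the integral.
    The coefficients are fixed before the bound M; the factor 2 is that of [cint_bound]. *)
Lemma taylor_circle phi r : 0 < r -> (forall z, nc z <= r -> cdiff phi z) ->
  exists c, forall M, (forall z, nc z = r -> nc (phi z) <= M) ->
    (forall N w, nc w < r -> nc (phi w - \sum_(m < N) c m * w ^+ m) <=
       2 * M * (nc w / r) ^+ N * (r / (r - nc w))) /\
    (forall m, nc (c m) <= 2 * M / r ^+ m).
Proof.
move=> r0 dphi; pose tau : R := pi *+ 2.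
have tp : 0 < tau := @tau_gt0 R; have t0 := ltW tp.
have tC : tau%:C != 0 by rewrite -nc_gt0 nc_real gtr0_norm.
have rn : r != 0 by rewrite gt_eqF.
have cc : ccts (fun t => phi (circ r t)).
  apply: ccts_comp => [|x]; first exact: ccts_circ.
  by apply: dphi; rewrite (nc_circ x (ltW r0)).
have cv m : ccts (fun t => circV r t ^+ m) by apply: cctsX; exact: ccts_circV.
exists (fun m => tau%:C^-1 * cint tau (fun t => phi (circ r t) * circV r t ^+ m)).
move=> M hM.
have M0 : 0 <= M.
  by rewrite (le_trans (nc_ge0 _) (hM (circ r 0) _))// nc_circ// ltW.
have nc_cv t m : nc (circV r t ^+ m) = (r ^+ m)^-1.
  by rewrite ncX circVE// ncV (nc_circ t (ltW r0)) exprVn.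
split => [N w wr|m]; last first.
  rewrite ncM ncV nc_real gtr0_norm// ler_pdivrMl//.
  apply: (@le_trans _ _ (2 * (M / r ^+ m) * tau)); last by rewrite mulrA [leRHS]mulrC.
  apply: cint_bound => //; first exact: cctsM.
  move=> t _; rewrite ncM nc_cv ler_wpM2r ?invr_ge0 ?exprn_ge0// ?(ltW r0)//.
  by apply: hM; rewrite (nc_circ t (ltW r0)).
pose ker t := circ r t * (circ r t - w)^-1.
have cker : ccts ker := ccts_ker r0 wr.
have w0 := nc_ge0 w.
have rw0 : 0 < r - nc w by rewrite subr_gt0.
have cw K : ccts (fun t => (w * circV r t) ^+ K).
  by apply: cctsX; apply: cctsM; [exact: ccts_cst|exact: ccts_circV].
have expand K (g : R -> R[i]) (B : R) : ccts g -> (forall t, nc (g t) <= B) -> 0 <= B ->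
    nc (cint tau (fun t => g t * ker t) -
        \sum_(m < K) w ^+ m * cint tau (fun t => g t * circV r t ^+ m)) <=
    2 * (B * (nc w / r) ^+ K * (r / (r - nc w))) * tau.
  move=> cg hB B0.
  have -> : (fun t => g t * ker t) = (fun t =>
      (\sum_(m < K) w ^+ m * (g t * circV r t ^+ m)) +
      g t * ((w * circV r t) ^+ K * ker t)).
    apply/funext => t; have cn0 := circ_neq0 t rn.
    have cnw : circ r t != w.
      by apply/eqP => e; move: wr; rewrite -e (nc_circ t (ltW r0)) ltxx.
    rewrite /ker [in LHS](geometric_remainder K cn0 cnw).
    rewrite mulrDr big_distrr /= circVE//; congr (_ + _).
    by apply: eq_bigr => m _; rewrite mulrCA.
  rewrite cintD//; last 2 first.
  - apply: ccts_sum => m; apply: cctsM; first exact: ccts_cst.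
    exact: cctsM.
  - by apply: cctsM => //; exact: cctsM.
  rewrite cint_sum//; last first.
    by move=> m; apply: cctsM; [exact: ccts_cst|exact: cctsM].
  have -> : \sum_(m < K) cint tau (fun t => w ^+ m * (g t * circV r t ^+ m)) =
     \sum_(m < K) w ^+ m * cint tau (fun t => g t * circV r t ^+ m).
    apply: eq_bigr => m _; apply: (cintZ _ t0); exact: cctsM.
  rewrite addrC addKr; apply: cint_bound => //.
    by apply: cctsM => //; exact: cctsM.
  move=> t _; rewrite [nc (g t * _)]ncM [nc (_ ^+ K * _)]ncM -mulrA.
  apply: ler_pM; rewrite ?mulr_ge0 ?nc_ge0//.
  apply: ler_pM; rewrite ?nc_ge0//; last exact: (nc_ker r0 wr).
  rewrite ncX [nc (w * _)]ncM circVE// [nc (circ r t)^-1]ncV.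
  by rewrite (nc_circ t (ltW r0)).
(* The integral of the kernel is found with the same expansion for the constant function 1: only the
   power 0 of [circV] has a non-zero integral. *)
have kerE : cint tau ker = tau%:C.
  apply/eqP; rewrite -subr_eq0 -nc_eq0; apply/eqP.
  apply: (@le_geom_eq0 _ (2 * (r / (r - nc w)) * tau * (nc w / r)) (nc w / r)).
  - by rewrite divr_ge0 ?(ltW r0)//= ltr_pdivrMr// mul1r.
  - exact: nc_ge0.
  move=> K; have := expand K.+1 (fun _ => 1) 1 (ccts_cst _) _ ler01.
  rewrite mul1r => /(_ (fun _ => _)); rewrite nc1 lexx => /(_ isT).
  have -> : (fun t => 1 * ker t) = ker by apply/funext => t; rewrite mul1r.
  have -> : \sum_(m < K.+1) w ^+ m * cint tau (fun t => 1 * circV r t ^+ m) = tau%:C.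
    rewrite big_ord_recl /= big1 ?addr0 => [|m _]; under eq_fun do rewrite mul1r.
      by rewrite cint_circVX /= expr0 !mul1r.
    by rewrite cint_circVX /= mul0r mulr0.
  by move/le_trans; apply; rewrite exprS; apply: eqr_le; ring.
have := @cauchy_kernel R phi r w r0 wr dphi; rewrite -/ker -/tau kerE => E.
have -> : phi w = tau%:C^-1 * cint tau (fun t => phi (circ r t) * ker t).
  by rewrite E mulrCA mulVf ?mulr1.
have -> : \sum_(m < N) tau%:C^-1 * cint tau (fun t => phi (circ r t) * circV r t ^+ m) * w ^+ m
  = tau%:C^-1 * \sum_(m < N) w ^+ m * cint tau (fun t => phi (circ r t) * circV r t ^+ m).
  by rewrite big_distrr /=; apply: eq_bigr => m _; rewrite mulrAC mulrA.
rewrite -mulrBr [nc _]ncM ncV nc_real gtr0_norm// ler_pdivrMl// [leRHS]mulrC.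
have -> : 2 * M * (nc w / r) ^+ N * (r / (r - nc w)) =
  2 * (M * (nc w / r) ^+ N * (r / (r - nc w))) by rewrite !mulrA.
apply: (expand N _ M cc _ M0) => t.
by apply: hM; rewrite (nc_circ t (ltW r0)).
Qed.

(** An asymptotic expansion at 0: it determines c, so coefficients computed on different circles can
    be identified without comparing integrals. *)
Definition is_taylor phi c := forall N, exists C d, [/\ 0 <= C, 0 < d &
  forall w, nc w < d -> nc (phi w - \sum_(m < N) c m * w ^+ m) <= C * nc w ^+ N].

(** The constant coefficient is O(t), hence 0; dividing by t lowers N by one. Only small positive
    real t are tested. *)
Lemma small_poly_eq0 N c : (exists C d, 0 < d /\ forall t : R, 0 < t < d ->
    nc (\sum_(m < N) c m * t%:C ^+ m) <= C * t ^+ N) ->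
  forall m, (m < N)%N -> c m = 0.
Proof.
elim: N c => [//|N IH] c [C [d [d0 hC]]].
pose p (t : R) := \sum_(m < N) c m.+1 * t%:C ^+ m.
have pE t : \sum_(m < N.+1) c m * t%:C ^+ m = c 0%N + t%:C * p t.
  rewrite big_ord_recl /= expr0 mulr1 big_distrr /=; congr (_ + _).
  by apply: eq_bigr => m _; rewrite exprS mulrCA.
pose D := \sum_(m < N) nc (c m.+1).
have D0 : 0 <= D by apply: sumr_ge0 => m _; exact: nc_ge0.
have pD t : 0 < t < 1 -> nc (p t) <= D.
  move=> /andP[t0 t1]; rewrite (le_trans (nc_sum _ _ _))//; apply: ler_sum => m _.
  rewrite ncM ncX nc_real gtr0_norm// ler_piMr ?nc_ge0//.
  by rewrite exprn_ile1// ltW.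
have c0 : c 0%N = 0.
  apply/eqP; rewrite -nc_eq0 eq_le nc_ge0 andbT leNgt; apply/negP => cpos.
  pose K := `|C| + D + 1.
  have K0 : 0 < K by rewrite ltr_wpDl ?addr_ge0.
  pose t := Num.min (d / 2) (Num.min (1 / 2) (nc (c 0%N) / (2 * K))).
  have t0 : 0 < t by rewrite !lt_min !divr_gt0// mulr_gt0.
  have td : t < d by rewrite /t gt_min ltr_pdivrMr// ltr_pMr// ltr1n.
  have t1 : t < 1 by rewrite /t !gt_min; apply/orP; right; apply/orP; left; lra.
  have tc : t * K <= nc (c 0%N) / 2.
    rewrite -ler_pdivlMr// /t !ge_min; apply/orP; right; apply/orP; right.
    by rewrite -mulrA -invfM.
  have := hC t; rewrite t0 td => /(_ isT); rewrite pE => h.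
  have : nc (c 0%N) <= t * K.
    rewrite -(addrK (t%:C * p t) (c 0%N)) (le_trans (ncB _ _))//.
    rewrite [nc (_%:C * _)]ncM nc_real gtr0_norm//.
    have h1 : C * t ^+ N.+1 <= t * `|C|.
      rewrite (@le_trans _ _ (`|C| * t ^+ N.+1))//.
        by rewrite ler_wpM2r ?ler_norm// exprn_ge0// ltW.
      rewrite exprS mulrCA ler_wpM2l ?(ltW t0)// ler_piMr//.
      by rewrite exprn_ile1// ltW.
    have h2 : t * nc (p t) <= t * D by rewrite ler_wpM2l ?(ltW t0)// pD// t0.
    by rewrite /K; lra.
  lra.
case=> [//|m]; rewrite ltnS => mN; apply: (IH (fun m => c m.+1)) mN.
exists C, d; split => // t /[dup] td /andP[t0 _].
have := hC t td; rewrite pE c0 add0r ncM nc_real gtr0_norm// -/(p t).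
by rewrite exprS mulrCA ler_pM2l.
Qed.

Lemma is_taylor_unique phi c c' : is_taylor phi c -> is_taylor phi c' -> c = c'.
Proof.
move=> hc hc'; apply/funext => m; apply/eqP; rewrite -subr_eq0; apply/eqP.
apply: (@small_poly_eq0 m.+1 (fun m => c m - c' m)) => //.
have [C [d [C0 d0 h]]] := hc m.+1; have [C' [d' [C'0 d'0 h']]] := hc' m.+1.
exists (C + C'), (Num.min d d'); split => [|t]; first by rewrite lt_min d0.
rewrite lt_min => /and3P[t0 td td'].
have nt : nc t%:C = t by rewrite nc_real gtr0_norm.
have -> : \sum_(k < m.+1) (c k - c' k) * t%:C ^+ k =
  (phi t%:C - \sum_(k < m.+1) c' k * t%:C ^+ k) -
  (phi t%:C - \sum_(k < m.+1) c k * t%:C ^+ k).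
  under eq_bigr do rewrite mulrBl.
  by rewrite sumrB; ring.
rewrite (le_trans (ncB _ _))// mulrDl addrC; apply: lerD.
  by have := h t%:C; rewrite nt; apply.
by have := h' t%:C; rewrite nt; apply.
Qed.

(** The coefficients are taken on one small circle, where continuity at 0 provides a bound. Each
    further circle has its own coefficients, equal to these by [is_taylor_unique], so its estimates
    hold for the same c. *)
Lemma taylor_exists phi R0 : 0 < R0 -> (forall z, nc z < R0 -> cdiff phi z) ->
  exists c, is_taylor phi c /\ forall r M, 0 < r < R0 ->
    (forall z, nc z = r -> nc (phi z) <= M) ->
    (forall N w, nc w < r -> nc (phi w - \sum_(m < N) c m * w ^+ m) <=
       2 * M * (nc w / r) ^+ N * (r / (r - nc w))) /\
    (forall m, nc (c m) <= 2 * M / r ^+ m).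
Proof.
move=> R00 dphi.
have circle r c M : 0 < r -> (forall N w, nc w < r ->
       nc (phi w - \sum_(m < N) c m * w ^+ m) <=
       2 * M * (nc w / r) ^+ N * (r / (r - nc w))) -> 0 <= M -> is_taylor phi c.
  move=> r0 h M0 N; exists (4 * M / r ^+ N), (r / 2); split.
  - by rewrite divr_ge0 ?mulr_ge0// exprn_ge0// ltW.
  - by rewrite divr_gt0.
  move=> w wr; have w0 := nc_ge0 w.
  have wr' : nc w < r by lra.
  rewrite (le_trans (h N w wr'))//.
  rewrite expr_div_n.
  have -> : 4 * M / r ^+ N * nc w ^+ N = 2 * M * (nc w ^+ N / r ^+ N) * 2.
    by field; rewrite expf_neq0// gt_eqF.
  rewrite ler_wpM2l//.
    by rewrite !mulr_ge0// ?invr_ge0 ?exprn_ge0// ltW.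
  by rewrite ler_pdivrMr; lra.
have local : exists r M, [/\ 0 < r < R0, 0 <= M & forall z, nc z = r -> nc (phi z) <= M].
  have d0 : cdiff phi 0 by apply: dphi; rewrite nc0.
  have [r r0 hr] := cdiff_continuous d0 ltr01.
  exists (Num.min (r / 2) (R0 / 2)), (nc (phi 0) + 1); split.
  - rewrite lt_min !divr_gt0//= gt_min; apply/orP; right; lra.
  - by rewrite addr_ge0 ?nc_ge0.
  - move=> z hz; rewrite -(subrK (phi 0) (phi z)) addrC.
    rewrite (le_trans (ncD _ _))// lerD2l ltW//; apply: hr.
    by rewrite subr0 hz gt_min; apply/orP; left; lra.
have [r1 [M1 [/andP[r10 r1R] M10 hM1]]] := local.
have [|c hc] := @taylor_circle phi r1 r10.
  by move=> z zr; apply: dphi; rewrite (le_lt_trans zr).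
have tc : is_taylor phi c.
  by have [h _] := hc M1 hM1; exact: (circle r1 c M1).
exists c; split => // r M /andP[r0 rR] hM.
have [|c' hc'] := @taylor_circle phi r r0.
  by move=> z zr; apply: dphi; rewrite (le_lt_trans zr).
suff -> : c = c' by exact: hc'.
apply: is_taylor_unique tc _.
have [h _] := hc' M hM; apply: (circle r c' M) => //.
apply: (le_trans (nc_ge0 (phi r%:C))); apply: hM.
by rewrite nc_real gtr0_norm.
Qed.

End TaylorSeries.

Section ComplexDifferentiability.
Context {R : realType}.
Implicit Types (phi psi : R[i] -> R[i]) (z w : R[i]).

Lemma cdiffB phi psi z : cdiff phi z -> cdiff psi z ->
  cdiff (fun x => phi x - psi x) z.
Proof.
move=> [d hd] [d' hd']; exists (d - d') => e e0; have e2 : 0 < e / 2 by rewrite divr_gt0.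
have [r r0 h] := hd _ e2; have [r' r'0 h'] := hd' _ e2.
exists (Num.min r r') => [|x]; first by rewrite lt_min r0.
rewrite lt_min => /andP[/h h1 /h' h2].
have -> : phi x - psi x - (phi z - psi z) - (d - d') * (x - z) =
  (phi x - phi z - d * (x - z)) - (psi x - psi z - d' * (x - z)) by ring.
by rewrite (le_trans (ncB _ _))//; lra.
Qed.

(** The coefficient is the mean of p(w) w^-i over the unit circle; 2 is the factor of
    [cint_bound]. *)
Lemma coef_bound (p : {poly R[i]}) M i :
  (forall w, nc w = 1 -> nc p.[w] <= M) -> nc p`_i <= 2 * M.
Proof.
move=> hM; pose tau : R := pi *+ 2; have tp : 0 < tau := @tau_gt0 R; have t0 := ltW tp.
have circK1 t : circ 1 t * circV 1 t = 1 :> R[i] by rewrite circK ?oner_eq0.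
have cM j : ccts (fun t => circ 1 t ^+ j * circV 1 t ^+ i : R[i]).
  by apply: cctsM; apply: cctsX; [exact: ccts_circ|exact: ccts_circV].
have pE : (fun t => p.[circ 1 t] * circV 1 t ^+ i) =
    (fun t => \sum_(j < size p) p`_j * (circ 1 t ^+ j * circV 1 t ^+ i)).
  apply/funext => t; rewrite horner_coef mulr_suml.
  by apply: eq_bigr => j _; rewrite mulrA.
have main : cint tau (fun t => p.[circ 1 t] * circV 1 t ^+ i) = p`_i * tau%:C.
  rewrite pE cint_sum// => [|j]; last by apply: cctsM (cM j); exact: ccts_cst.
  have -> : p`_i = \sum_(j < size p) p`_j * (i == j)%:R.
    rewrite -[in LHS](coefK p) poly_def coef_sum.
    by apply: eq_bigr => j _; rewrite coefZ coefXn.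
  rewrite mulr_suml; apply: eq_bigr => j _; rewrite cintZ// -mulrA; congr (_ * _).
  have [ji|ij] := ltnP j i.
    have E t : circ 1 t ^+ j * circV 1 t ^+ i = circV 1 t ^+ (i - j) :> R[i].
      by rewrite -[in LHS](subnKC (ltnW ji)) exprD mulrA -exprMn circK1 expr1n mul1r.
    under eq_fun do rewrite E.
    by rewrite cint_circVX subn_eq0 leqNgt ji (gtn_eqF ji).
  have E t : circ 1 t ^+ j * circV 1 t ^+ i = circ 1 t ^+ (j - i) :> R[i].
    by rewrite -[in LHS](subnKC ij) exprD mulrAC -exprMn circK1 expr1n mul1r.
  under eq_fun do rewrite E.
  by rewrite cint_circX subn_eq0 eqn_leq ij.
have : nc (p`_i * tau%:C) <= 2 * M * tau.
  rewrite -main; apply: cint_bound => //.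
    rewrite pE; apply: ccts_sum => j; apply: cctsM (cM j); exact: ccts_cst.
  move=> t _; rewrite ncM ncX circVE ?oner_eq0// [nc (circ 1 t)^-1]ncV (nc_circ t ler01).
  by rewrite invr1 expr1n mulr1; apply: hM; rewrite (nc_circ t ler01).
by rewrite ncM nc_real gtr0_norm// ler_pM2r.
Qed.

End ComplexDifferentiability.

(** * Integration over the sphere *)

Section IntegralZeroPi.
Context {R : realType}.
Implicit Types f g F : R -> R.

Let mu := @lebesgue_measure R.
Local Notation I f := (\int[mu]_(t in `[0, pi]) f t).

Lemma continuous_integrable f : continuous f -> mu.-integrable `[0, pi] (EFin \o f).
Proof.
move=> cf; apply: continuous_compact_integrable; first exact: segment_compact.
exact: continuous_subspaceT.
Qed.

Lemma int_derivative F f : (forall x : R, is_derive x 1 F (f x)) -> continuous f ->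
  I f = F pi - F 0.
Proof.
move=> dF cf; rewrite /Rintegral (@continuous_FTC2 _ f F)//.
- exact: pi_gt0.
- exact: continuous_subspaceT.
- have cF : continuous F.
    move=> x; apply: differentiable_continuous.
    by apply/derivable1_diffP; have [] := dF x.
  split; first by move=> x _; have [] := dF x.
    exact: cvg_at_right_filter (cF _).
  exact: cvg_at_left_filter (cF _).
- by move=> x _; rewrite derive1E; have [_ ->] := dF x.
Qed.

Lemma int_sum (T : Type) (s : seq T) (c : T -> R) (f : T -> R -> R) :
  (forall i, continuous (f i)) ->
  I (fun t => \sum_(i <- s) c i * f i t) = \sum_(i <- s) c i * I (f i).
Proof.
move=> cf.
have csum r : continuous (fun t => \sum_(i <- r) c i * f i t).
  elim: r => [|i r IH]; first by under eq_fun do rewrite big_nil; exact: cst_continuous.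
  under eq_fun do rewrite big_cons; move=> x; apply: cvgD (IH x).
  by apply: cvgM; [exact: cvg_cst|exact: cf].
elim: s => [|i s IH].
  under eq_Rintegral do rewrite big_nil.
  by rewrite big_nil Rintegral_cst//= mul0r.
under eq_Rintegral do rewrite big_cons.
rewrite big_cons -IH RintegralD//.
- by rewrite RintegralZl//; exact: continuous_integrable.
- apply: (@continuous_integrable (fun t => c i * f i t)) => x.
  by apply: cvgM; [exact: cvg_cst|exact: cf].
- exact: (@continuous_integrable (fun t => \sum_(j <- s) c j * f j t)).
Qed.

Definition wallis (a b : nat) : R := I (fun t => sin t ^+ a * cos t ^+ b).

Lemma continuous_sincos a b : continuous (fun t : R => sin t ^+ a * cos t ^+ b).
Proof.
move=> t; apply: cvgM.
  apply: (continuous_comp (f := sin) (g := fun x => x ^+ a)).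
    exact: continuous_sin.
  exact: exprn_continuous.
apply: (continuous_comp (f := cos) (g := fun x => x ^+ b)).
  exact: continuous_cos.
exact: exprn_continuous.
Qed.

Lemma wallis_sub a b : wallis a.+2 b = wallis a b - wallis a b.+2.
Proof.
rewrite /wallis -RintegralB//; last 2 first.
- exact/continuous_integrable/continuous_sincos.
- exact/continuous_integrable/continuous_sincos.
apply: eq_Rintegral => t _; have := cos2Dsin2 t.
rewrite !exprS expr0 mulr1 => h.
have -> : sin t * (sin t * sin t ^+ a) * cos t ^+ b =
  (sin t * sin t) * (sin t ^+ a * cos t ^+ b) by ring.
have -> : sin t * sin t = 1 - cos t * cos t by rewrite -h; ring.
ring.
Qed.

(** The derivative of sin^(a + 1) cos^b integrates to 0, because sin vanishes at 0 and pi. For b = 0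
    the identity says that the moment with a single factor cos is 0. *)
Lemma wallis_rec a b : b%:R * wallis a b.-1 = (a + b + 1)%:R * wallis a b.+1.
Proof.
have step : a.+1%:R * wallis a b.+1 = b%:R * wallis a.+2 b.-1.
  pose f t : R := a.+1%:R * (sin t ^+ a * cos t ^+ b.+1) -
    b%:R * (sin t ^+ a.+2 * cos t ^+ b.-1).
  have cf : continuous f.
    move=> t; apply: cvgB; (apply: cvgM; [exact: cvg_cst|exact: continuous_sincos]).
  have dF (x : R) : is_derive x 1 (fun t : R => sin t ^+ a.+1 * cos t ^+ b) (f x).
    rewrite (_ : (fun t => _) = (sin ^+ a.+1) * (cos ^+ b)); last first.
      by apply/funext => y; rewrite /GRing.mul /= !fctE.
    apply: is_derive_eq (is_deriveM (is_deriveX _ (is_derive_sin x))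
      (is_deriveX _ (is_derive_cos x))) _.
    rewrite /f /GRing.scale /= !fctE !exprS; case: (b) => [|b'] /=; rewrite ?exprS; ring.
  have := int_derivative dF cf.
  rewrite sinpi sin0 !expr0n /= !mul0r subrr /f RintegralB//.
  - rewrite !RintegralZl//; try exact/continuous_integrable/continuous_sincos.
    by move=> /eqP; rewrite subr_eq0 => /eqP.
  - apply: continuous_integrable => t.
    by apply: cvgM; [exact: cvg_cst|exact: continuous_sincos].
  - apply: continuous_integrable => t.
    by apply: cvgM; [exact: cvg_cst|exact: continuous_sincos].
case: b step => [|b] /= step.
  rewrite mul0r; move: step; rewrite mul0r => /eqP; rewrite mulf_eq0 pnatr_eq0 /=.
  by move=> /eqP ->; rewrite mulr0.
rewrite wallis_sub in step; rewrite !natrD; move: step; rewrite -!natr1; lra.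
Qed.

Lemma wallis_rec' a b : a.+1%:R * wallis a b = (a + b + 2)%:R * wallis a.+2 b.
Proof.
have := wallis_rec a b.+1; rewrite /= wallis_sub.
by rewrite !natrD -!natr1; lra.
Qed.

End IntegralZeroPi.

(** * Moments of monomials on the sphere *)

Section SphereMonomials.
Context {R : realType}.

Local Notation mu := (@lebesgue_measure R).

Definition monom n (al : 'I_n -> nat) (x : 'rV[R]_n) : R :=
  \prod_(i < n) x 0 i ^+ al i.

(** Polynomials are lists of terms, because the restriction to a slice [sph t] of the sphere maps
    lists to lists; the recursion on the dimension runs over such slices. *)
Definition monoms n (s : seq (R * ('I_n -> nat))) (x : 'rV[R]_n) : R :=
  \sum_(p <- s) p.1 * monom p.2 x.

Definition on_sphere n (x : 'rV[R]_n) := \sum_(i < n) x 0 i ^+ 2 = 1.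

Definition sph n t (om : 'rV[R]_n.+1) : 'rV[R]_n.+2 :=
  row_mx ((cos t)%:M : 'rV[R]_1) (sin t *: om).

Lemma sph0 n t (om : 'rV[R]_n.+1) : sph t om 0 ord0 = cos t.
Proof.
rewrite /sph; have -> : ord0 = lshift n.+1 ord0 :> 'I_(1 + n.+1) by exact/val_inj.
apply: etrans (row_mxEl _ _ _ _) _.
by rewrite mxE eqxx.
Qed.

Lemma sphS n t (om : 'rV[R]_n.+1) j : sph t om 0 (lift ord0 j) = sin t * om 0 j.
Proof.
rewrite /sph; have -> : lift ord0 j = rshift 1 j :> 'I_(1 + n.+1) by exact/val_inj.
apply: etrans (row_mxEr _ _ _ _) _.
by rewrite mxE.
Qed.

Lemma sph_on_sphere n t (om : 'rV[R]_n.+1) : on_sphere om -> on_sphere (sph t om).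
Proof.
rewrite /on_sphere => h; rewrite big_ord_recl sph0.
under eq_bigr do rewrite sphS exprMn.
by rewrite -mulr_sumr h mulr1 cos2Dsin2.
Qed.

(** The recursion of [sphere_int_succ] on a monomial: the exponent of sin collects the Jacobian and
    the degree in the remaining variables. *)
Fixpoint mmom (m : nat) : ('I_m.+1 -> nat) -> R :=
  match m return ('I_m.+1 -> nat) -> R with
  | 0 => fun al => 1 + (-1) ^+ al ord0
  | m'.+1 => fun al => wallis (m' + \sum_(j < m'.+1) al (lift ord0 j)) (al ord0) *
      mmom (fun j => al (lift ord0 j))
  end.

Lemma sphere_ext m (g1 g2 : 'rV[R]_m.+1 -> R) :
  (forall x, on_sphere x -> g1 x = g2 x) -> sphere_int_succ g1 = sphere_int_succ g2.
Proof.
elim: m g1 g2 => [|m IH] g1 g2 h /=.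
  by congr (_ + _); apply: h; rewrite /on_sphere big_ord1 mxE ?expr1n// sqrrN expr1n.
apply: eq_Rintegral => t _; congr (_ * _); apply: IH => om hom.
exact/h/sph_on_sphere.
Qed.

Lemma monom_sph m t (om : 'rV[R]_m.+1) (al : 'I_m.+2 -> nat) :
  monom al (sph t om) = sin t ^+ (\sum_(j < m.+1) al (lift ord0 j)) * cos t ^+ al ord0 *
    monom (fun j => al (lift ord0 j)) om.
Proof.
rewrite /monom big_ord_recl sph0; under eq_bigr do rewrite sphS exprMn.
by rewrite big_split /= prodrXr mulrA [cos t ^+ _ * _]mulrC.
Qed.

(** The induction is over whole lists, since the iterated integral is additive only for integrable
    integrands; here the integrand at each level is a trigonometric polynomial. *)
Lemma sphere_monoms m (s : seq (R * ('I_m.+1 -> nat))) :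
  sphere_int_succ (monoms s) = \sum_(p <- s) p.1 * mmom p.2.
Proof.
elim: m s => [|m IH] s /=.
  rewrite /monoms -big_split /=; apply: eq_bigr => p _.
  by rewrite -mulrDr /monom !big_ord1 !mxE expr1n.
under eq_Rintegral => t _.
  have -> : sphere_int_succ (fun om : 'rV[R]_m.+1 => monoms s (sph t om)) =
    \sum_(p <- s) (p.1 * (sin t ^+ (\sum_(j < m.+1) p.2 (lift ord0 j)) * cos t ^+ p.2 ord0)) *
       mmom (fun j => p.2 (lift ord0 j)).
    pose s' := [seq (p.1 * (sin t ^+ (\sum_(j < m.+1) p.2 (lift ord0 j)) * cos t ^+ p.2 ord0),
      fun j : 'I_m.+1 => p.2 (lift ord0 j)) | p <- s].
    rewrite -(big_map (fun p => (p.1 * (sin t ^+ (\sum_(j < m.+1) p.2 (lift ord0 j)) * cos t ^+ p.2 ord0),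
      fun j : 'I_m.+1 => p.2 (lift ord0 j))) predT (fun p => p.1 * mmom p.2)) -/s'.
    rewrite -IH; congr sphere_int_succ; apply/funext => om.
    rewrite /monoms /s' big_map; apply: eq_bigr => p _.
    by rewrite monom_sph /= mulrA.
  rewrite mulr_sumr.
  under eq_bigr => p _.
    have -> : sin t ^+ m * (p.1 * (sin t ^+ (\sum_(j < m.+1) p.2 (lift ord0 j)) *
        cos t ^+ p.2 ord0) * mmom (fun j => p.2 (lift ord0 j))) =
      (p.1 * mmom (fun j => p.2 (lift ord0 j))) *
      (sin t ^+ (m + \sum_(j < m.+1) p.2 (lift ord0 j)) * cos t ^+ p.2 ord0).
      by rewrite exprD; ring.
    over.
  over.
rewrite (int_sum s (fun p => p.1 * mmom (fun j => p.2 (lift ord0 j)))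
  (f := fun p t => sin t ^+ (m + \sum_(j < m.+1) p.2 (lift ord0 j)) * cos t ^+ p.2 ord0)).
  by apply: eq_bigr => p _; rewrite -/(wallis _ _); ring.
by move=> p; exact: continuous_sincos.
Qed.

Definition upd n (al : 'I_n -> nat) i k := fun j => if j == i then k else al j.

Lemma upd_lift0 n (al : 'I_n.+1 -> nat) k j :
  upd al ord0 k (lift ord0 j) = al (lift ord0 j).
Proof. by rewrite /upd eq_sym (negbTE (neq_lift _ _)). Qed.

Lemma upd_lift n (al : 'I_n.+1 -> nat) i k :
  (fun j => upd al (lift ord0 i) k (lift ord0 j)) = upd (fun j => al (lift ord0 j)) i k.
Proof. by apply/funext => j; rewrite /upd (inj_eq lift_inj). Qed.

Lemma sum_upd n (al : 'I_n -> nat) i k :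
  (\sum_(j < n) upd al i k j + al i = \sum_(j < n) al j + k)%N.
Proof.
rewrite (bigD1 i)//= [in RHS](bigD1 i)//= {1}/upd eqxx.
rewrite (eq_bigr al) => [|j ji]; last by rewrite /upd (negbTE ji).
lia.
Qed.

(* The divergence theorem on the ball for the field x^al e_i. *)
Lemma mmom_div m (al : 'I_m.+1 -> nat) i :
  (al i)%:R * mmom (upd al i (al i).-1) =
  (\sum_j al j + m)%:R * mmom (upd al i (al i).+1).
Proof.
elim: m al i => [|m IH] al i /=.
  rewrite big_ord1 (ord1 i) addn0 /upd eqxx; case: (al ord0) => [|k] /=.
    by rewrite !mul0r.
  by rewrite !exprS !mulN1r opprK.
(* For the polar coordinate the identity is [wallis_rec] in the exponent of cos, the other factor
   being unchanged. Otherwise both the integral over the slice and the power of sin change. *)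
have [j ->|->] := unliftP ord0 i; last first.
  have e k : (fun j => upd al ord0 k (lift ord0 j)) = (fun j => al (lift ord0 j)).
    by apply/funext => j; exact: upd_lift0.
  have es k : (\sum_(j < m.+1) upd al ord0 k (lift ord0 j) = \sum_(j < m.+1) al (lift ord0 j))%N.
    by apply: eq_bigr => j _; exact: upd_lift0.
  have e00 k : upd al ord0 k ord0 = k by rewrite /upd eqxx.
  rewrite !e !es !e00 !mulrA wallis_rec; congr (_ * _ * _); congr (_%:R).
  by rewrite [in RHS]big_ord_recl; lia.
move: (j : 'I_m.+1) => {}j; rewrite !upd_lift.
set al' := fun j : 'I_m.+1 => al (lift ord0 j); set b := al ord0.
have e0 k : upd al (lift ord0 j) k ord0 = b.
  by rewrite /upd (negbTE (neq_lift _ _)).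
have es k : (\sum_(l < m.+1) upd al (lift ord0 j) k (lift ord0 l) =
             \sum_(l < m.+1) upd al' j k l)%N.
  by apply: eq_bigr => l _; rewrite -(upd_lift al j k).
have eal : (\sum_(l < m.+2) al l = b + \sum_(l < m.+1) al' l)%N by rewrite big_ord_recl.
rewrite !e0 !es eal -/(al' j).
(* For exponent 0 the left-hand side is 0 and [_.-1] is truncated. The moment with exponent 1
   vanishes by the induction hypothesis, except when its factor is 0; then m = 0 and the slice is
   {1, -1}. *)
have [aj|aj] := posnP (al' j).
  rewrite aj mul0r; suff -> : mmom (upd al' j 1) = 0 by rewrite !mulr0.
  have := IH al' j; rewrite aj mul0r => /esym/eqP.
  rewrite mulf_eq0 pnatr_eq0 => /orP[|/eqP //].
  rewrite addn_eq0 => /andP[_ /eqP m0]; subst m.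
  by rewrite /= (ord1 j) /upd eqxx expr1 subrr.
have s1 := sum_upd al' j (al' j).-1; have s2 := sum_upd al' j (al' j).+1.
set S := (\sum_(l < m.+1) al' l)%N in s1 s2 *.
have -> : (\sum_(l < m.+1) upd al' j (al' j).-1 l = S - 1)%N by lia.
have -> : (\sum_(l < m.+1) upd al' j (al' j).+1 l = S + 1)%N by lia.
have S0 : (0 < S)%N by lia.
(* The induction hypothesis raises the exponent by two at the price of the factor S + m;
   [wallis_rec'], which raises the power of sin by two, trades this factor for the required one. *)
rewrite mulrCA (IH al' j) -/S mulrCA !mulrA; congr (_ * _).
have := wallis_rec' (R := R) (m + (S - 1)) b.
have -> : (m + (S - 1)).+1 = (S + m)%N by lia.
have -> : (S + m).+1 = (m + (S + 1))%N by lia.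
by have -> : (m + (S - 1) + b + 2 = b + S + m.+1)%N by lia.
Qed.

End SphereMonomials.

(** * Continuity of the surface integral under uniform convergence *)

Section SphereBound.
Context {R : realType}.
Local Notation mu := (@lebesgue_measure R).

(** A class of integrands that contains f(r theta) times the conjugate of Y and is stable under
    slicing, so that integrability at each level of the iterated integral can be derived from
    polynomials. *)
Definition approximable n (g : 'rV[R]_n -> R) := forall e, 0 < e ->
  exists s, forall x, on_sphere x -> `|g x - monoms s x| <= e.

Lemma sphere_int1_ge0 m : 0 <= sphere_int_succ (fun _ : 'rV[R]_m.+1 => 1).
Proof.
elim: m => [|m IH] /=; first by rewrite addr_ge0.
apply: Rintegral_ge0 => t /= /[!in_itv] /= tpi.
by rewrite mulr_ge0// exprn_ge0// sin_ge0_pi.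
Qed.

Definition sph_seq m (s : seq (R * ('I_m.+2 -> nat))) t :=
  [seq (p.1 * (sin t ^+ (\sum_(j < m.+1) p.2 (lift ord0 j)) * cos t ^+ p.2 ord0),
      fun j : 'I_m.+1 => p.2 (lift ord0 j)) | p <- s].

Lemma monoms_sph m (s : seq (R * ('I_m.+2 -> nat))) t om :
  monoms s (sph t om) = monoms (sph_seq s t) om.
Proof.
rewrite /monoms big_map; apply: eq_bigr => p _.
by rewrite monom_sph /= mulrA.
Qed.

Lemma approximable_sph m (g : 'rV[R]_m.+2 -> R) t : approximable g ->
  approximable (fun om => g (sph t om)).
Proof.
move=> ag e /ag[s hs]; exists (sph_seq s t) => om hom.
by rewrite -monoms_sph; apply: hs; exact: sph_on_sphere.
Qed.

Lemma approximable_monoms n (s : seq (R * ('I_n -> nat))) : approximable (monoms s).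
Proof. by move=> e e0; exists s => x _; rewrite subrr normr0 ltW. Qed.

Lemma continuous_sphere_monoms m (s : seq (R * ('I_m.+2 -> nat))) :
  continuous (fun t : R => sin t ^+ m * sphere_int_succ (fun om => monoms s (sph t om))).
Proof.
have -> : (fun t : R => sin t ^+ m * sphere_int_succ (fun om => monoms s (sph t om))) =
  fun t => \sum_(p <- s) (p.1 * mmom (fun j => p.2 (lift ord0 j))) *
    (sin t ^+ (m + \sum_(j < m.+1) p.2 (lift ord0 j)) * cos t ^+ p.2 ord0).
  apply/funext => t; under [in LHS]eq_fun do rewrite monoms_sph.
  rewrite sphere_monoms /sph_seq big_map mulr_sumr; apply: eq_bigr => p _ /=.
  by rewrite exprD; ring.
elim: s => [|p s IH]; first by under eq_fun do rewrite big_nil; exact: cst_continuous.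
under eq_fun do rewrite big_cons; move=> x; apply: cvgD (IH x).
by apply: cvgM; [exact: cvg_cst|exact: continuous_sincos].
Qed.

Lemma sphere_int_dist m (g1 g2 : 'rV[R]_m.+1 -> R) (C : R) :
  approximable g1 -> approximable g2 ->
  (forall x, on_sphere x -> `|g1 x - g2 x| <= C) ->
  `|sphere_int_succ g1 - sphere_int_succ g2| <=
    C * sphere_int_succ (fun _ : 'rV[R]_m.+1 => 1).
Proof.
elim: m g1 g2 C => [|m IH] g1 g2 C a1 a2 hC /=.
  rewrite mulrDr mulr1 opprD addrACA (le_trans (ler_normD _ _))//.
  by apply: lerD; apply: hC; rewrite /on_sphere big_ord1 mxE ?expr1n// sqrrN expr1n.
pose H (g : 'rV[R]_m.+2 -> R) t := sin t ^+ m * sphere_int_succ (fun om => g (sph t om)).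
pose I1 := sphere_int_succ (fun _ : 'rV[R]_m.+1 => 1 : R).
have I10 : 0 <= I1 := sphere_int1_ge0 m.
have sinm (t : R) : t \in `[0, pi] -> 0 <= sin t ^+ m <= 1.
  move=> /[!in_itv] /= tpi; have s0 := sin_ge0_pi tpi; have s1 := sin_le1 t.
  by rewrite exprn_ge0//= exprn_ile1.
have HC g g' D (t : R) : approximable g -> approximable g' ->
    (forall x, on_sphere x -> `|g x - g' x| <= D) -> t \in `[0, pi] ->
    `|H g t - H g' t| <= sin t ^+ m * (D * I1).
  move=> ag ag' hD ht; rewrite /H -mulrBr normrM ger0_norm; last first.
    by case/andP: (sinm t ht).
  rewrite ler_wpM2l//; first by case/andP: (sinm t ht).
  apply: IH; [exact: approximable_sph|exact: approximable_sph|].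
  by move=> om hom; apply: hD; exact: sph_on_sphere.
have HD g g' D (t : R) : approximable g -> approximable g' -> 0 <= D ->
    (forall x, on_sphere x -> `|g x - g' x| <= D) -> t \in `[0, pi] ->
    `|H g t - H g' t| <= D * I1.
  move=> ag ag' D0 hD ht; rewrite (le_trans (HC _ _ _ _ ag ag' hD ht))//.
  by rewrite ler_piMl ?mulr_ge0//; case/andP: (sinm t ht).
(* The slice integrals of approximating polynomials are continuous in t and, by the induction
   hypothesis, converge to those of g. The limit is therefore measurable, and it is dominated by a
   continuous function. *)
have intH g : approximable g -> mu.-integrable `[0, pi] (EFin \o H g).
  move=> ag.
  have /choice[s hs] : forall k : nat, exists s, forall x, on_sphere x ->
    `|g x - monoms s x| <= k.+1%:R^-1 by move=> k; apply: ag; rewrite invr_gt0.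
  have ints k : mu.-integrable `[0, pi] (EFin \o H (monoms (s k))).
    exact/continuous_integrable/continuous_sphere_monoms.
  have mH : measurable_fun `[0, pi] (H g).
    apply: (@measurable_fun_cvg _ _ _ _ (fun k => H (monoms (s k)))) => //.
      move=> k; have /integrableP[/measurable_EFinP //] := ints k.
    move=> t ht; apply/cvgrPdist_le => e e0.
    have [N _ hN] : \forall k \near \oo, k.+1%:R^-1 * I1 <= e.
      have : (fun k => k.+1%:R^-1 * I1) @ \oo --> 0 * I1.
        by apply: cvgM; [exact: cvg_harmonic|exact: cvg_cst].
      rewrite mul0r => /cvgrPdist_le/(_ _ e0); apply: filterS => k.
      by rewrite sub0r normrN ger0_norm// mulr_ge0// invr_ge0.
    exists N => // k Nk; apply: le_trans (hN k Nk).
    apply: HD => //; [exact: approximable_monoms|exact: hs].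
  apply: (@le_integrable _ _ _ mu `[0, pi] _ _
      (EFin \o (fun t => `|H (monoms (s 0%N)) t| + I1))) => //.
  - exact/measurable_EFinP.
  - move=> t ht /=; rewrite lee_fin.
    have := HD g _ _ t ag (approximable_monoms (s 0%N)) ler01.
    rewrite mul1r => /(_ _ ht).
    have h x : on_sphere x -> `|g x - monoms (s 0%N) x| <= 1.
      by move=> /(hs 0%N); rewrite invr1.
    move=> /(_ h) hh; rewrite [leRHS]ger0_norm ?addr_ge0//.
    rewrite -{1}(subrK (H (monoms (s 0%N)) t) (H g t)) addrC.
    by rewrite (le_trans (ler_normD _ _))// lerD2l.
  - apply: (@continuous_integrable _ (fun t => `|H (monoms (s 0%N)) t| + I1)) => t.
    apply: cvgD; last exact: cvg_cst.
    by apply: cvg_norm; exact: continuous_sphere_monoms.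
rewrite -/(H g1) -/(H g2).
have -> : \int[mu]_(t in `[0, pi]) (sin t ^+ m * sphere_int_succ (fun om => g1 (sph t om)))
  = \int[mu]_(t in `[0, pi]) H g1 t by [].
have -> : \int[mu]_(t in `[0, pi]) (sin t ^+ m * sphere_int_succ (fun om => g2 (sph t om)))
  = \int[mu]_(t in `[0, pi]) H g2 t by [].
have i1 := intH g1 a1; have i2 := intH g2 a2.
have intC c : mu.-integrable `[0, pi] (EFin \o (fun t : R => sin t ^+ m * c)).
  apply: continuous_integrable => t; apply: cvgM; last exact: cvg_cst.
  apply: (continuous_comp (f := sin) (g := fun x => x ^+ m)).
    exact: continuous_sin.
  exact: exprn_continuous.
have iB : mu.-integrable `[0, pi] (EFin \o (fun t => H g1 t - H g2 t)).
  rewrite (_ : EFin \o _ = ((EFin \o H g1) \- (EFin \o H g2))%E).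
    exact: integrableB.
  by apply/funext => t /=; rewrite EFinB.
rewrite -RintegralB//.
apply: (le_trans (le_normr_Rintegral _ _)) => //.
rewrite -RintegralZl//.
apply: le_Rintegral => //.
- exact: integrable_norm iB.
- rewrite (_ : (fun x : R => _) = (fun t => sin t ^+ m * (C * I1))); first exact: intC.
  by apply/funext => t; rewrite mulrCA.
- by move=> t ht; rewrite mulrCA; exact: HC.
Qed.

End SphereBound.

(** * Surface integrals of complex polynomials *)

Section SphereOfPolynomials.
Import -(notations) mpoly.
Context {R : realType} {m : nat}.
Local Notation n := m.+1.
Local Notation C := R[i].
Local Notation homog d := (ishomog1 d mdeg).
Implicit Types (p q h : mpoly n C) (G : 'rV[R]_n -> C).

Definition vol : R := sphere_int_succ (fun _ : 'rV[R]_n => 1).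

Lemma vol_ge0 : 0 <= vol. Proof. exact: sphere_int1_ge0. Qed.

Lemma peval_real p (x : 'rV[R]_n) : peval p (real_point x) =
  \sum_(u <- msupp p) mcoeff u p * (monom u x)%:C.
Proof.
rewrite /peval mevalE; apply: eq_bigr => u _; congr (_ * _).
by rewrite /monom rmorph_prod; apply: eq_bigr => i _; rewrite mxE rmorphXn.
Qed.

Definition Re_seq p : seq (R * ('I_n -> nat)) :=
  [seq (Re (mcoeff u p), fun_of_multinom u) | u <- msupp p].
Definition Im_seq p : seq (R * ('I_n -> nat)) :=
  [seq (Im (mcoeff u p), fun_of_multinom u) | u <- msupp p].

Lemma Re_sum (I : Type) (s : seq I) (f : I -> C) :
  Re (\sum_(i <- s) f i) = \sum_(i <- s) Re (f i).
Proof. by elim/big_rec2: _ => // i a b _ <-; rewrite Re_add. Qed.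

Lemma Im_sum (I : Type) (s : seq I) (f : I -> C) :
  Im (\sum_(i <- s) f i) = \sum_(i <- s) Im (f i).
Proof. by elim/big_rec2: _ => // i a b _ <-; rewrite Im_add. Qed.

Lemma Re_peval p x : Re (peval p (real_point x)) = monoms (Re_seq p) x.
Proof.
rewrite peval_real Re_sum /monoms /Re_seq [in RHS]big_map; apply: eq_bigr => u _.
by rewrite Re_mul /= mulr0 subr0.
Qed.

Lemma Im_peval p x : Im (peval p (real_point x)) = monoms (Im_seq p) x.
Proof.
rewrite peval_real Im_sum /monoms /Im_seq [in RHS]big_map; apply: eq_bigr => u _.
by rewrite Im_mul /= mulr0 add0r.
Qed.

Definition IS p : C := sphere_intC (fun x : 'rV[R]_n => peval p (real_point x)).

Lemma IS_monlin p : IS p = monlin (fun u : multinom n => (mmom (fun_of_multinom u))%:C) p.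
Proof.
rewrite /IS /sphere_intC /= /monlin.
have -> : (fun x : 'rV[R]_n => Re (peval p (real_point x))) = monoms (Re_seq p).
  by apply/funext => x; exact: Re_peval.
have -> : (fun x : 'rV[R]_n => Im (peval p (real_point x))) = monoms (Im_seq p).
  by apply/funext => x; exact: Im_peval.
rewrite !sphere_monoms /Re_seq /Im_seq; apply: complex_ext => /=.
  rewrite [in LHS]big_map Re_sum; apply: eq_bigr => u _.
  by rewrite Re_mul /= mulr0 subr0.
rewrite [in LHS]big_map Im_sum; apply: eq_bigr => u _.
by rewrite Im_mul /= mulr0 add0r.
Qed.

Lemma ISD p q : IS (p + q) = IS p + IS q.
Proof. by rewrite !IS_monlin monlinD. Qed.

Lemma ISZ c p : IS (c *: p) = c * IS p.
Proof. by rewrite !IS_monlin monlinZ. Qed.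

Lemma IS0 : IS 0 = 0.
Proof. by rewrite IS_monlin monlin0. Qed.

Lemma IS_sum (I : Type) (s : seq I) (f : I -> mpoly n C) :
  IS (\sum_(i <- s) f i) = \sum_(i <- s) IS (f i).
Proof. by elim/big_rec2: _ => [|i a b _ <-]; [exact: IS0|rewrite ISD]. Qed.

Lemma sphere_intC_ext G1 G2 : (forall x, on_sphere x -> G1 x = G2 x) ->
  sphere_intC G1 = sphere_intC G2.
Proof.
move=> h; rewrite /sphere_intC /=; congr (_ +i* _)%C;
  by apply: sphere_ext => x /h ->.
Qed.

Definition capproximable G := forall e, 0 < e -> exists p,
  forall x, on_sphere x -> nc (G x - peval p (real_point x)) <= e.

Lemma capproximable_peval p : capproximable (fun x => peval p (real_point x)).
Proof. by move=> e e0; exists p => x _; rewrite subrr nc0 ltW. Qed.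

Lemma sphere_intC_dist G1 G2 c : capproximable G1 -> capproximable G2 ->
  (forall x, on_sphere x -> nc (G1 x - G2 x) <= c) ->
  nc (sphere_intC G1 - sphere_intC G2) <= 2 * c * vol.
Proof.
move=> a1 a2 hc.
have aRe G : capproximable G -> approximable (fun x => Re (G x)).
  move=> aG e /aG[p hp]; exists (Re_seq p) => x /hp h.
  by rewrite -Re_peval -Re_opp -Re_add (le_trans (nc_Re _)).
have aIm G : capproximable G -> approximable (fun x => Im (G x)).
  move=> aG e /aG[p hp]; exists (Im_seq p) => x /hp h.
  by rewrite -Im_peval -Im_opp -Im_add (le_trans (nc_Im _)).
rewrite (le_trans (nc_le_ReIm _))// Re_add Re_opp Im_add Im_opp /=.
rewrite -mulrA mulr2n mulrDl mul1r; apply: lerD.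
  apply: sphere_int_dist => [||x hx]; [exact: aRe|exact: aRe|].
  by rewrite -Re_opp -Re_add (le_trans (nc_Re _))// hc.
apply: sphere_int_dist => [||x hx]; [exact: aIm|exact: aIm|].
by rewrite -Im_opp -Im_add (le_trans (nc_Im _))// hc.
Qed.

Lemma IS_bound p c : (forall x, on_sphere x -> nc (peval p (real_point x)) <= c) ->
  nc (IS p) <= 2 * c * vol.
Proof.
move=> hc; rewrite -[IS p]subr0 -IS0; apply: sphere_intC_dist.
- exact: capproximable_peval.
- exact: capproximable_peval.
- by move=> x hx; rewrite /peval meval0 subr0; exact: hc.
Qed.

Lemma IS_sqpoly p : IS (sqpoly * p) = IS p.
Proof.
apply: sphere_intC_ext => x hx; rewrite /peval mevalM.
suff -> : meval (fun i => real_point x 0 i) (sqpoly : mpoly n C) = 1 by rewrite mul1r.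
rewrite /sqpoly raddf_sum /=.
transitivity (\sum_(i < n) ((x 0 i) ^+ 2)%:C).
  by apply: eq_bigr => i _; rewrite rmorphXn /= mevalXU mxE rmorphXn.
by rewrite -rmorph_sum hx.
Qed.

(* The divergence theorem on the ball for the field p e_i. *)
Lemma IS_div d p i : p \is homog d ->
  IS (mderiv i p) = (d + m)%:R * IS (mpolyX C (mnm1 i) * p).
Proof.
move: p; apply: dhomog_ind => [|p q hp hq|c p hp|u hu].
- by rewrite mderiv0 mulr0 IS0 mulr0.
- by rewrite mderivD mulrDr !ISD hp hq mulrDr.
- by rewrite mderivZ -scalerAr !ISZ hp mulrCA.
rewrite mderivX ISZ -mpolyXD !IS_monlin !monlinX.
have -> : (fun_of_multinom (mnm_sub u (mnm1 i))) = upd u i (u i).-1.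
  by apply/funext => j; rewrite mnmBE mnm1E /upd eq_sym; case: eqP => [->|_];
    rewrite ?subn1 ?subn0.
have -> : (fun_of_multinom (mnm_add (mnm1 i) u)) = upd u i (u i).+1.
  by apply/funext => j; rewrite mnmDE mnm1E /upd eq_sym; case: eqP => [->|_].
have e : forall k : nat, (k%:R : C) = (k%:R : R)%:C by move=> k; rewrite rmorph_nat.
by rewrite !e -!rmorphM mmom_div -mdegE hu.
Qed.

End SphereOfPolynomials.

Arguments vol R m : clear implicits.

(** * Spherical harmonics *)

Section SphericalHarmonics.
Import -(notations) mpoly.
Context {R : realType} {m : nat}.
Hypothesis m_gt0 : (0 < m)%N.
Local Notation n := m.+1.
Local Notation C := R[i].
Local Notation homog d := (ishomog1 d mdeg).
Implicit Types (p q h : mpoly n C).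

Lemma natC_neq0 (k : nat) : (0 < k)%N -> (k%:R : C) != 0.
Proof. by rewrite pnatr_eq0 lt0n. Qed.

(** Euler's identity writes h as a multiple of sum_i X_i d_i h, and [IS_div] turns the integral of
    this sum into a multiple of that of the Laplacian. The hypothesis m > 0 keeps the factor of
    [IS_div] non-zero in degree 1. *)
Lemma IS_harmonic h k : (0 < k)%N -> h \is homog k -> lap h = 0 -> IS h = 0.
Proof.
case: k => // k _ hh lh.
have := congr1 (@IS R m) (mpoly_euler hh); rewrite ISZ IS_sum.
have e i : (k + m)%:R * IS (mpolyX C (mnm1 i) * mderiv i h) = IS (mderiv i (mderiv i h)).
  by rewrite (IS_div i (dhomog_deriv i hh)).
move=> /(congr1 (fun x => (k + m)%:R * x)); rewrite mulr_sumr.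
under eq_bigr do rewrite e.
rewrite -IS_sum -/(lap h) lh IS0 => /esym/eqP.
rewrite !mulf_eq0 !pnatr_eq0 /= addn_eq0 (gtn_eqF m_gt0) andbF /=.
by move=> /eqP.
Qed.

(** One variable X_i is split off a monomial p = X_i v. By [IS_div] the integral becomes that of
    (d_i v) h + v (d_i h), and in both products the first factor still has lower degree than the
    harmonic one. *)
Lemma IS_harmonic_low d k p h : (d < k)%N -> p \is homog d -> h \is homog k ->
  lap h = 0 -> IS (p * h) = 0.
Proof.
elim/ltn_ind: d k p h => d IH k p h dk hp hh lh.
move: p hp; apply: dhomog_ind => [|p q hp hq|c p hp|u hu].
- by rewrite mul0r IS0.
- by rewrite mulrDl ISD hp hq addr0.
- by rewrite -scalerAl ISZ hp mulr0.
case: d hu IH dk => [|d] hu IH dk.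
  have -> : u = mnm0 by apply/eqP; rewrite -mdeg_eq0 hu.
  by rewrite mpolyX0 mul1r; apply: IS_harmonic hh lh.
have [i ui] : exists i, u i != 0%N.
  apply/existsP; rewrite -negb_forall; apply/negP => /forallP u0.
  have : mdeg u = 0%N by rewrite mdegE big1// => i _; apply/eqP.
  by rewrite hu.
rewrite -(mnm_neq0_sub1 ui); set v := mnm_sub u (mnm1 i).
have hv : mdeg v = d.
  by have := congr1 mdeg (mnm_neq0_sub1 ui); rewrite mdegD mdeg1 hu addn1 => -[].
rewrite mpolyXD [_ * mpolyX C (mnm1 i)]mulrC -mulrA.
case: k dk hh => // k dk hh.
have pv : mpolyX C v * h \is homog (d + k.+1)%N.
  by apply: dhomogM => //; rewrite dhomogX /= hv.
have := IS_div i pv; rewrite mderivM ISD.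
have -> : IS (mpolyX C v * mderiv i h) = 0.
  refine (IH d _ k _ _ _ _ _ _); [by []|by []| |exact: dhomog_deriv|].
    by rewrite dhomogX /= hv.
  by rewrite lap_mderiv lh mderiv0.
have -> : IS (mderiv i (mpolyX C v) * h) = 0.
  have [d0|d0] := posnP d.
    have -> : mderiv i (mpolyX C v) = 0.
      by apply: dhomog0_deriv; rewrite dhomogX /= hv d0.
    by rewrite mul0r IS0.
  refine (IH d.-1 _ k.+1 _ _ _ _ hh lh); [lia|lia|].
  by apply: dhomog_deriv; rewrite dhomogX /= hv prednK.
rewrite ?addr0 => /esym/eqP; rewrite mulf_eq0 pnatr_eq0 !addn_eq0 /= => /orP[|/eqP //].
by rewrite andbF.
Qed.

Lemma IS_sqpolyX p j : IS (sqpoly ^+ j * p) = IS p.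
Proof. elim: j => [|j IH]; first by rewrite expr0 mul1r.
by rewrite exprS -mulrA IS_sqpoly. Qed.

(** The constant in the integral of (x . theta)^k h(theta), which is [ck k] times h(x) for h
    harmonic of degree k. *)
Fixpoint ck (k : nat) : R := match k with
  | 0 => vol R m
  | k'.+1 => ck k' * k'.+1%:R / (2 * k' + 1 + m)%:R
  end.

Lemma natRC (k : nat) : (k%:R : C) = (k%:R : R)%:C.
Proof. by rewrite rmorph_nat. Qed.

Lemma IS1 : IS (1 : mpoly n C) = (vol R m)%:C.
Proof.
rewrite /IS /sphere_intC /= /vol; apply: complex_ext => /=.
  by apply: sphere_ext => x _; rewrite /peval meval1.
rewrite (_ : (fun x => _) = monoms [::]); last first.
  by apply/funext => x; rewrite /peval meval1 /monoms big_nil.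
by rewrite sphere_monoms big_nil.
Qed.

(** Split off one factor x . theta and apply [IS_div] in each coordinate. The derivative of the
    remaining power has degree k - 1 and is orthogonal to h, of degree k + 1; the derivatives of h
    have degree k, and Euler's identity reassembles h(x) from them. *)
Lemma IS_lpolyX h k (x : 'I_n -> C) : h \is homog k -> lap h = 0 ->
  IS (lpoly x ^+ k * h) = (ck k)%:C * meval x h.
Proof.
elim: k h => [|k IH] h hh lh.
  rewrite expr0 mul1r /=.
  have -> : h = mcoeff mnm0 h *: 1.
    rewrite [LHS]mpolyE big_seq (eq_bigr (fun _ => mcoeff mnm0 h *: 1)); last first.
      move=> u uh; have : mdeg u = 0%N by move/dhomogP: hh => /(_ u uh).
      by move/eqP; rewrite mdeg_eq0 => /eqP ->; rewrite mpolyX0.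
    have [h0|h0] := eqVneq (mcoeff mnm0 h) 0.
      by rewrite h0 scale0r big1.
    rewrite -big_seq (big_rem mnm0) /=; last by rewrite mcoeff_msupp.
    rewrite big_seq big1 ?addr0// => u.
    rewrite mem_rem_uniq ?msupp_uniq// inE => /andP[u0 uh].
    have : mdeg u = 0%N by move/dhomogP: hh => /(_ u uh).
    by move/eqP; rewrite mdeg_eq0 (negbTE u0).
  by rewrite ISZ IS1 mevalZ meval1 mulr1 mulrC.
have step i : (2 * k + 1 + m)%:R * IS (mpolyX C (mnm1 i) * (lpoly x ^+ k * h)) =
    (ck k)%:C * meval x (mderiv i h).
  have hl : lpoly x ^+ k * h \is homog (2 * k + 1)%N.
    have -> : (2 * k + 1 = k + k.+1)%N by lia.
    by apply: dhomogM => //; exact: dhomog_lpolyX.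
  rewrite -(IS_div i hl) mderivM ISD.
  rewrite (IH _ (dhomog_deriv i hh)); last by rewrite lap_mderiv lh mderiv0.
  suff -> : IS (mderiv i (lpoly x ^+ k) * h) = 0 by rewrite add0r.
  rewrite mderivXn mderiv_lpoly -scalerAl ISZ.
  have [->|k0] := posnP k; first by rewrite mul0r.
  rewrite [_ * mpolyC n _]mulrC mul_mpolyC -scalerAl ISZ.
  rewrite (@IS_harmonic_low k.-1 k.+1) ?mulr0//.
    by apply: leq_ltn_trans (leq_pred _) _.
  exact: dhomog_lpolyX.
have n0 : ((2 * k + 1 + m)%:R : C) != 0 by apply: natC_neq0; lia.
apply: (mulfI n0).
rewrite exprS -mulrA {1}/lpoly mulr_suml IS_sum mulr_sumr.
under eq_bigr => i _ do rewrite -scalerAl ISZ mulrCA step.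
rewrite /= rmorphM fmorphV /= -natRC.
have -> : (2 * k + 1 + m)%:R * ((ck k * k.+1%:R)%:C / (2 * k + 1 + m)%:R * meval x h)
  = (ck k)%:C * (k.+1%:R * meval x h) :> C.
  by rewrite rmorphM /= -natRC; field.
rewrite -mevalZ -(mpoly_euler hh) raddf_sum mulr_sumr; apply: eq_bigr => i _.
by rewrite /= mevalM mevalXU; ring.
Qed.

Lemma zcoef0 k : @zcoef C n k 0 = 1.
Proof. by rewrite /zcoef muln0 ffactn0 mulr1. Qed.

Lemma dhomog_zonal k (x : 'I_n -> C) : zonal k x \is homog k.
Proof. by apply: dhomog_harm; exact: dhomog_lpolyX. Qed.

Lemma lap_zonal k (x : 'I_n -> C) : lap (zonal k x) = 0.
Proof. by apply: lap_harm => //; exact: dhomog_lpolyX. Qed.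

(** On the sphere q = 1, so the terms j > 0 of [zonal] integrate like powers of x . theta of degree
    below k, which are orthogonal to h. *)
Lemma IS_zonal h k (x : 'I_n -> C) : h \is homog k -> lap h = 0 ->
  IS (zonal k x * h) = (ck k)%:C * meval x h.
Proof.
move=> hh lh; rewrite zonalE mulr_suml IS_sum big_ord_recl [X in _ + X]big1 ?addr0 => [|j _].
  rewrite /= zcoef0 !expr0 !mul1r scale1r muln0 subn0.
  exact: IS_lpolyX.
rewrite -scalerAl ISZ -[_ * _ * h]mulrA IS_sqpolyX.
rewrite (@IS_harmonic_low (k - 2 * lift ord0 j) k) ?mulr0//.
  by rewrite /= /bump /=; have := ltn_ord j; lia.
exact: dhomog_lpolyX.
Qed.

Lemma meval_zonal k (x y : 'I_n -> C) : meval y (zonal k x) =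
  \sum_(j < (k./2).+1) @zcoef C n k j * (\sum_(i < n) x i ^+ 2) ^+ j *
    ((\sum_(i < n) y i ^+ 2) ^+ j * (\sum_(i < n) x i * y i) ^+ (k - 2 * j)).
Proof.
rewrite zonalE raddf_sum; apply: eq_bigr => j _ /=.
rewrite mevalZ mevalM !rmorphXn /=; congr (_ * (_ ^+ _ * _ ^+ _)).
  by rewrite /sqpoly raddf_sum; apply: eq_bigr => i _ /=; rewrite rmorphXn /= mevalXU.
by rewrite /lpoly raddf_sum; apply: eq_bigr => i _ /=; rewrite mevalZ mevalXU.
Qed.

(** Conjugating the coefficients conjugates the values at real points, so that [sphere_dot] becomes
    the integral of a polynomial. *)
Definition cpoly p : mpoly n C := map_mpoly Num.conj p.

Lemma mcoeff_cpoly p u : mcoeff u (cpoly p) = (mcoeff u p)^*.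
Proof. exact: mcoeff_map_mpoly. Qed.

Lemma mderiv_cpoly i p : mderiv i (cpoly p) = cpoly (mderiv i p).
Proof.
by apply/mpolyP => u; rewrite mcoeff_deriv !mcoeff_cpoly mcoeff_deriv rmorphMn.
Qed.

Lemma lap_cpoly p : lap (cpoly p) = cpoly (lap p).
Proof.
rewrite /lap; transitivity (\sum_(i < n) cpoly (mderiv i (mderiv i p))).
  by apply: eq_bigr => i _; rewrite !mderiv_cpoly.
by rewrite /cpoly -raddf_sum.
Qed.

Lemma dhomog_cpoly p k : p \is homog k -> cpoly p \is homog k.
Proof.
move=> hp; apply/dhomogP => u; rewrite mcoeff_msupp mcoeff_cpoly fmorph_eq0 -mcoeff_msupp.
by move/dhomogP: hp; apply.
Qed.

Lemma peval_cpoly p (z : 'rV[C]_n) : peval (cpoly p) z = (peval p (map_mx Num.conj z))^*.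
Proof.
rewrite /peval; have [k hk] : exists k, (msize p <= k)%N /\ (msize (cpoly p) <= k)%N.
  by exists (maxn (msize p) (msize (cpoly p))); rewrite !leq_max !leqnn orbT.
case: hk => h1 h2.
have E q (v : 'I_n -> C) : (msize q <= k)%N ->
    meval v q = \sum_(u : bmultinom n k) mcoeff u q * \prod_(i < n) v i ^+ u i.
  move=> hq; rewrite {1}(mpolywE hq) raddf_sum; apply: eq_bigr => u _ /=.
  by rewrite mevalZ mevalX.
rewrite !E// rmorph_sum; apply: eq_bigr => u _.
rewrite mcoeff_cpoly rmorphM rmorph_prod; congr (_ * _).
by apply: eq_bigr => i _; rewrite rmorphXn mxE /= conjCK.
Qed.

Lemma peval_cpoly_real p (x : 'rV[R]_n) :
  peval (cpoly p) (real_point x) = (peval p (real_point x))^*.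
Proof.
rewrite peval_cpoly; congr ((peval p _)^*).
by apply/matrixP => i j; rewrite !mxE; exact: conjc_real.
Qed.

Lemma sphere_dotE p q : sphere_dot p q = IS (p * cpoly q).
Proof.
apply: sphere_intC_ext => x _.
by rewrite -peval_cpoly_real /peval mevalM.
Qed.

Section Basis.
Variables (k a : nat) (Y : 'I_a -> mpoly n C).
Hypothesis hY : orthonormal_harmonic_basis k Y.

Lemma basis_homog l : Y l \is homog k. Proof. by case: hY => /(_ l)[]. Qed.
Lemma basis_lap l : lap (Y l) = 0. Proof. by case: hY => /(_ l)[]. Qed.

Lemma basis_expansion h : h \is homog k -> lap h = 0 ->
  h = \sum_(l < a) IS (h * cpoly (Y l)) *: Y l.
Proof.
move=> hh lh; case: hY => _ /(_ h (conj hh lh))[c [hc _]] ortho.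
rewrite [LHS]hc; apply: eq_bigr => l _; congr (_ *: _).
rewrite [in RHS]hc mulr_suml IS_sum (bigD1 l)//= big1 => [|l' ll'].
  by rewrite addr0 -scalerAl ISZ -sphere_dotE ortho eqxx mulr1.
by rewrite -scalerAl ISZ -sphere_dotE ortho (negbTE ll') mulr0.
Qed.

(** Expand [zonal k x] in the basis: by [IS_zonal] its coefficients are [ck k] times the values at x
    of the conjugated basis. The identity is polynomial in x and y, hence available at complex
    points. *)
Lemma reproducing_kernel (x y : 'rV[C]_n) :
  (ck k)%:C * \sum_(l < a) peval (Y l) y * (peval (Y l) (map_mx Num.conj x))^* =
  meval (fun i => y 0 i) (zonal k (fun i => x 0 i)).
Proof.
rewrite [in RHS](basis_expansion (dhomog_zonal k _) (lap_zonal k _)).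
rewrite raddf_sum mulr_sumr; apply: eq_bigr => l _ /=.
rewrite mevalZ IS_zonal.
- by rewrite -peval_cpoly /peval; ring.
- exact/dhomog_cpoly/basis_homog.
- by rewrite lap_cpoly basis_lap /cpoly raddf0.
Qed.

End Basis.
End SphericalHarmonics.

(** * Size of the basis at complex points *)

Section BasisBound.
Import -(notations) mpoly.
Context {R : realType} {m : nat}.
Hypothesis m_gt0 : (0 < m)%N.
Local Notation n := m.+1.
Local Notation C := R[i].
Local Notation homog d := (ishomog1 d mdeg).

Lemma rcM (x y : R) : (x * y)%:C = x%:C * y%:C.
Proof. exact: rmorphM. Qed.

Lemma rcX (x : R) j : (x ^+ j)%:C = x%:C ^+ j.
Proof. exact: rmorphXn. Qed.

Lemma rcD (x y : R) : (x + y)%:C = x%:C + y%:C.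
Proof. exact: rmorphD. Qed.

Lemma rc_sum (I : Type) (s : seq I) (F : I -> R) :
  (\sum_(i <- s) F i)%:C = \sum_(i <- s) (F i)%:C.
Proof. exact: rmorph_sum. Qed.

Lemma rcV (x : R) : (x^-1)%:C = x%:C^-1.
Proof. exact: fmorphV. Qed.

Definition lie_sq (z : 'rV[C]_n) : R :=
  sqnorm z + Num.sqrt (sqnorm z ^+ 2 - nc (quad z) ^+ 2).

Lemma sqnorm_ge0 (z : 'rV[C]_n) : 0 <= sqnorm z.
Proof. by apply: sumr_ge0 => i _; rewrite sqr_ge0. Qed.

Lemma nc_quad_le (z : 'rV[C]_n) : nc (quad z) <= sqnorm z.
Proof.
rewrite (le_trans (nc_sum _ _ _))//; apply: ler_sum => i _.
by rewrite ncX.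
Qed.

Lemma lie_disc_ge0 (z : 'rV[C]_n) : 0 <= sqnorm z ^+ 2 - nc (quad z) ^+ 2.
Proof.
rewrite subr_ge0 lerXn2r ?nnegrE ?nc_ge0 ?sqnorm_ge0//.
exact: nc_quad_le.
Qed.

Lemma sqnorm_le_lie (z : 'rV[C]_n) : sqnorm z <= lie_sq z.
Proof. by rewrite lerDl sqrtr_ge0. Qed.

Lemma nc_quad_le_lie (z : 'rV[C]_n) : nc (quad z) <= lie_sq z.
Proof. exact: le_trans (nc_quad_le z) (sqnorm_le_lie z). Qed.

Lemma lie_sq_ge0 (z : 'rV[C]_n) : 0 <= lie_sq z.
Proof. exact: le_trans (sqnorm_ge0 z) (sqnorm_le_lie z). Qed.

(** With w = |q| / L^2 this reads |z|^2 = L^2 (1 + w^2) / 2, which makes the kernel a polynomial in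
    w. *)
Lemma lie_sq_root (z : 'rV[C]_n) :
  lie_sq z ^+ 2 + nc (quad z) ^+ 2 = 2 * sqnorm z * lie_sq z.
Proof.
rewrite /lie_sq; have := sqr_sqrtr (lie_disc_ge0 z).
set s := Num.sqrt _; set A := sqnorm z; set B := nc _ ^+ 2 => h.
have -> : B = A ^+ 2 - s ^+ 2 by rewrite h; ring.
ring.
Qed.

(** The recursion for the zonal coefficients involves only rational numbers, so it can be run over R
    instead of R[i]. *)
Definition rcoef k j : R := @zcoef R n k j.

Lemma hcoef_real k j : @hcoef C n k j = (@hcoef R n k j)%:C.
Proof.
elim: j => [|j IH]; first by rewrite rmorph1.
rewrite [LHS]/= [in RHS]/= IH rmorphM fmorphV rmorphN /=.
by rewrite natRC.
Qed.

Lemma zcoef_real k j : @zcoef C n k j = (rcoef k j)%:C.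
Proof. by rewrite /rcoef /zcoef rmorphM /= hcoef_real natRC. Qed.

(** Up to normalisation, the homogenised Gegenbauer polynomial: A stands for x . y and B for q(x)
    q(y). *)
Definition gegen k (A B : R) : R :=
  \sum_(j < (k./2).+1) rcoef k j * B ^+ j * A ^+ (k - 2 * j).

Lemma meval_zonal_diag k (z : 'rV[C]_n) :
  meval (fun i => z 0 i) (zonal k (fun i => (map_mx Num.conj z) 0 i)) =
  (gegen k (sqnorm z) (nc (quad z) ^+ 2))%:C.
Proof.
rewrite meval_zonal /gegen rmorph_sum; apply: eq_bigr => j _ /=.
have -> : \sum_(i < n) (map_mx Num.conj z) 0 i ^+ 2 = (quad z)^*.
  by rewrite /quad rmorph_sum; apply: eq_bigr => i _; rewrite mxE rmorphXn.
have -> : \sum_(i < n) (map_mx Num.conj z) 0 i * z 0 i = (sqnorm z)%:C.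
  rewrite /sqnorm rmorph_sum; apply: eq_bigr => i _ /=.
  by rewrite mxE mulrC -nc_sqr.
rewrite -/(quad z) mulrA -[_ * (quad z)^* ^+ j * _]mulrA -exprMn [_^* * _]mulrC -nc_sqr.
by rewrite zcoef_real !rmorphM !rmorphXn.
Qed.

Section Basis.
Variables (k a : nat) (Y : 'I_a -> mpoly n C).
Hypothesis hY : orthonormal_harmonic_basis k Y.
Hypothesis vol_gt0 : 0 < vol R m.

Lemma ck_gt0 j : 0 < @ck R m j.
Proof.
elim: j => [//|j IH] /=; rewrite divr_gt0 ?mulr_gt0// ltr0n; lia.
Qed.

(** The kernel conjugates its pole; with the pole conj z its terms become the squared moduli of
    Y_l(z). *)
Lemma kernel_diag (z : 'rV[C]_n) :
  @ck R m k * \sum_(l < a) nc (peval (Y l) z) ^+ 2 =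
  gegen k (sqnorm z) (nc (quad z) ^+ 2).
Proof.
apply: complexI; rewrite -meval_zonal_diag -(reproducing_kernel m_gt0 hY).
rewrite rmorphM rmorph_sum; congr (_ * _); apply: eq_bigr => l _ /=.
rewrite nc_sqr; congr (_ * (peval _ _)^*).
by apply/matrixP => i j; rewrite !mxE conjCK.
Qed.

Lemma sqnorm_real (x : 'rV[R]_n) : on_sphere x -> sqnorm (real_point x) = 1.
Proof.
move=> hx; rewrite /sqnorm -[RHS]hx; apply: eq_bigr => i _.
by rewrite mxE nc_real real_normK// num_real.
Qed.

Lemma quad_real (x : 'rV[R]_n) : on_sphere x -> quad (real_point x) = 1.
Proof.
move=> hx; rewrite /quad -(rmorph1 (real_complex R)) -[in RHS]hx rmorph_sum.
by apply: eq_bigr => i _; rewrite mxE rmorphXn.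
Qed.

Lemma kernel_sphere (x : 'rV[R]_n) : on_sphere x ->
  @ck R m k * \sum_(l < a) nc (peval (Y l) (real_point x)) ^+ 2 = gegen k 1 1.
Proof.
by move=> hx; rewrite kernel_diag sqnorm_real// quad_real// nc1 expr1n.
Qed.

(** Integrate [kernel_sphere] over the sphere: each of the a normalised basis elements contributes
    1. *)
Lemma gegen11 : gegen k 1 1 * vol R m = @ck R m k * a%:R.
Proof.
apply: complexI; rewrite !rmorphM /=.
have : \sum_(l < a) IS (Y l * cpoly (Y l)) = a%:R.
  rewrite (eq_bigr (fun _ => 1)) ?sumr_const ?card_ord// => l _.
  by case: hY => _ _ ortho; rewrite -sphere_dotE ortho eqxx.
rewrite -natRC => <-; rewrite -IS_sum -ISZ -IS1 -ISZ.
apply: sphere_intC_ext => x hx.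
rewrite /peval !mevalZ meval1 mulr1 -(kernel_sphere hx) rmorphM rmorph_sum.
rewrite raddf_sum; congr (_ * _); apply: eq_bigr => l _ /=.
by rewrite mevalM -!/(peval _ _) peval_cpoly_real -nc_sqr.
Qed.

Lemma gegen11_ge0 : 0 <= gegen k 1 1.
Proof.
by rewrite -(pmulr_lge0 _ vol_gt0) gegen11 mulr_ge0// ltW// ck_gt0.
Qed.

(** As n >= 2, there are unit vectors x and y with x . y = c. In the kernel, |u v| <= (u^2 + v^2) /
    2 reduces the value at (x, y) to the values at (x, x) and (y, y), which are equal. *)
Lemma gegen_le (c s : R) : c ^+ 2 + s ^+ 2 = 1 -> `|gegen k c 1| <= gegen k 1 1.
Proof.
move=> cs; pose i1 : 'I_n := Ordinal (m_gt0 : (1 < n)%N).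
have i10 : i1 != ord0 by [].
pose x : 'rV[R]_n := \row_i (i == ord0)%:R.
pose y : 'rV[R]_n := \row_i (if i == ord0 then c else if i == i1 then s else 0).
have hx : on_sphere x.
  rewrite /on_sphere (bigD1 ord0)//= big1 => [|i i0]; rewrite !mxE.
    by rewrite eqxx expr1n addr0.
  by rewrite (negbTE i0) expr0n.
have hy : on_sphere y.
  rewrite /on_sphere (bigD1 ord0)//= (bigD1 i1)//= big1 => [|i /andP[i0 ii1]]; rewrite !mxE.
    by rewrite eqxx (negbTE i10) eqxx addr0.
  by rewrite (negbTE i0) (negbTE ii1) expr0n.
have := reproducing_kernel m_gt0 hY (real_point x) (real_point y).
rewrite meval_zonal.
have -> : \sum_(j < (k./2).+1) @zcoef C n k j * (\sum_(i < n) real_point x 0 i ^+ 2) ^+ j *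
    ((\sum_(i < n) real_point y 0 i ^+ 2) ^+ j *
    (\sum_(i < n) real_point x 0 i * real_point y 0 i) ^+ (k - 2 * j)) =
    (gegen k c 1)%:C.
  rewrite /gegen rmorph_sum; apply: eq_bigr => j _ /=.
  rewrite -!/(quad _) !quad_real// !expr1n mulr1 mul1r.
  have -> : \sum_(i < n) real_point x 0 i * real_point y 0 i = c%:C.
    rewrite (bigD1 ord0)//= big1 => [|i i0]; rewrite !mxE.
      by rewrite eqxx rmorph1 mul1r addr0.
    by rewrite (negbTE i0) rmorph0 mul0r.
  by rewrite zcoef_real mulr1 [in RHS]rmorphM /= rmorphXn.
move=> e; rewrite -nc_real -e ncM nc_real gtr0_norm ?ck_gt0//.
apply: (@le_trans _ _ (@ck R m k * \sum_(l < a)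
   (nc (peval (Y l) (real_point x)) ^+ 2 + nc (peval (Y l) (real_point y)) ^+ 2) / 2)).
  rewrite ler_wpM2l ?(ltW (ck_gt0 _))// (le_trans (nc_sum _ _ _))//.
  apply: ler_sum => l _; rewrite ncM nc_conj.
  have -> : map_mx Num.conj (real_point x) = real_point x.
    by apply/matrixP => i j; rewrite !mxE; exact: conjc_real.
  set u := nc _; set v := nc _; have := sqr_ge0 (u - v); rewrite sqrrB -mulr_natr; lra.
rewrite -mulr_suml big_split /= mulrA mulrDr !kernel_sphere//.
by apply: eqr_le; field.
Qed.

Definition gpoly : {poly C} := \sum_(j < (k./2).+1) (rcoef k j)%:C *:
  (((2%:R)^-1 *: (1 + 'X ^+ 2)) ^+ (k - 2 * j) * 'X ^+ (2 * j)).

Lemma horner_gpoly w : gpoly.[w] = \sum_(j < (k./2).+1) (rcoef k j)%:C *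
  (((2%:R)^-1 * (1 + w ^+ 2)) ^+ (k - 2 * j) * w ^+ (2 * j)).
Proof.
by rewrite /gpoly horner_sum; apply: eq_bigr => j _; rewrite !hornerE.
Qed.

Lemma size_gpoly : (size gpoly <= (2 * k).+1)%N.
Proof.
apply: (leq_trans (size_sum _ _ _)); apply/bigmax_leqP => j _.
apply: (leq_trans (size_scale_leq _ _)).
apply: (leq_trans (size_polyMleq _ _)); rewrite size_polyXn addnS /=.
have h : (size ((2%:R : C)^-1 *: (1 + 'X^2)) <= 3)%N.
  apply: (leq_trans (size_scale_leq _ _)).
  by rewrite (leq_trans (size_polyD _ _))// size_polyXn size_poly1.
have ht := size_poly_exp_leq ((2%:R : C)^-1 *: (1 + 'X^2)) (k - 2 * j).
have jk : (2 * j <= k)%N by have := ltn_ord j; lia.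
have hs : ((size ((2%:R : C)^-1 *: (1 + 'X^2))).-1 * (k - 2 * j) <= 2 * (k - 2 * j))%N.
  by rewrite leq_mul2r; apply/orP; right; lia.
apply: (@leq_trans ((2 * (k - 2 * j)).+1 + 2 * j)); last by lia.
by rewrite leq_add2r (leq_trans ht).
Qed.

(** On the circle 1 = w conj w, hence (1 + w^2) / 2 = w Re w and g(w) = w^k [gegen k (Re w) 1]. *)
Lemma gpoly_circle w : nc w = 1 -> nc gpoly.[w] <= gegen k 1 1.
Proof.
move=> w1; pose c := Re w.
have ww : w * w^* = 1 by rewrite -nc_sqr w1 expr1n rmorph1.
have hw : (2%:R)^-1 * (1 + w ^+ 2) = w * c%:C.
  rewrite -[X in X + w ^+ 2]ww -[w ^+ 2]/(w * w) -mulrDr mulrCA; congr (_ * _).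
  have -> : w^* + w = (2 * c)%:C.
    by rewrite /c; case: (w) => x y; apply: complex_ext => /=; ring.
  by rewrite rcM -natRC mulrA mulVf ?mul1r// pnatr_eq0.
have -> : gpoly.[w] = w ^+ k * (gegen k c 1)%:C.
  rewrite horner_gpoly /gegen rc_sum mulr_sumr; apply: eq_bigr => j _.
  have jk : (2 * j <= k)%N by have := ltn_ord j; lia.
  rewrite hw expr1n mulr1 rcM rcX exprMn.
  have -> : w ^+ k = w ^+ (k - 2 * j) * w ^+ (2 * j) by rewrite -exprD subnK.
  by move: (w ^+ (k - 2 * j)) (w ^+ (2 * j)) => x y; ring.
rewrite ncM ncX w1 expr1n mul1r nc_real; apply: (@gegen_le c (Im w)).
have : nc w ^+ 2 = 1 by rewrite w1 expr1n.
by rewrite /c; case: (w) => x y /=; rewrite sqr_sqrtr// addr_ge0// sqr_ge0.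
Qed.

(** The factor 2 k + 1 counts the coefficients of g and 2 is that of [coef_bound]. The case L(z) = 0
    is separate, since w is a quotient by L(z)^2. *)
Lemma gegen_lie (z : 'rV[C]_n) : gegen k (sqnorm z) (nc (quad z) ^+ 2) <=
  lie_sq z ^+ k * ((2 * k).+1%:R * (2 * gegen k 1 1)).
Proof.
pose u := lie_sq z; pose v := nc (quad z).
have u0 : 0 <= u := lie_sq_ge0 z.
have G0 := gegen11_ge0.
have [uz|un] := eqVneq u 0.
  have s0 : sqnorm z = 0 by apply/eqP; rewrite eq_le sqnorm_ge0 -uz sqnorm_le_lie.
  have q0 : nc (quad z) = 0.
    by apply/eqP; rewrite eq_le nc_ge0 andbT -uz; exact: nc_quad_le_lie.
  rewrite -/u uz s0 q0.
  have [k0|k0] := posnP k.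
    rewrite k0 /gegen big_ord1 /= !expr0 /rcoef /zcoef /= !mulr1.
    rewrite mul1r /gegen big_ord1 /= !expr0 /rcoef /zcoef /= !mulr1 mul1r.
    lra.
  rewrite [0 ^+ 2]expr0n /= [0 ^+ k]expr0n (gtn_eqF k0) mul0r /gegen big1// => j _.
  case: (nat_of_ord j) => [|j'].
    by rewrite muln0 subn0 [0 ^+ k]expr0n (gtn_eqF k0) mulr0.
  by rewrite [0 ^+ j'.+1]expr0n mulr0 mul0r.
have upos : 0 < u by rewrite lt0r un.
pose w := v / u.
have w01 : 0 <= w <= 1.
  rewrite divr_ge0 ?nc_ge0//= ler_pdivrMr// mul1r.
  exact: nc_quad_le_lie.
have hA : sqnorm z = u * (2^-1 * (1 + w ^+ 2)).
  have := lie_sq_root z; rewrite -/u -/v => h.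
  have -> : u * (2^-1 * (1 + w ^+ 2)) = (u ^+ 2 + v ^+ 2) / (2 * u).
    by rewrite /w; field.
  by rewrite h; field.
have hB : nc (quad z) ^+ 2 = (u * w) ^+ 2 by rewrite /w mulrC divfK.
have -> : gegen k (sqnorm z) (nc (quad z) ^+ 2) = u ^+ k * Re gpoly.[w%:C].
  have -> : gpoly.[w%:C] = ((\sum_(j < (k./2).+1) rcoef k j *
     ((2^-1 * (1 + w ^+ 2)) ^+ (k - 2 * j) * w ^+ (2 * j)))%:C)%C.
    rewrite horner_gpoly rc_sum; apply: eq_bigr => j _.
    have -> : (2%:R)^-1 * (1 + w%:C ^+ 2) = (2^-1 * (1 + w ^+ 2))%:C :> C.
      rewrite (rcM 2^-1 (1 + w ^+ 2)) (rcV 2) (rcD 1 (w ^+ 2)) (rcX w 2).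
      by rewrite (natRC 2%N).
    by rewrite [RHS]rcM [(_ ^+ _ * _)%:C]rcM !rcX.
  rewrite /= /gegen mulr_sumr; apply: eq_bigr => j _.
  have jk : (2 * j <= k)%N by have := ltn_ord j; lia.
  have -> : u ^+ k = u ^+ (k - 2 * j) * u ^+ (2 * j) by rewrite -exprD subnK.
  rewrite hA hB -exprM !exprMn.
  move: (u ^+ (k - 2 * j)) (u ^+ (2 * j)) (w ^+ (2 * j)) => x y x'; ring.
rewrite ler_wpM2l ?exprn_ge0//.
rewrite (le_trans (ler_norm _))// (le_trans (nc_Re _))//.
rewrite (horner_coef_wide _ size_gpoly) (le_trans (nc_sum _ _ _))//.
have -> : (2 * k).+1%:R * (2 * gegen k 1 1) = \sum_(i < (2 * k).+1) 2 * gegen k 1 1.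
  by rewrite sumr_const card_ord mulr_natl.
apply: ler_sum => i _; rewrite ncM ncX nc_real.
have /andP[w0 w1] := w01.
rewrite -[leRHS]mulr1; apply: ler_pM; rewrite ?nc_ge0 ?exprn_ge0//.
  by apply: coef_bound; exact: gpoly_circle.
by rewrite ger0_norm// exprn_ile1.
Qed.

Lemma basis_norm_bound (z : 'rV[C]_n) l :
  nc (peval (Y l) z) ^+ 2 <= (2 * k).+1%:R * (2 * (a%:R / vol R m)) * lie_sq z ^+ k.
Proof.
apply: (@le_trans _ _ (\sum_(l < a) nc (peval (Y l) z) ^+ 2)).
  rewrite (bigD1 l)//= lerDl; apply: sumr_ge0 => i _; exact: sqr_ge0.
have c0 := ck_gt0 k.
rewrite -(ler_pM2l c0) kernel_diag (le_trans (gegen_lie z))//.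
have -> : gegen k 1 1 = @ck R m k * (a%:R / vol R m).
  by rewrite mulrA -gegen11 mulfK// gt_eqF.
by apply: eqr_le; ring.
Qed.

End Basis.
End BasisBound.

(** * Homogeneous expansion in the Lie ball *)

Section Differentiability.
Context {R : realType}.
Local Notation C := R[i].

Lemma lt0C_Re (e : C) : 0 < e -> e = (Re e)%:C /\ 0 < Re e.
Proof.
case: e => a b; rewrite ltcE /= => /andP[/eqP b0 a0]; split => //.
by apply: complex_ext => /=.
Qed.

Lemma differentiable_line (V : normedModType C) (f : V -> C) (x y : V) (l : C) :
  differentiable f (x + l *: y) -> cdiff (fun l => f (x + l *: y)) l.
Proof.
move=> df.
have dg : differentiable (fun l : C => x + l *: y) l.
  by [].
have : differentiable (f \o (fun l : C => x + l *: y)) l by apply: differentiable_comp.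
move=> /derivable1_diffP /cvg_ex[d /cvgrPdist_le hd].
exists d => e e0.
have eC : (0 : C) < e%:C by rewrite ltcR.
have /nbhs_ballP[r /= r0 hr] := hd _ eC.
have [rE rr0] := lt0C_Re r0.
exists (Re r) => // z zr.
have [->|zl] := eqVneq z l.
  by rewrite !subrr mulr0 subr0 nc0 mulr0.
have h0 : z - l != 0 by rewrite subr_eq0.
have := hr (z - l).
rewrite /ball /= sub0r normrN normr_nc rE ltcR => /(_ zr h0).
rewrite /= scaler1 subrK normr_nc lecR => hz.
have -> : f (x + z *: y) - f (x + l *: y) - d * (z - l) =
  - ((z - l) * (d - (z - l)^-1 *: (f (x + z *: y) - f (x + l *: y)))).
  rewrite /GRing.scale /=; field.
  exact: h0.
by rewrite ncN ncM mulrC ler_wpM2r ?nc_ge0.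
Qed.

Lemma cdiff_differentiable (phi : C -> C) (z : C) : cdiff phi z -> differentiable phi z.
Proof.
move=> [d hd]; apply/derivable1_diffP; apply/cvg_ex; exists d.
apply/cvgrPdist_le => e e0; have [eE re0] := lt0C_Re e0.
have [r r0 hr] := hd _ re0.
apply/nbhs_ballP; exists r%:C => /=; first by rewrite ltcR.
move=> h; rewrite /ball /= sub0r normrN normr_nc ltcR => hh h0.
rewrite /= scaler1 normr_nc eE lecR.
have := hr (h + z); rewrite addrK => /(_ hh) H.
have -> : d - h^-1 *: (phi (h + z) - phi z) = - (h^-1 * (phi (h + z) - phi z - d * h)).
  by rewrite /GRing.scale /=; field; exact: h0.
by rewrite ncN ncM ncV ler_pdivrMl ?nc_gt0// [leRHS]mulrC.
Qed.

Lemma differentiable_local_bound (n : nat) (f : 'rV[C]_n -> C) : differentiable f 0 ->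
  exists2 e : R, 0 < e & forall z : 'rV[C]_n, (forall i, nc (z 0 i) < e) -> nc (f z) <= nc (f 0) + 1.
Proof.
move=> /differentiable_continuous /cvgrPdist_lt /(_ 1 ltr01) /nbhs_ballP[r /= r0 hr].
have [rE rr0] := lt0C_Re r0.
exists (Re r) => // z hz.
have : nc (f 0 - f z) < 1.
  rewrite -ltcR -normr_nc rmorph1; apply: hr; split => // i j.
  by rewrite /ball /= mxE sub0r normrN normr_nc rE ltcR ord1; exact: hz.
move=> h; have -> : f z = f 0 - (f 0 - f z) by ring.
by apply: (le_trans (ncB _ _)); rewrite lerD2l; exact: ltW.
Qed.

End Differentiability.

(** * Functions that are polynomial in each variable *)

Section SeparatePolynomial.
Import -(notations) mpoly.
Context {F : fieldType} {n : nat}.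

Definition updv (z : 'rV[F]_n) (j : 'I_n) (x : F) : 'rV[F]_n :=
  \row_i (if i == j then x else z 0 i).

(** Induction on the number of free variables: with the coordinates from k on frozen, freeing one
    more expresses u by interpolation through functions in which that coordinate is frozen at a
    node. *)
Lemma separately_polynomial (N : nat) (node : 'I_N -> F) (L : 'I_N -> {poly F})
  (u : 'rV[F]_n -> F) :
  (forall z j, u z = \sum_(i < N) (L i).[z 0 j] * u (updv z j (node i))) ->
  exists P : mpoly n F, forall z : 'rV[F]_n, u z = meval (fun i => z 0 i) P.
Proof.
move=> hu.
have H k : (k <= n)%N -> forall w : 'rV[F]_n, exists P : mpoly n F,
    forall z : 'rV[F]_n, (forall i : 'I_n, (k <= i)%N -> z 0 i = w 0 i) ->
      u z = meval (fun i => z 0 i) P.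
  elim: k => [|k IH] kn w.
    exists (mpolyC n (u w)) => z hz; rewrite mevalC; congr u.
    by apply/matrixP => i j; rewrite ord1; exact: hz.
  pose j := Ordinal kn.
  have /choice[Q hQ] : forall i, exists P : mpoly n F,
    forall z : 'rV[F]_n, (forall l : 'I_n, (k <= l)%N -> z 0 l = (updv w j (node i)) 0 l) ->
      u z = meval (fun i => z 0 i) P by move=> i; apply: IH; exact: ltnW.
  pose sub i : n.-tuple (mpoly n F) :=
    [tuple (if l == j then mpolyC n (node i) else mpolyX F (mnm1 l)) | l < n].
  pose Lj i : mpoly n F := \sum_(d < size (L i)) (L i)`_d *: (mpolyX F (mnm1 j)) ^+ d.
  exists (\sum_(i < N) Lj i * comp_mpoly (sub i) (Q i)) => z hz.
  rewrite (hu z j) raddf_sum; apply: eq_bigr => i _ /=.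
  rewrite mevalM; congr (_ * _).
    rewrite /Lj raddf_sum horner_coef; apply: eq_bigr => d _ /=.
    by rewrite mevalZ rmorphXn /= mevalXU.
  rewrite comp_mpoly_meval (hQ i) => [|l kl].
    apply: meval_eq => l; rewrite tnth_mktuple mxE; case: ifP => _.
      by rewrite mevalC.
    by rewrite mevalXU.
  rewrite !mxE; case: eqP => // /eqP lj; apply: hz.
  by rewrite ltn_neqAle kl andbT; apply: contraNneq lj => e; apply/eqP/val_inj.
have [P hP] := H n (leqnn n) 0; exists P => z; apply: hP => i.
by rewrite leqNgt ltn_ord.
Qed.

End SeparatePolynomial.

(** * Taylor coefficients along complex lines through 0 *)

Section HomogeneousExpansion.
Import -(notations) mpoly.
Context {R : realType} {m : nat}.
Local Notation n := m.+1.
Local Notation C := R[i].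
Local Notation homog d := (ishomog1 d mdeg).
Variables (rho : R) (f : 'rV[C]_n -> C).
Hypothesis rho_gt0 : 0 < rho.
Hypothesis hf : holomorphic_on (@lie_ball R n rho) f.

Lemma lie_ballE (z : 'rV[C]_n) : lie_ball rho z <-> lie_sq z < rho ^+ 2.
Proof. by []. Qed.

Lemma sqnormZ (l : C) (z : 'rV[C]_n) : sqnorm (l *: z) = nc l ^+ 2 * sqnorm z.
Proof.
by rewrite /sqnorm mulr_sumr; apply: eq_bigr => i _; rewrite mxE ncM exprMn.
Qed.

Lemma quadZ (l : C) (z : 'rV[C]_n) : quad (l *: z) = l ^+ 2 * quad z.
Proof.
by rewrite /quad mulr_sumr; apply: eq_bigr => i _; rewrite mxE exprMn.
Qed.

Lemma lie_sqZ (l : C) (z : 'rV[C]_n) : lie_sq (l *: z) = nc l ^+ 2 * lie_sq z.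
Proof.
rewrite /lie_sq sqnormZ quadZ ncM ncX !exprMn -mulrBr sqrtrM ?sqr_ge0//.
by rewrite sqrtr_sqr ger0_norm ?sqr_ge0// mulrDr.
Qed.

Lemma lie_sq_small (z : 'rV[C]_n) (e : R) : (forall i, nc (z 0 i) <= e) ->
  lie_sq z <= 2 * (n%:R * e ^+ 2).
Proof.
move=> hz; have s : sqnorm z <= n%:R * e ^+ 2.
  rewrite mulr_natl -[X in _ *+ X]card_ord -sumr_const; apply: ler_sum => i _.
  by rewrite lerXn2r ?nnegrE ?nc_ge0// (le_trans (nc_ge0 (z 0 i))).
apply: (@le_trans _ _ (2 * sqnorm z)); last by rewrite ler_wpM2l.
rewrite /lie_sq mulr_natl mulr2n lerD2l -[leRHS]ger0_norm ?sqnorm_ge0//.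
rewrite -sqrtr_sqr ler_wsqrtr// gerBl sqr_ge0//.
Qed.

Lemma cdiff_line (x y : 'rV[C]_n) (l : C) : lie_ball rho (x + l *: y) ->
  cdiff (fun l => f (x + l *: y)) l.
Proof. by move=> /hf; exact: differentiable_line. Qed.

Lemma cdiff_slice (z : 'rV[C]_n) (l : C) : lie_ball rho (l *: z) ->
  cdiff (fun l => f (l *: z)) l.
Proof.
move=> h; have -> : (fun l => f (l *: z)) = (fun l => f (0 + l *: z)).
  by apply/funext => y; rewrite add0r.
by apply: cdiff_line; rewrite add0r.
Qed.

(** One bound for all lines near 0; it makes the constants of [slice_coef_interpolation] independent
    of t. *)
Lemma local_polydisc : exists e M : R, [/\ 0 < e, 0 <= M &
  forall z : 'rV[C]_n, (forall i, nc (z 0 i) < e) -> lie_ball rho z /\ nc (f z) <= M].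
Proof.
have b0 : lie_ball rho (0 : 'rV[C]_n).
  apply/lie_ballE; rewrite -(scale0r (0 : 'rV[C]_n)) lie_sqZ nc0 expr0n mul0r.
  by rewrite exprn_gt0.
have [e e0 he] := differentiable_local_bound (hf b0).
have [d d0 hd] : exists2 d : R, 0 < d & 2 * (n%:R * d ^+ 2) < rho ^+ 2.
  exists (rho / (2 * n%:R)); first by rewrite divr_gt0// mulr_gt0.
  have n0 : (n%:R : R) != 0 by rewrite pnatr_eq0.
  have -> : 2 * (n%:R * (rho / (2 * n%:R)) ^+ 2) = rho ^+ 2 / (2 * n%:R).
    by field.
  rewrite ltr_pdivrMr ?mulr_gt0// ltr_pMr ?exprn_gt0//.
  by rewrite -natrM ltr1n; lia.
exists (Num.min e d), (nc (f 0) + 1); split.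
- by rewrite lt_min e0.
- by rewrite addr_ge0 ?nc_ge0.
- move=> z hz; split.
    apply/lie_ballE; apply: le_lt_trans hd; apply: lie_sq_small => i.
    by have := hz i; rewrite lt_min => /andP[_ /ltW].
  by apply: he => i; have := hz i; rewrite lt_min => /andP[].
Qed.

(** The summand 1 makes it positive at z = 0 and strictly larger than the modulus of each
    coordinate. *)
Definition bnd (z : 'rV[C]_n) : R := 1 + \sum_(i < n) nc (z 0 i).

Lemma bnd_gt0 (z : 'rV[C]_n) : 0 < bnd z.
Proof. by rewrite ltr_pwDl// sumr_ge0// => i _; exact: nc_ge0. Qed.

Lemma nc_lt_bnd (z : 'rV[C]_n) i : nc (z 0 i) < bnd z.
Proof.
rewrite /bnd (bigD1 i)//= addrCA ltrDl ltr_pwDl// sumr_ge0// => j _.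
exact: nc_ge0.
Qed.

(** Only small l are involved, so z need not lie in the Lie ball; the coefficients are thus
    functions on all of C^n. *)
Lemma exists_slice_taylor (z : 'rV[C]_n) : exists c, is_taylor (fun l => f (l *: z)) c.
Proof.
have [e [M [e0 M0 he]]] := local_polydisc.
have [||c [hc _]] := @taylor_exists R (fun l => f (l *: z)) (e / bnd z).
- by rewrite divr_gt0// bnd_gt0.
- move=> l hl; apply: cdiff_slice; apply: (he _ _).1 => i.
  rewrite mxE ncM; move: hl; rewrite ltr_pdivlMr ?bnd_gt0//.
  by apply: le_lt_trans; rewrite ler_wpM2l ?nc_ge0// ltW// nc_lt_bnd.
- by exists c.
Qed.

Definition slice_coef : 'rV[C]_n -> nat -> C := projT1 (choice exists_slice_taylor).

Lemma slice_coefP (z : 'rV[C]_n) : is_taylor (fun l => f (l *: z)) (slice_coef z).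
Proof. exact: (projT2 (choice exists_slice_taylor) z). Qed.

Lemma slice_coefZ (l : C) (z : 'rV[C]_n) d : slice_coef (l *: z) d = l ^+ d * slice_coef z d.
Proof.
have h : is_taylor (fun t => f (t *: (l *: z))) (fun d => l ^+ d * slice_coef z d).
  move=> N; have [K [r [K0 r0 hK]]] := slice_coefP z N.
  exists (K * (nc l + 1) ^+ N), (r / (nc l + 1)).
  have l1 : 0 < nc l + 1 by rewrite ltr_wpDl// nc_ge0.
  split; [by rewrite mulr_ge0// exprn_ge0// ltW|by rewrite divr_gt0|].
  move=> w; rewrite ltr_pdivlMr// => hw.
  have wl : nc (w * l) <= nc w * (nc l + 1).
    by rewrite ncM ler_wpM2l ?nc_ge0// lerDl.
  have := hK (w * l) (le_lt_trans wl hw); rewrite scalerA => h1.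
  rewrite (eq_bigr (fun d : 'I_N => slice_coef z d * (w * l) ^+ d)); last first.
    by move=> i _; rewrite exprMn; ring.
  rewrite (le_trans h1)// -mulrA -exprMn [_ * nc w]mulrC ler_wpM2l// lerXn2r ?nnegrE ?nc_ge0//.
  by rewrite mulr_ge0 ?nc_ge0// ltW.
by rewrite (is_taylor_unique (slice_coefP (l *: z)) h).
Qed.

(* Both sides are the coefficients of t^d in f (t (x + zeta y)) and in its
   Lagrange interpolation in zeta, which agree up to O(t^N). *)
Lemma slice_coef_interpolation (N : nat) (node : nat -> C) (x y : 'rV[C]_n) (zeta : C) d :
  injective node -> (d < N)%N ->
  slice_coef (x + zeta *: y) d =
    \sum_(i < N) (tnth (lagrange N node) i : {poly C}).[zeta] * slice_coef (x + node i *: y) d.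
Proof.
move=> inj dN; pose L (i : 'I_N) := (tnth (lagrange N node) i : {poly C}).[zeta].
apply/eqP; rewrite -subr_eq0; apply/eqP.
apply: (@small_poly_eq0 R N (fun d => slice_coef (x + zeta *: y) d -
   \sum_(i < N) L i * slice_coef (x + node i *: y) d)) => //.
have [e [M [e0 M0 he]]] := local_polydisc.
pose r := e / (2 * bnd y).
have r0 : 0 < r by rewrite divr_gt0// mulr_gt0// bnd_gt0.
have line (t : R) : 0 < t < e / (2 * bnd x) -> forall xi : C, nc xi <= r ->
    lie_ball rho (t%:C *: x + xi *: y) /\ nc (f (t%:C *: x + xi *: y)) <= M.
  move=> /andP[t0 te] xi hxi; apply: he => i; rewrite !mxE.
  rewrite (le_lt_trans (ncD _ _))// !ncM nc_real gtr0_norm//.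
  have h1 : t * nc (x 0 i) < e / 2.
    apply: (@le_lt_trans _ _ (t * bnd x)).
      by rewrite ler_wpM2l ?(ltW t0)// ltW// nc_lt_bnd.
    by move: te; rewrite invfM mulrA ltr_pdivlMr ?bnd_gt0.
  have h2 : nc xi * nc (y 0 i) <= e / 2.
    apply: (@le_trans _ _ (r * bnd y)).
      by apply: ler_pM; rewrite ?nc_ge0// ltW// nc_lt_bnd.
    by rewrite /r; have := bnd_gt0 y; move: (bnd y) => b b0;
      apply: eqr_le; field; rewrite gt_eqF.
  lra.
have r20 : 0 < r / 2 by rewrite divr_gt0.
pose K1 := 4 * M / (r / 2) ^+ N.
have K10 : 0 <= K1 by rewrite divr_ge0 ?mulr_ge0// exprn_ge0// ltW.
(* For each small t the function xi -> f (t x + xi y) has a polynomial approximation p of degree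
   below N near 0; the point is that [K1] does not depend on t. *)
have lineT (t : R) : 0 < t < e / (2 * bnd x) -> exists p : {poly C}, (size p <= N)%N /\
    forall xi, nc xi <= r / 4 ->
    nc (f (t%:C *: x + xi *: y) - p.[xi]) <= K1 * nc xi ^+ N.
  move=> ht; have [|b [_ hb]] := @taylor_exists R (fun xi => f (t%:C *: x + xi *: y)) r r0.
    by move=> xi hxi; apply: cdiff_line; have [] := line t ht xi (ltW hxi).
  exists (\poly_(i < N) b i); split; first exact: size_poly.
  move=> xi hxi; have h01 : 0 < r / 2 < r by apply/andP; split => //; lra.
  have [|hb1 _] := hb (r / 2) M h01.
    by move=> xi' hxi'; have [|_ ] := line t ht xi' _ => //; rewrite hxi'; lra.
  have xr : nc xi < r / 2 by lra.
  rewrite horner_poly (le_trans (hb1 N xi xr))// expr_div_n.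
  have -> : K1 * nc xi ^+ N = 2 * M * (nc xi ^+ N / (r / 2) ^+ N) * 2.
    by rewrite /K1; field; rewrite expf_neq0// gt_eqF.
  rewrite ler_wpM2l//.
    by rewrite !mulr_ge0// ?invr_ge0 ?exprn_ge0// ?nc_ge0// ltW.
  by rewrite ler_pdivrMr; lra.
have tay (z : 'rV[C]_n) : exists K d, [/\ 0 <= K, 0 < d & forall t : R, 0 < t < d ->
    nc (f (t%:C *: z) - \sum_(k < N) slice_coef z k * t%:C ^+ k) <= K * t ^+ N].
  have [K [d' [K0 d'0 hK]]] := slice_coefP z N; exists K, d'; split => // t /andP[t0 td].
  by have := hK t%:C; rewrite nc_real gtr0_norm//; apply.
have [K2 [d2 [K20 d20 h2]]] := tay (x + zeta *: y).
have /choice[K3 hK3] := fun i : 'I_N => tay (x + node i *: y).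
have /choice[d3 hd3] := hK3.
pose D := \big[Num.min/d2]_(i < N) d3 i.
have D0 : 0 < D.
  rewrite /D; apply: (big_ind (fun v : R => 0 < v)) => //.
    by move=> u v u0 v0; rewrite lt_min u0.
  by move=> i _; have [] := hd3 i.
have Dd2 : D <= d2 by apply: bigmin_le_id.
have Dd3 i : D <= d3 i by apply: bigmin_le_cond.
pose Z := 1 + nc zeta + \sum_(i < N) nc (node i).
have Z0 : 0 < Z.
  rewrite ltr_wpDr ?ltr_wpDr ?nc_ge0//; apply: sumr_ge0 => i _; exact: nc_ge0.
have zZ : nc zeta <= Z.
  rewrite /Z addrAC lerDr addr_ge0// sumr_ge0// => i _; exact: nc_ge0.
have nZ (i : 'I_N) : nc (node i) <= Z.
  rewrite /Z (bigD1 i)//= addrCA lerDl addr_ge0 ?addr_ge0 ?nc_ge0// sumr_ge0// => j _.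
  exact: nc_ge0.
pose SL := \sum_(i < N) nc (L i).
exists (K1 * Z ^+ N + SL * (K1 * Z ^+ N) + K2 + \sum_(i < N) nc (L i) * K3 i).
exists (Num.min D (Num.min (e / (2 * bnd x)) (r / (4 * Z)))); split.
  by rewrite !lt_min D0 !divr_gt0// mulr_gt0// bnd_gt0.
move=> t; rewrite !lt_min => /and4P[t0 tD tx tZ].
have tx' : 0 < t < e / (2 * bnd x) by rewrite t0.
have [p [sp hp]] := lineT t tx'.
have shift (z0 : C) : t%:C *: (x + z0 *: y) = t%:C *: x + (t%:C * z0) *: y.
  by rewrite scalerDr scalerA.
have err (z0 : C) : nc z0 <= Z ->
    nc (f (t%:C *: (x + z0 *: y)) - p.[t%:C * z0]) <= K1 * Z ^+ N * t ^+ N.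
  move=> hz; rewrite shift; have nt : nc (t%:C * z0) <= t * Z.
    by rewrite ncM nc_real gtr0_norm// ler_wpM2l// ltW.
  have small : nc (t%:C * z0) <= r / 4.
    rewrite (le_trans nt)//; move: tZ; rewrite invfM mulrA ltr_pdivlMr// => /ltW //.
  rewrite (le_trans (hp _ small))// -mulrA ler_wpM2l// -exprMn [Z * t]mulrC.
  by rewrite lerXn2r ?nnegrE ?nc_ge0// mulr_ge0// ltW.
(* Interpolation in zeta is exact for zeta -> p (t zeta), a polynomial of degree below N. *)
have interp : p.[t%:C * zeta] = \sum_(i < N) L i * p.[t%:C * node i].
  pose q := p \Po (t%:C *: 'X).
  have qE z0 : q.[z0] = p.[t%:C * z0] by rewrite horner_comp !hornerE.
  have N_gt0 : (0 < N)%N := leq_ltn_trans (leq0n d) dN.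
  rewrite -qE [in LHS](lagrange_gen N_gt0 inj (p := q)).
    by rewrite horner_sum; apply: eq_bigr => i _; rewrite hornerM hornerC qE mulrC.
  rewrite (leq_trans (size_comp_poly_leq _ _))//.
  have hv : ((size (t%:C *: 'X : {poly C})%R).-1 <= 1)%N.
    rewrite -subn1 leq_subLR.
    by apply: (leq_trans (size_scale_leq _ _)); rewrite size_polyX.
  apply: (@leq_trans (size p).-1.+1).
    by rewrite ltnS -[leqRHS]muln1 leq_mul2l hv orbT.
  by move: sp; case: (size _) => [|s] //= _; apply: leq_ltn_trans dN.
pose T (z0 : C) := \sum_(k < N) slice_coef (x + z0 *: y) k * t%:C ^+ k.
have -> : \sum_(k < N) (slice_coef (x + zeta *: y) k -
     \sum_(i < N) L i * slice_coef (x + node i *: y) k) * t%:C ^+ k =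
  T zeta - \sum_(i < N) L i * T (node i).
  under eq_bigr do rewrite mulrBl.
  rewrite sumrB; congr (_ - _); under eq_bigr do rewrite mulr_suml.
  rewrite exchange_big /=; apply: eq_bigr => i _; rewrite /T mulr_sumr.
  by apply: eq_bigr => k _; rewrite mulrA.
pose ff (z0 : C) := f (t%:C *: (x + z0 *: y)).
(* The errors, all O(t^N), are the Taylor remainders in t at zeta and at the nodes, and the
   distances from f to p at the same points; p itself drops out by [interp]. *)
have -> : T zeta - \sum_(i < N) L i * T (node i) =
  - (ff zeta - T zeta) + \sum_(i < N) L i * (ff (node i) - T (node i)) +
  ((ff zeta - p.[t%:C * zeta]) - \sum_(i < N) L i * (ff (node i) - p.[t%:C * node i])).
  have dist (g h : 'I_N -> C) : \sum_(i < N) L i * (g i - h i) =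
      \sum_(i < N) L i * g i - \sum_(i < N) L i * h i.
    by rewrite -sumrB; apply: eq_bigr => i _; rewrite mulrBr.
  by rewrite interp !dist; ring.
have e1 : nc (ff zeta - T zeta) <= K2 * t ^+ N.
  by apply: h2; rewrite t0 (lt_le_trans tD).
have e2 : nc (\sum_(i < N) L i * (ff (node i) - T (node i))) <=
    (\sum_(i < N) nc (L i) * K3 i) * t ^+ N.
  rewrite (le_trans (nc_sum _ _ _))// mulr_suml; apply: ler_sum => i _.
  rewrite ncM -mulrA ler_wpM2l ?nc_ge0//; have [_ _ h] := hd3 i; apply: h.
  by rewrite t0 (lt_le_trans tD).
have e3 : nc (ff zeta - p.[t%:C * zeta]) <= K1 * Z ^+ N * t ^+ N by exact: err.
have e4 : nc (\sum_(i < N) L i * (ff (node i) - p.[t%:C * node i])) <=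
    SL * (K1 * Z ^+ N) * t ^+ N.
  rewrite (le_trans (nc_sum _ _ _))// -mulrA mulr_suml; apply: ler_sum => i _.
  by rewrite ncM ler_wpM2l ?nc_ge0//; exact: err.
rewrite (le_trans (ncD _ _))//.
apply: (@le_trans _ _ ((K2 * t ^+ N + (\sum_(i < N) nc (L i) * K3 i) * t ^+ N) +
   (K1 * Z ^+ N * t ^+ N + SL * (K1 * Z ^+ N) * t ^+ N))); last first.
  by apply: eqr_le; ring.
apply: lerD.
  by apply: (le_trans (ncD _ _)); rewrite ncN; exact: lerD.
by apply: (le_trans (ncB _ _)); exact: lerD.
Qed.

End HomogeneousExpansion.

Section HomogeneousComponents.
Import -(notations) mpoly.
Context {R : realType} {m : nat}.
Local Notation n := m.+1.
Local Notation C := R[i].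
Local Notation homog d := (ishomog1 d mdeg).
Variables (rho : R) (f : 'rV[C]_n -> C).
Hypothesis rho_gt0 : 0 < rho.
Hypothesis hf : holomorphic_on (@lie_ball R n rho) f.

Let scoef := slice_coef rho_gt0 hf.

(** The coordinate j is varied along the line through [updv z j 0] in the direction [ej]; d + 1
    nodes suffice for the d-th coefficient. *)
Lemma slice_coef_polynomial d : exists P : mpoly n C, forall z, scoef z d = peval P z.
Proof.
pose node (i : nat) : C := i%:R.
have inj : injective node by move=> i j /eqP; rewrite /node eqr_nat => /eqP.
apply: (@separately_polynomial _ _ d.+1 (fun i => node i)
  (fun i => tnth (lagrange d.+1 node) i) (fun z => scoef z d)) => z j.
pose ej : 'rV[C]_n := \row_l (l == j)%:R.
have updE x : updv z j x = updv z j 0 + x *: ej.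
  apply/matrixP => i l; rewrite !mxE; case: eqP => _; first by rewrite mulr1 add0r.
  by rewrite mulr0 addr0.
have zE : z = updv z j 0 + z 0 j *: ej.
  rewrite -updE; apply/matrixP => i l; rewrite !mxE ord1.
  by case: eqP => // ->.
rewrite {1}zE /scoef (slice_coef_interpolation rho_gt0 hf _ _ _ inj (ltnSn d)).
by apply: eq_bigr => i _; rewrite -updE.
Qed.

Lemma peval_scale (p : mpoly n C) d (l : C) (z : 'rV[C]_n) : p \is homog d ->
  peval p (l *: z) = l ^+ d * peval p z.
Proof.
move=> hp; rewrite /peval -(meval_dhomog l (fun i => z 0 i) hp).
by apply: meval_eq => i; rewrite mxE.
Qed.

(** Only the values of P are known to be homogeneous. Comparing the powers of t in P (t z) isolates
    the values of its component of degree d. *)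
Lemma homogeneous_component (P : mpoly n C) d :
  (forall (l : C) z, peval P (l *: z) = l ^+ d * peval P z) ->
  forall z, peval (pihomog mdeg d P) z = peval P z.
Proof.
move=> hP z; pose K := maxn (msize P) d.+1.
pose c k := peval (pihomog mdeg k P) z - (k == d)%:R * peval P z.
suff : c d = 0 by rewrite /c eqxx mul1r => /eqP; rewrite subr_eq0 => /eqP.
apply: (@small_poly_eq0 R K c); last by rewrite /K leq_max leqnn orbT.
exists 0, 1; split => // t _; rewrite mul0r.
suff -> : \sum_(k < K) c k * t%:C ^+ k = 0 by rewrite nc0.
have hK : (msize P <= K)%N by rewrite leq_max leqnn.
have e1 : \sum_(k < K) peval (pihomog mdeg k P) z * t%:C ^+ k =
    peval P (t%:C *: z).
  rewrite {2}(pihomog_partitionE hK) /peval raddf_sum; apply: eq_bigr => k _ /=.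
  by have := peval_scale t%:C z (pihomogP mdeg k P); rewrite /peval mulrC.
rewrite /c; under eq_bigr do rewrite mulrBl.
rewrite sumrB e1 hP; have dK : (d < K)%N by rewrite /K leq_max leqnn orbT.
rewrite (bigD1 (Ordinal dK))//= eqxx mul1r big1 ?addr0 => [|k kd].
  by rewrite mulrC subrr.
rewrite -val_eqE /= in kd.
by rewrite (negbTE kd) !mul0r.
Qed.

Theorem homogeneous_expansion : exists F : nat -> mpoly n C,
  (forall d, F d \is homog d) /\
  forall (z : 'rV[C]_n) r0, 0 < r0 ->
    (forall l : C, nc l < r0 -> lie_ball rho (l *: z)) ->
  forall r M, 0 < r < r0 -> (forall l : C, nc l = r -> nc (f (l *: z)) <= M) ->
    (forall N l, nc l < r -> nc (f (l *: z) - \sum_(d < N) peval (F d) (l *: z)) <=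
        2 * M * (nc l / r) ^+ N * (r / (r - nc l))) /\
    (forall d, nc (peval (F d) z) <= 2 * M / r ^+ d).
Proof.
have /choice[P hP] := slice_coef_polynomial.
have hF d z : peval (pihomog mdeg d (P d)) z = scoef z d.
  rewrite hP; apply: homogeneous_component => l w.
  by rewrite -!hP; exact: slice_coefZ.
exists (fun d => pihomog mdeg d (P d)); split => [d|z r0 r00 hball r M hr hM].
  exact: pihomogP.
have [|c [tc hc]] := @taylor_exists R (fun l => f (l *: z)) r0 r00.
  by move=> l /hball; exact: cdiff_slice.
(* By uniqueness the coefficients on the large disc are those found near 0, so one family F serves
   all z, r and M. *)
have cE : c = scoef z := is_taylor_unique tc (slice_coefP rho_gt0 hf z).
have [h1 h2] := hc r M hr hM; split => [N l lr|d]; last by rewrite hF -cE.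
have := h1 N l lr; congr (nc (_ - _) <= _).
by apply: eq_bigr => d _; rewrite hF {1}/scoef slice_coefZ -/scoef cE mulrC.
Qed.

End HomogeneousComponents.

(** * Expansion of homogeneous polynomials in the basis *)

Section BasisFamily.
Import -(notations) mpoly.
Context {R : realType} {m : nat}.
Hypothesis m_gt0 : (0 < m)%N.
Local Notation n := m.+1.
Local Notation C := R[i].
Local Notation homog d := (ishomog1 d mdeg).
Variables (a : nat -> nat) (Y : forall k, 'I_(a k) -> mpoly n C).
Hypothesis hY : forall k, orthonormal_harmonic_basis k (@Y k).

(** Positivity is read off from orthonormality. The polynomial 1 is harmonic, so the basis of degree
    0 is not empty; its elements are constants of norm 1, which is impossible if the sphere has
    volume 0. *)
Lemma vol_gt0 : 0 < vol R m.
Proof.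
rewrite lt0r vol_ge0 andbT; apply/eqP => v0.
have h1 : (1 : mpoly n C) \is homog 0%N by exact: dhomog1.
have l1 : lap (1 : mpoly n C) = 0 by apply: dhomog_lap0 h1.
have := basis_expansion (hY 0) h1 l1.
rewrite big1 => [/eqP|l _]; first by rewrite oner_eq0.
have := hY 0 => -[_ _ /(_ l l)]; rewrite eqxx sphere_dotE.
have hl := basis_homog (hY 0) l; have hc := dhomog_cpoly hl.
have hp : @Y 0 l * cpoly (@Y 0 l) \is homog 0%N by exact: (dhomogM hl hc).
have lp : lap (@Y 0 l * cpoly (@Y 0 l)) = 0 by apply: dhomog_lap0 hp.
have := IS_lpolyX m_gt0 (fun _ => 0) hp lp; rewrite expr0 mul1r /= v0 mul0r => ->.
by move=> /eqP; rewrite eq_sym oner_eq0.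
Qed.

Lemma IS_harmonic_orth k k' p q : k != k' -> p \is homog k -> lap p = 0 ->
  q \is homog k' -> lap q = 0 -> IS (p * q : mpoly n C) = 0.
Proof.
move=> kk hp lp hq lq; have [lt|le] := ltnP k k'.
  exact: (IS_harmonic_low m_gt0 lt hp hq lq).
rewrite mulrC; apply: (IS_harmonic_low m_gt0 _ hq hp lp).
by rewrite ltn_neqAle eq_sym kk.
Qed.

(** Pairing p with Y_(k, l) over the sphere sees only the layer d - 2 j = k: there q = 1, and
    harmonic polynomials of different degrees are orthogonal. *)
Lemma homogeneous_in_basis d p : p \is homog d ->
  p = \sum_(j < (d./2).+1) sqpoly ^+ j *
    \sum_(l < a (d - 2 * j)) IS (p * cpoly (@Y (d - 2 * j) l)) *: @Y (d - 2 * j) l /\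
  forall k l, (forall j, d != k + 2 * j)%N -> IS (p * cpoly (@Y k l)) = 0.
Proof.
move=> hp; have [h [hh pE]] := harmonic_decomposition (ltn0Sn m) hp.
have orth k l j : (2 * j <= d)%N -> (d - 2 * j)%N != k ->
    IS (h j * cpoly (@Y k l)) = 0.
  move=> jd jk; have [h1 h2] := hh j jd; apply: (IS_harmonic_orth jk h1 h2).
    exact/dhomog_cpoly/(basis_homog (hY k)).
  by rewrite lap_cpoly (basis_lap (hY k)) /cpoly raddf0.
have ISE k l : IS (p * cpoly (@Y k l)) =
    \sum_(j < (d./2).+1) IS (h j * cpoly (@Y k l)).
  rewrite {1}pE mulr_suml IS_sum; apply: eq_bigr => j _.
  by rewrite -mulrA IS_sqpolyX.
split.
  rewrite [LHS]pE; apply: eq_bigr => j _; congr (_ * _).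
  have jd : (2 * j <= d)%N by have := ltn_ord j; lia.
  have [h1 h2] := hh j jd; rewrite {1}(basis_expansion (hY _) h1 h2).
  apply: eq_bigr => l _.
  suff -> : IS (h j * cpoly (Y l)) = IS (p * cpoly (Y l)) by [].
  rewrite ISE [RHS](bigD1 j isT) [X in _ = _ + X]big1 => [|i ij]; first by rewrite addr0.
  apply: orth; first by have := ltn_ord i; lia.
  by apply: contraNneq ij => e; apply/eqP/val_inj => /=; have := ltn_ord i; lia.
move=> k l hk; rewrite ISE big1// => j _.
have jd : (2 * j <= d)%N by have := ltn_ord j; lia.
by apply: orth => //; have := hk j; lia.
Qed.

(** [basis_norm_bound] controls the square of the modulus by some x; as x <= (1 + x)^2, taking 1 + x
    avoids a square root and gives a bound that is at least 1. *)
Definition Ybound k : R := 1 + (2 * k).+1%:R * (2 * ((a k)%:R / vol R m)).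

Lemma Ybound_ge1 k : 1 <= Ybound k.
Proof. by rewrite lerDl !mulr_ge0// invr_ge0 ltW// vol_gt0. Qed.

Lemma basis_norm k l (z : 'rV[C]_n) r : 0 <= r -> lie_sq z <= r ^+ 2 ->
  nc (peval (@Y k l) z) <= Ybound k * r ^+ k.
Proof.
move=> r0 zr; have B1 := Ybound_ge1 k.
have b0 : 0 <= Ybound k * r ^+ k by rewrite mulr_ge0 ?exprn_ge0// (le_trans ler01).
rewrite -(@ler_pXn2r _ 2) ?nnegrE ?nc_ge0//.
apply: (le_trans (basis_norm_bound m_gt0 (hY k) vol_gt0 z l)).
rewrite exprMn -exprM [(k * 2)%N]mulnC exprM; apply: ler_pM.
- by rewrite !mulr_ge0// invr_ge0 ltW// vol_gt0.
- by rewrite exprn_ge0// lie_sq_ge0.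
- move: B1; rewrite /Ybound; move: (_ * (2 * _)) => x x1.
  by have := sqr_ge0 x; lra.
- by rewrite lerXn2r// nnegrE ?lie_sq_ge0// exprn_ge0.
Qed.

Lemma dim_bound k : (a k <= k.+1 ^ n)%N.
Proof.
apply: (@card_independent_dhomog _ _ _ _ (@Y k)) => [l|c hc].
  exact: basis_homog (hY k) l.
have [_ /(_ 0) h _] := hY k.
have h0 : harmonic_homogeneous k (0 : mpoly n C).
  by split; [exact: dhomog0|exact: lap0].
have [c0 [_ uc]] := h h0.
rewrite -(uc c); last by rewrite hc.
by apply: uc; rewrite big1// => l _; rewrite mxE scale0r.
Qed.

End BasisFamily.

(** * Power series *)

Section PowerSeries.
Context {R : realType}.
Local Notation C := R[i].
Implicit Types (u b : nat -> C) (K q s t : R).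

Lemma geometric_tail u K q : 0 <= q < 1 -> (forall j, nc (u j) <= K * q ^+ j) ->
  forall J n, nc (\sum_(j < J + n) u j - \sum_(j < J) u j) <= K * q ^+ J / (1 - q).
Proof.
move=> /andP[q0 q1] hu J n.
have K0 : 0 <= K by have := hu 0%N; rewrite expr0 mulr1; exact/le_trans/nc_ge0.
have q1' : 0 < 1 - q by rewrite subr_gt0.
apply: (@le_trans _ _ (K * q ^+ J * (1 - q ^+ n) / (1 - q))).
  elim: n => [|n IH]; first by rewrite addn0 subrr nc0 expr0 subrr mulr0 mul0r.
  rewrite addnS big_ord_recr /= addrAC (le_trans (ncD _ _))//.
  rewrite (le_trans (lerD IH (hu _)))// exprD exprS le_eqVlt; apply/orP; left; apply/eqP.
  by field; rewrite gt_eqF.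
rewrite ler_wpM2r ?invr_ge0 ?(ltW q1')// ler_piMr ?mulr_ge0 ?exprn_ge0//.
by rewrite gerBl exprn_ge0.
Qed.

Lemma real_geometric_cvg (v : nat -> R) K q : 0 <= q < 1 ->
  (forall j, `|v j| <= K * q ^+ j) -> exists L, forall e : R, 0 < e ->
  exists N, forall n, (N <= n)%N -> `|L - \sum_(j < n) v j| < e.
Proof.
move=> /andP[q0 q1] hv.
have : cvgn (series v).
  apply: normed_cvg; apply: (@series_le_cvg _ _ (geometric K q)) => [n|n|n|].
  - exact: normr_ge0.
  - exact: le_trans (hv n).
  - exact: hv.
  - by apply: is_cvg_geometric_series; rewrite ger0_norm.
move=> /cvg_ex[L /cvgrPdist_lt hL]; exists L => e e0.
have [N _ h] := hL e e0; exists N => n Nn.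
by have := h n Nn; rewrite /series /= big_mkord.
Qed.

(** The sum is chosen before K and q, so that its tail estimate holds for every geometric
    majorant. *)
Lemma csum_exists u :
  (exists K q, 0 <= q < 1 /\ forall j, nc (u j) <= K * q ^+ j) ->
  exists L, forall K q, 0 <= q < 1 -> (forall j, nc (u j) <= K * q ^+ j) ->
  forall J, nc (L - \sum_(j < J) u j) <= K * q ^+ J / (1 - q).
Proof.
move=> [K0 [q0 [hq0 hK0]]].
have [x hx] : exists L, forall e : R, 0 < e -> exists N, forall n, (N <= n)%N ->
    `|L - \sum_(j < n) Re (u j)| < e.
  by apply: (@real_geometric_cvg (fun j => Re (u j)) K0 q0 hq0) => j; apply: le_trans (hK0 j); exact: nc_Re.
have [y hy] : exists L, forall e : R, 0 < e -> exists N, forall n, (N <= n)%N ->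
    `|L - \sum_(j < n) Im (u j)| < e.
  by apply: (@real_geometric_cvg (fun j => Im (u j)) K0 q0 hq0) => j; apply: le_trans (hK0 j); exact: nc_Im.
exists (x +i* y)%C => K q hq hK J; apply/ler_addgt0Pr => e e0.
have [N1 h1] := hx _ (divr_gt0 e0 (ltr0Sn R 1)); have [N2 h2] := hy _ (divr_gt0 e0 (ltr0Sn R 1)).
set n := maxn N1 N2.
rewrite -(subrKA (\sum_(j < J + n) u j)) [leRHS]addrC.
apply: (le_trans (ncD _ _)); rewrite lerD//; last exact: geometric_tail.
apply: (le_trans (nc_le_ReIm _)).
rewrite Re_add Im_add Re_opp Im_opp.
have -> : Re (\sum_(j < J + n) u j) = \sum_(j < J + n) Re (u j).
  by apply: (big_morph _ Re_add).
have -> : Im (\sum_(j < J + n) u j) = \sum_(j < J + n) Im (u j).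
  by apply: (big_morph _ Im_add).
have /h1 H1 : (N1 <= J + n)%N by rewrite /n; lia.
have /h2 H2 : (N2 <= J + n)%N by rewrite /n; lia.
rewrite /=; move: H1 H2; set p := `|_|; set q' := `|_|; lra.
Qed.

(** Each factor k + 1 is absorbed by half of the decay: with h the square root of t, (k + 1) h^k is
    bounded and h^k is left for the induction. *)
Lemma polynomial_geometric D t : 0 <= t < 1 -> exists A q,
  [/\ 0 <= A, 0 <= q < 1 & forall k, k.+1%:R ^+ D * t ^+ k <= A * q ^+ k].
Proof.
elim: D t => [|D IH] t /andP[t0 t1].
  by exists 1, t; split=> [||k]; rewrite ?t0 ?expr0.
set h := Num.sqrt t.
have h0 : 0 <= h by exact: sqrtr_ge0.
have tE : t = h ^+ 2 by rewrite sqr_sqrtr.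
have h1 : h < 1 by rewrite -(@ltr_pXn2r _ 2) ?nnegrE// -tE expr1n.
have [|A [q [A0 q01 hA]]] := IH h; first by rewrite h0.
have lin k : k.+1%:R * h ^+ k <= (1 - h)^-1.
  have d0 : 0 < 1 - h by rewrite subr_gt0.
  rewrite -[leRHS]mul1r ler_pdivlMr//.
  (* The left-hand side is 1 at k = 0 and decreases from k to k + 1 by (k + 1) h^k (1 - h)^2. *)
  have step : k.+1%:R * h ^+ k * (1 - h) + h ^+ k.+1 <= 1.
    elim: k => [|k IHk]; first by rewrite expr0 expr1 !mul1r subrK.
    apply: le_trans IHk; have hk : 0 <= h ^+ k by exact: exprn_ge0.
    rewrite !exprS -[k.+2%:R]natr1; set x := k.+1%:R in hk *.
    have x0 : 0 <= x by rewrite /x ler0n.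
    rewrite -subr_ge0.
    have -> : x * h ^+ k * (1 - h) + h * h ^+ k -
      ((x + 1) * (h * h ^+ k) * (1 - h) + h * (h * h ^+ k)) =
      x * h ^+ k * (1 - h) ^+ 2 by ring.
    by rewrite mulr_ge0 ?sqr_ge0// mulr_ge0.
  by apply: le_trans step; rewrite lerDl exprn_ge0.
exists (A * (1 - h)^-1), q; split => // [|k].
  by rewrite mulr_ge0// invr_ge0 subr_ge0 ltW.
rewrite tE -exprM mulnC mulnS muln1 exprD exprSr.
have := ler_pM _ _ (hA k) (lin k).
rewrite !mulrA => H; rewrite [leRHS]mulrAC.
apply: le_trans (H _ _); rewrite ?mulr_ge0 ?exprn_ge0//.
apply: eqr_le; ring.
Qed.

(** The second-order remainder of the power function; the factor s^2 on the left avoids the exponent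
    k - 2 on the right. *)
Lemma expD_second_order (z h : C) s k : 0 < s -> nc z <= s -> nc (z + h) <= s ->
  s ^+ 2 * nc ((z + h) ^+ k - z ^+ k - k%:R * z ^+ k.-1 * h) <=
  k%:R ^+ 2 * s ^+ k * nc h ^+ 2.
Proof.
move=> s0 zs zhs; elim: k => [|k IH].
  by rewrite !expr0 subrr !mul0r subr0 nc0 mulr0 mulr0n expr0n /= mul0r mul0r.
have -> : (z + h) ^+ k.+1 - z ^+ k.+1 - k.+1%:R * z ^+ k.+1.-1 * h =
    (z + h) * ((z + h) ^+ k - z ^+ k - k%:R * z ^+ k.-1 * h) +
    k%:R * z ^+ k.-1 * h ^+ 2.
  case: k {IH} => [|k] /=; first by rewrite !expr0 !expr1; ring.
  by rewrite !exprS -!natr1; ring.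
apply: (@le_trans _ _ (s * (s ^+ 2 *
    nc ((z + h) ^+ k - z ^+ k - k%:R * z ^+ k.-1 * h)) +
    k%:R * s ^+ k.+1 * nc h ^+ 2)).
  have -> (x y w : R) : s * (s ^+ 2 * x) + w * s ^+ k.+1 * y =
    s ^+ 2 * (s * x) + w * s ^+ k.+1 * y by ring.
  apply: (le_trans (ler_wpM2l (sqr_ge0 s) (ncD _ _))).
  rewrite mulrDr lerD//.
    by rewrite ler_wpM2l ?sqr_ge0// ncM ler_wpM2r ?nc_ge0.
  rewrite !ncM ncX nc_nat; case: k {IH} => [|k] /=; first by rewrite !mul0r mulr0.
  have : nc z ^+ k <= s ^+ k by rewrite lerXn2r// nnegrE ?nc_ge0 ?ltW.
  rewrite [s ^+ k.+2]exprS [s ^+ k.+1]exprS.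
  set x := nc z ^+ k; set y := s ^+ k; set w := nc h => xy.
  rewrite -subr_ge0.
  have -> : k.+1%:R * (s * (s * y)) * w ^+ 2 - s ^+ 2 * (k.+1%:R * x * w ^+ 2) =
    k.+1%:R * w ^+ 2 * s ^+ 2 * (y - x) by ring.
  apply: mulr_ge0; last by rewrite subr_ge0.
  by apply: mulr_ge0 (sqr_ge0 _); apply: mulr_ge0 (sqr_ge0 _).
have := ler_wpM2l (ltW s0) IH => IH'.
apply: (le_trans (lerD IH' (lexx _))).
rewrite -[k.+1%:R]natr1 [s ^+ k.+1]exprS -subr_ge0.
have -> : (k%:R + 1) ^+ 2 * (s * s ^+ k) * nc h ^+ 2 -
  (s * (k%:R ^+ 2 * s ^+ k * nc h ^+ 2) + k%:R * (s * s ^+ k) * nc h ^+ 2) =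
  (k%:R + 1) * (s * s ^+ k) * nc h ^+ 2 :> R by ring.
apply: mulr_ge0 (sqr_ge0 _); apply: mulr_ge0; first by rewrite addr_ge0.
by rewrite mulr_ge0 ?exprn_ge0 ?(ltW s0).
Qed.

Definition subgeometric S b := forall s, 0 < s < S -> exists K, forall j, nc (b j) <= K / s ^+ j.

Lemma subgeometric_term b (z : C) s0 s K : nc z <= s0 -> 0 < s ->
  (forall j, nc (b j) <= K / s ^+ j) ->
  forall j, nc (b j * z ^+ j) <= K * (s0 / s) ^+ j.
Proof.
move=> zs s_gt0 hb j; rewrite ncM ncX expr_div_n.
apply: (le_trans (ler_pM (nc_ge0 _) _ (hb j) (lerXn2r j _ _ zs))).
- by rewrite exprn_ge0 ?nc_ge0.
- by rewrite nnegrE nc_ge0.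
- by rewrite nnegrE (le_trans (nc_ge0 z)).
- by rewrite -mulrA [_^-1 * _]mulrC.
Qed.

Lemma ratio_lt1 s0 s : 0 <= s0 -> s0 < s -> 0 <= s0 / s < 1.
Proof.
move=> s00 ss; have s_gt0 : 0 < s by exact: le_lt_trans ss.
by rewrite divr_ge0 ?(ltW s_gt0)//= ltr_pdivrMr// mul1r.
Qed.

(** P is the sum of the power series, recorded through explicit tail bounds: these are what the
    estimates of the double series consume. *)
Definition sums_on S b (P : C -> C) := forall z s0 s K,
  nc z <= s0 -> s0 < s -> s < S -> (forall j, nc (b j) <= K / s ^+ j) ->
  forall J, nc (P z - \sum_(j < J) b j * z ^+ j) <= K * (s0 / s) ^+ J / (1 - s0 / s).

Lemma power_series_exists S b : subgeometric S b -> exists P, sums_on S b P.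
Proof.
move=> hb; suff /choice[P hP] : forall z : C, exists y : C, forall s0 s K,
    nc z <= s0 -> s0 < s -> s < S -> (forall j, nc (b j) <= K / s ^+ j) ->
    forall J, nc (y - \sum_(j < J) b j * z ^+ j) <= K * (s0 / s) ^+ J / (1 - s0 / s).
  by exists P.
move=> z; have z0 := nc_ge0 z.
have [zS|zS] := ltP (nc z) S; last first.
  by exists 0 => s0 s K h1 h2 h3; lra.
have [s1 [zs1 s1S]] : exists s, nc z < s /\ s < S.
  by exists ((nc z + S) / 2); lra.
have s1p : 0 < s1 by exact: le_lt_trans zs1.
have [|K hK] := hb s1; first by rewrite s1p.
have [|L hL] := @csum_exists (fun j => b j * z ^+ j).
  exists K, (nc z / s1); split; first exact: ratio_lt1.
  exact: (subgeometric_term (lexx _)).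
exists L => s0 s K' zs ss sS hK'.
have s00 := le_trans z0 zs.
apply: hL; first exact: ratio_lt1.
by apply: subgeometric_term => //; exact: le_lt_trans ss.
Qed.

Lemma le_add_geometric x y A q : 0 <= q < 1 ->
  (forall J : nat, x <= y + A * q ^+ J) -> x <= y.
Proof.
move=> q01 h; rewrite leNgt; apply/negP => yx.
have : x - y = 0 by apply: (le_geom_eq0 q01) => [|J]; [rewrite subr_ge0 ltW|rewrite lerBlDl].
by lra.
Qed.

(** The derivative D is the sum of the differentiated series. Partial sums satisfy a bound B |x -
    z|^2 by [expD_second_order], the factors j^2 being absorbed in a larger ratio; the tails then
    disappear as J grows. *)
Lemma power_series_cdiff S b P : subgeometric S b -> sums_on S b P ->
  forall z, nc z < S -> cdiff P z.
Proof.
move=> hb hP z zS; have z0 := nc_ge0 z.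
have [s0 [s [zs0 ss sS]]] : exists s0 s, [/\ nc z < s0, s0 < s & s < S].
  by exists ((2 * nc z + S) / 3), ((nc z + 2 * S) / 3); split; lra.
have s0p : 0 < s0 by exact: le_lt_trans zs0.
have sp : 0 < s by exact: lt_trans ss.
have [|K hK] := hb s; first by rewrite sp.
have K0 : 0 <= K by have := hK 0%N; rewrite expr0 divr1; exact/le_trans/nc_ge0.
have q01 := ratio_lt1 (ltW s0p) ss; set q := s0 / s in q01.
have /andP[q0 q1] := q01.
have [A [q' [A0 q'01 hA]]] := polynomial_geometric 2 q01.
have /andP[q'0 q'1] := q'01.
have hj j : nc (b j) * (j%:R ^+ 2 * s0 ^+ j) <= K * A * q' ^+ j.
  apply: (@le_trans _ _ (K * (j.+1%:R ^+ 2 * q ^+ j))); last first.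
    by rewrite -mulrA ler_wpM2l.
  apply: (@le_trans _ _ (K / s ^+ j * (j%:R ^+ 2 * s0 ^+ j))).
    by rewrite ler_wpM2r// mulr_ge0 ?sqr_ge0// exprn_ge0// ltW.
  rewrite -mulrA ler_wpM2l// mulrCA [_^-1 * _]mulrC -expr_div_n ler_wpM2r ?exprn_ge0//.
  by rewrite lerXn2r ?nnegrE// ler_nat.
have hd j : nc (j%:R * b j * z ^+ j.-1) <= (K * A / s0) * q' ^+ j.
  have -> : (K * A / s0) * q' ^+ j = s0^-1 * (K * A * q' ^+ j) by ring.
  rewrite ler_pdivlMl//; apply: le_trans (hj j).
  rewrite !ncM nc_nat ncX.
  have -> : s0 * (j%:R * nc (b j) * nc z ^+ j.-1) =
    nc (b j) * (j%:R * (s0 * nc z ^+ j.-1)) by ring.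
  rewrite ler_wpM2l ?nc_ge0//; case: j => [|j] /=; first by rewrite mulr0n mul0r mulr_ge0 ?sqr_ge0.
  apply: (@le_trans _ _ (j.+1%:R * s0 ^+ j.+1)).
    rewrite ler_wpM2l// exprS ler_wpM2l ?(ltW s0p)//.
    by apply: lerXn2r; rewrite ?nnegrE ?(ltW s0p) ?(ltW zs0).
  rewrite ler_wpM2r ?exprn_ge0 ?(ltW s0p)// expr2.
  by rewrite ler_peMl// ler1n.
have [|D hD] := @csum_exists (fun j => j%:R * b j * z ^+ j.-1).
  by exists (K * A / s0), q'.
pose B := (K * A / s0 ^+ 2) / (1 - q').
have B0 : 0 <= B.
  by rewrite !mulr_ge0// invr_ge0 ?sqr_ge0// subr_ge0 ltW.
have main x : nc (x - z) < s0 - nc z ->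
    nc (P x - P z - D * (x - z)) <= B * nc (x - z) ^+ 2.
  move=> xz; set h := x - z in xz *.
  have xE : x = z + h by rewrite /h addrC subrK.
  have xs : nc (z + h) <= s0 by apply: (le_trans (ncD _ _)); lra.
  apply: (le_add_geometric (A := (2 * (K * A / (1 - q)) + (K * A / s0) / (1 - q') * nc h)) q'01) => J.
  have qA : q ^+ J <= A * q' ^+ J.
    apply: le_trans (hA J); rewrite ler_peMl ?exprn_ge0//.
    by rewrite exprn_ege1// ler1n.
  have tail w : nc w <= s0 -> nc (P w - \sum_(j < J) b j * w ^+ j) <=
      K * A / (1 - q) * q' ^+ J.
    move=> ws; apply: (le_trans (hP w s0 s K ws ss sS hK J)); rewrite -/q.
    have -> : K * A / (1 - q) * q' ^+ J = K * (A * q' ^+ J) / (1 - q) by ring.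
    by rewrite ler_wpM2r ?invr_ge0 ?subr_ge0 ?(ltW q1)// ler_wpM2l.
  have t1 := tail _ xs; have t2 := tail _ (ltW zs0).
  have t3 := hD _ _ q'01 hd J.
  set S1 := \sum_(j < J) _ in t1; set S2 := \sum_(j < J) _ in t2.
  set S3 := \sum_(j < J) _ in t3.
  have t4 : nc (S1 - S2 - S3 * h) <= B * nc h ^+ 2.
    rewrite /S1 /S2 /S3 mulr_suml -!sumrB.
    apply: (le_trans (nc_sum _ _ _)).
    apply: (@le_trans _ _ (\sum_(j < J) (K * A / s0 ^+ 2 * nc h ^+ 2) * q' ^+ j)).
      apply: ler_sum => j _.
      have -> : b j * (z + h) ^+ j - b j * z ^+ j - j%:R * b j * z ^+ j.-1 * h =
        b j * ((z + h) ^+ j - z ^+ j - j%:R * z ^+ j.-1 * h) by ring.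
      have := expD_second_order j s0p (ltW zs0) xs => e2.
      have e3 := ler_wpM2l (nc_ge0 (b j)) e2.
      rewrite ncM -(ler_pM2l (exprn_gt0 2 s0p)) mulrCA.
      apply: (le_trans e3).
      have -> : s0 ^+ 2 * (K * A / s0 ^+ 2 * nc h ^+ 2 * q' ^+ j) =
        K * A * q' ^+ j * nc h ^+ 2 by field; rewrite gt_eqF.
      by rewrite mulrA ler_wpM2r ?sqr_ge0.
    rewrite -mulr_sumr.
    have -> : B * nc h ^+ 2 = K * A / s0 ^+ 2 * nc h ^+ 2 * (1 - q')^-1.
      by rewrite /B; ring.
    rewrite ler_wpM2l//.
      by apply: mulr_ge0 (sqr_ge0 _); apply: divr_ge0 (sqr_ge0 _); rewrite mulr_ge0.
    rewrite -[leRHS]mul1r ler_pdivlMr ?subr_gt0// mulrC.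
    have -> : (1 - q') * (\sum_(j < J) q' ^+ j) = 1 - q' ^+ J.
      by rewrite -[in RHS]opprB subrX1; ring.
    by rewrite gerBl exprn_ge0.
  rewrite {1}xE.
  have -> : P (z + h) - P z - D * h = (P (z + h) - S1) - (P z - S2) - (D - S3) * h +
    (S1 - S2 - S3 * h) by ring.
  rewrite addrC (le_trans (ncD _ _))// lerD//.
  apply: (le_trans (ncB _ _)); apply: (le_trans (lerD (ncB _ _) (lexx _))).
  rewrite ncM; have := ler_wpM2r (nc_ge0 h) t3.
  move: t1 t2; set a1 := nc _; set a2 := nc _; set a3 := nc _ * _; lra.
exists D => e e0; exists (Num.min (s0 - nc z) (e / (B + 1))) => [|x].
  by rewrite lt_min subr_gt0 zs0 divr_gt0// ltr_wpDl.
rewrite lt_min => /andP[x1]; rewrite ltr_pdivlMr ?ltr_wpDl// => x2.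
apply: (le_trans (main x x1)); rewrite expr2 mulrA ler_wpM2r ?nc_ge0//.
by apply: le_trans (ltW x2); rewrite mulrC ler_wpM2l ?nc_ge0// lerDl.
Qed.

(** Polar coordinates over a compact interval of angles, where the extreme value theorem for real
    functions bounds phi on a circle. *)
Lemma circ_surj (z : C) : exists2 t : R, - pi <= t <= pi & z = circ (nc z) t.
Proof.
have [->|zn] := eqVneq z 0.
  by exists 0; [rewrite oppr_le0 pi_ge0|rewrite nc0 /circ mul0r].
have r0 : 0 < nc z by rewrite nc_gt0.
set r := nc z in r0 *.
have r2 : Re z ^+ 2 + Im z ^+ 2 = r ^+ 2.
  by rewrite /r; case: (z) => x y /=; rewrite sqr_sqrtr// addr_ge0 ?sqr_ge0.
have h1 : -1 <= Re z / r <= 1.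
  rewrite ler_pdivlMr// ler_pdivrMr// mul1r mulN1r -ler_norml.
  exact: nc_Re.
have c := acosK h1; have s := sin_acos h1.
have sE : Num.sqrt (1 - (Re z / r) ^+ 2) = `|Im z| / r.
  have -> : 1 - (Re z / r) ^+ 2 = (Im z / r) ^+ 2.
    by rewrite !expr_div_n -[1](@divff _ (r ^+ 2)) ?gt_eqF ?exprn_gt0// -mulrBl -r2 [_ + Im z ^+ 2]addrC addrK.
  by rewrite sqrtr_sqr normrM normrV ?unitfE ?gt_eqF// [`|r|]gtr0_norm.
have ap := acos_lepi h1; have a0 := acos_ge0 h1.
have [y0|y0] := leP 0 (Im z).
  exists (acos (Re z / r)); first by rewrite ap (le_trans _ a0)// oppr_le0 pi_ge0.
  rewrite /circ; apply: complex_ext.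
    by rewrite Re_mul /= mul0r subr0 c mulrC divfK ?gt_eqF.
  by rewrite Im_mul /= mul0r addr0 s sE ger0_norm// mulrC divfK ?gt_eqF.
exists (- acos (Re z / r)); first by rewrite lerN2 ap (le_trans _ (pi_ge0 R))// oppr_le0.
rewrite /circ; apply: complex_ext.
  by rewrite Re_mul /= mul0r subr0 cosN c mulrC divfK ?gt_eqF.
by rewrite Im_mul /= mul0r addr0 sinN s sE ltr0_norm// mulNr opprK mulrC divfK ?gt_eqF.
Qed.

Lemma circle_bound (phi : C -> C) r : 0 < r -> (forall z, nc z = r -> cdiff phi z) ->
  exists M, forall z, nc z = r -> nc (phi z) <= M.
Proof.
move=> r0 dphi.
have [cR cI] : ccts (fun t => phi (circ r t)).
  apply: ccts_comp => [|x]; first exact: ccts_circ.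
  by apply: dphi; rewrite (nc_circ x (ltW r0)).
have cn (u : R -> R) : continuous u -> continuous (fun t => `|u t|).
  by move=> cu t; apply: (continuous_comp (cu t)); exact: norm_continuous.
have pp : - pi <= pi :> R by rewrite (le_trans _ (pi_ge0 R))// oppr_le0 pi_ge0.
have [c1 _ h1] := EVT_max pp (continuous_subspaceT (cn _ cR)).
have [c2 _ h2] := EVT_max pp (continuous_subspaceT (cn _ cI)).
exists (`|Re (phi (circ r c1))| + `|Im (phi (circ r c2))|) => z zr.
have [t tp ->] := circ_surj z; rewrite zr.
by rewrite (le_trans (nc_le_ReIm _))// lerD ?h1 ?h2// in_itv.
Qed.

(** Q - P vanishes at small positive reals, so its Taylor coefficients at 0 vanish; the remainder
    estimate on a circle around z then gives Q = P at z. *)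
Lemma power_series_unique S b P Q : 0 < S -> subgeometric S b -> sums_on S b P ->
  (forall z, nc z < S -> cdiff Q z) ->
  (forall t : R, 0 < t < S -> Q t%:C = P t%:C) ->
  forall z, nc z < S -> Q z = P z.
Proof.
move=> S0 hb hP dQ QP z zS.
have dP := power_series_cdiff hb hP.
have dH w : nc w < S -> cdiff (fun w => Q w - P w) w.
  by move=> ws; apply: cdiffB; [exact: dQ|exact: dP].
have [c [tc hc]] := taylor_exists S0 dH.
have c0 j : c j = 0.
  apply: (@small_poly_eq0 _ j.+1 c _ j (ltnSn j)).
  have [A [d [A0 d0 hA]]] := tc j.+1.
  exists A, (Num.min d S); split; first by rewrite lt_min d0.
  move=> t /andP[t0]; rewrite lt_min => /andP[td tS].
  have := hA t%:C; rewrite nc_real gtr0_norm// => /(_ td).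
  by rewrite QP ?t0// subrr sub0r ncN.
have z0 := nc_ge0 z.
have [r [zr rS]] : exists r, nc z < r /\ r < S by exists ((nc z + S) / 2); lra.
have r0 : 0 < r by exact: le_lt_trans zr.
have [|M hM] := @circle_bound (fun w => Q w - P w) r r0.
  by move=> w wr; apply: dH; rewrite wr.
have [|h _] := hc r M _ hM; first by rewrite r0.
apply/eqP; rewrite -subr_eq0 -nc_eq0; apply/eqP.
apply: (@le_geom_eq0 _ _ (2 * M * (r / (r - nc z))) (nc z / r) (ratio_lt1 z0 zr)).
  exact: nc_ge0.
move=> N; have := h N z zr; rewrite big1 => [|j _]; last by rewrite c0 mul0r.
by rewrite subr0 mulrAC.
Qed.

End PowerSeries.

(** * Compact subsets of the Lie ball *)

Section LieBallCompactness.
Context {R : realType} {m : nat}.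
Local Notation n := m.+1.
Local Notation C := R[i].

Lemma continuous_nc : continuous (fun z : C => nc z : R).
Proof.
move=> z; apply/(@cvgrPdist_lt _ _ _ _ (@nbhs_filter C z)) => e e0.
apply/nbhs_ballP; exists e%:C => /=; first by rewrite ltcR.
move=> w; rewrite /ball /= normr_nc ltcR => /(le_lt_trans _); apply.
have := ncD (w - z) z; have := ncD (z - w) w; rewrite !subrK [nc (w - z)]ncBC => h1 h2.
by rewrite ler_norml; lra.
Qed.

Lemma continuous_sum_at (T : topologicalType) (K : numFieldType) (I : Type) (s : seq I)
    (F : I -> T -> K) x :
  (forall i, {for x, continuous (F i)}) -> {for x, continuous (fun y => \sum_(i <- s) F i y)}.
Proof.
move=> cF; elim: s => [|i s IH].
  have -> : (fun y => \sum_(i <- [::]) F i y) = cst 0 by apply/funext => y; rewrite big_nil.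
  exact: cst_continuous.
have -> : (fun y => \sum_(j <- i :: s) F j y) = F i \+ (fun y => \sum_(j <- s) F j y).
  by apply/funext => y; rewrite big_cons.
exact: continuousD (cF i) IH.
Qed.

Lemma continuous_lie_sq : continuous (fun z : 'rV[C]_n => lie_sq z).
Proof.
have cs : continuous (fun z : 'rV[C]_n => sqnorm z).
  move=> z; apply: continuous_sum_at => i.
  apply: (@continuous_comp _ _ _ (fun z : 'rV[C]_n => nc (z 0 i)) (fun t => t ^+ 2)).
    by apply: continuous_comp; [exact: coord_continuous|exact: continuous_nc].
  exact: exprn_continuous.
have cq : continuous (fun z : 'rV[C]_n => nc (quad z)).
  move=> z; apply: continuous_comp; last exact: continuous_nc.
  apply: continuous_sum_at => i.
  have c1 : {for z, continuous (fun z : 'rV[C]_n => z 0 i)} by exact: coord_continuous.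
  exact: (continuousM c1 c1).
have cX (u : 'rV[C]_n -> R) : continuous u -> continuous (fun z => u z ^+ 2).
  by move=> cu z; apply: (@continuous_comp _ _ _ u (fun t => t ^+ 2)); [exact: cu|exact: exprn_continuous].
move=> z; apply: continuousD; first exact: cs.
apply: continuous_comp; last exact: sqrt_continuous.
by apply: continuousB; [exact: cX|exact: cX].
Qed.

Lemma compact_disc (s : R) : compact [set z : C | nc z <= s].
Proof.
pose J := [set` `[- s, s]].
have cJ : compact (J `*` J) by apply: compact_setX; exact: segment_compact.
pose g (p : R * R) : C := (p.1 +i* p.2)%C.
have cg : continuous g.
  move=> [x y]; apply/(@cvgrPdist_lt _ _ _ _ (@nbhs_filter (R * R)%type (x, y))) => e e0; have [-> re0] := lt0C_Re e0.
  set r := Re e in re0 *; have r2 : 0 < r / 2 by rewrite divr_gt0.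
  apply/nbhs_ballP; exists (r / 2) => //= -[x' y'] [/= h1 h2].
  rewrite normr_nc ltcR; apply: (le_lt_trans (nc_le_ReIm _)) => /=.
  move: h1 h2; rewrite /ball /= => h1 h2; lra.
apply: (subclosed_compact _ (continuous_compact (continuous_subspaceT cg) cJ)).
  have -> : [set z : C | nc z <= s] = (fun z => nc z) @^-1` [set t : R | t <= s] by [].
  by apply: preimage_closed => [z _|]; [exact: continuous_nc|exact: closed_le].
move=> z /= zs; exists (Re z, Im z); last by rewrite /g; case: (z).
by split; rewrite /J /= in_itv /= -ler_norml (le_trans _ zs)// ?nc_Re ?nc_Im.
Qed.

Lemma compact_lie_ball (s : R) : 0 <= s -> compact [set z : 'rV[C]_n | lie_sq z <= s ^+ 2].
Proof.
move=> s0; have cP := @rV_compact _ n (fun _ => [set z : C | nc z <= s]) (fun _ => @compact_disc s).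
apply: (subclosed_compact _ cP).
  have -> : [set z : 'rV[C]_n | lie_sq z <= s ^+ 2] =
      (fun z => lie_sq z) @^-1` [set t : R | t <= s ^+ 2] by [].
  by apply: preimage_closed => [z _|]; [exact: continuous_lie_sq|exact: closed_le].
move=> z /= zs i; rewrite -(@ler_pXn2r _ 2) ?nnegrE ?nc_ge0//.
apply: le_trans zs; apply: (le_trans _ (sqnorm_le_lie z)).
by rewrite /sqnorm (bigD1 i)//= lerDl sumr_ge0// => j _; exact: sqr_ge0.
Qed.

Lemma holomorphic_bounded (rho s : R) (f : 'rV[C]_n -> C) :
  holomorphic_on (@lie_ball R n rho) f -> 0 <= s < rho ->
  exists M, 0 <= M /\ forall z, lie_sq z <= s ^+ 2 -> nc (f z) <= M.
Proof.
move=> hf /andP[s0 sr].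
have sub z : lie_sq z <= s ^+ 2 -> lie_ball rho z.
  move=> zs; apply/lie_ballE; apply: (le_lt_trans zs).
  by rewrite ltrXn2r// nnegrE// (le_trans s0)// ltW.
have [||c _ hc] := compact_EVT_max _ (@compact_lie_ball s s0) (f := fun z => nc (f z)).
- by exists 0 => /=; rewrite -[0](scale0r 0) lie_sqZ nc0 expr0n mul0r sqr_ge0.
- apply: continuous_in_subspaceT => z; rewrite inE /= => zs.
  apply: continuous_comp; last exact: continuous_nc.
  exact/differentiable_continuous/hf/sub.
exists (nc (f c)); split; first exact: nc_ge0.
by move=> z zs; apply: hc; rewrite inE.
Qed.

Lemma compact_in_lie_ball (rho : R) (K : set 'rV[C]_n) : 0 < rho -> compact K ->
  K `<=` lie_ball rho -> exists2 r, 0 < r < rho & forall z, K z -> lie_sq z <= r ^+ 2.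
Proof.
move=> rho0 cK sK; have [K0|K0] := pselect (K !=set0); last first.
  exists (rho / 2) => [|z Kz]; last by case: K0; exists z.
  by rewrite divr_gt0//=; lra.
have [c] := compact_EVT_max K0 cK (continuous_subspaceT continuous_lie_sq).
rewrite inE => /sK /lie_ballE c1 hc.
(* The maximum with rho / 2 keeps r positive when K is contained in {0}. *)
exists (Num.max (rho / 2) (Num.sqrt (lie_sq c))) => [|z Kz].
  rewrite lt_max divr_gt0//= gt_max; apply/andP; split; first lra.
  by rewrite -(@ltr_pXn2r _ 2) ?nnegrE ?sqrtr_ge0 ?(ltW rho0)// sqr_sqrtr ?lie_sq_ge0.
apply: (@le_trans _ _ (lie_sq c)); first by apply: hc; rewrite inE.
rewrite -[leLHS]sqr_sqrtr ?lie_sq_ge0// lerXn2r ?nnegrE ?sqrtr_ge0//.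
  by rewrite le_max sqrtr_ge0 orbT.
by rewrite le_max lexx orbT.
Qed.

End LieBallCompactness.

(** * The Laplace-Fourier series *)

Section Expansion.
Import -(notations) mpoly.
Context {R : realType} {m : nat}.
Local Notation n := m.+1.
Local Notation C := R[i].
Local Notation homog d := (ishomog1 d mdeg).

Lemma uniform_cvg_eps (T : choiceType) (K : set T) (S : nat -> T -> C) (f : T -> C) :
  (forall e : R, 0 < e -> exists N : nat, forall k, (N <= k)%N ->
     forall z, K z -> nc (f z - S k z) < e) ->
  {uniform K, S @ \oo --> f}.
Proof.
move=> h P /uniform_nbhs[E [+ sub]].
rewrite -entourage_ballE => -[e e0 hE].
have [eE re0] := lt0C_Re e0.
have [N hN] := h _ re0.
exists N => // k /= Nk; apply: sub => z Kz /=; apply: hE => /=.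
by rewrite /ball /= normr_nc eE ltcR; exact: hN.
Qed.

Lemma ltr_sqr_pos (x y : R) : 0 <= x -> x < y -> x ^+ 2 < y ^+ 2.
Proof. by move=> x0 xy; rewrite ltr_pXn2r// nnegrE// (le_trans x0)// ltW. Qed.

Lemma lie_sq_real (x : 'rV[R]_n) : on_sphere x -> lie_sq (real_point x) = 1.
Proof.
move=> hx; rewrite /lie_sq sqnorm_real// quad_real// nc1 subrr sqrtr0 addr0.
by [].
Qed.

Lemma real_pointZ (r : R) (x : 'rV[R]_n) : real_point (r *: x) = r%:C *: real_point x.
Proof. by apply/rowP => i; rewrite !mxE rcM. Qed.

Lemma pevalM (p q : mpoly n C) z : peval (p * q) z = peval p z * peval q z.
Proof. exact: mevalM. Qed.

Lemma pevalZ c (p : mpoly n C) z : peval (c *: p) z = c * peval p z.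
Proof. exact: mevalZ. Qed.

Lemma peval_sum (I : Type) (s : seq I) (F : I -> mpoly n C) z :
  peval (\sum_(i <- s) F i) z = \sum_(i <- s) peval (F i) z.
Proof. by rewrite /peval raddf_sum. Qed.

Lemma peval_sqpoly (z : 'rV[C]_n) : peval sqpoly z = quad z.
Proof.
rewrite /sqpoly peval_sum; apply: eq_bigr => i _.
by rewrite /peval rmorphXn /= mevalXU.
Qed.

Lemma peval_sqpolyX j (z : 'rV[C]_n) : peval (sqpoly ^+ j) z = quad z ^+ j.
Proof. by rewrite -peval_sqpoly /peval rmorphXn. Qed.

Lemma sum_parity (V : nmodType) (H : nat -> V) N :
  \sum_(k < N.+1 | ~~ odd (N - k)) H k = \sum_(j < (N./2).+1) H (N - 2 * j)%N.
Proof.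
elim/ltn_ind: N H => -[_|[_|N IH]] H.
- by rewrite big_mkcond !big_ord1.
- by rewrite big_mkcond !big_ord_recr !big_ord0 /= addr0 add0r.
rewrite big_mkcond 2!big_ord_recr /= subnn subSnn /= addr0 addrC.
rewrite [RHS]big_ord_recl muln0 subn0; congr (_ + _).
rewrite -big_mkcond.
have -> : \sum_(i < N.+1 | ~~ odd (N.+2 - i)) H i = \sum_(i < N.+1 | ~~ odd (N - i)) H i.
  by apply: eq_bigl => i; rewrite !subSn ?negbK//; have := ltn_ord i; lia.
rewrite IH//; apply: eq_bigr => j _; congr (H _); rewrite /= /bump /=; lia.
Qed.

(** Both sides run over the pairs with k + 2 j < N, on the right grouped by d = k + 2 j. From N to N
    + 1 the new pairs are those with k + 2 j = N, one for each k such that N - k is even. *)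
Lemma sum_by_degree (V : zmodType) (H : nat -> nat -> V) N :
  \sum_(k < N) \sum_(j < uphalf (N - k)) H k j =
  \sum_(d < N) \sum_(j < (d./2).+1) H (d - 2 * j)%N j.
Proof.
elim: N => [|N IH]; first by rewrite !big_ord0.
have stepE (g : nat -> V) d : \sum_(j < uphalf d.+1) g j =
    \sum_(j < uphalf d) g j + (if ~~ odd d then g d./2 else 0).
  rewrite uphalfE; have [od|ed] /= := boolP (odd d).
    by rewrite addr0 uphalf_half od.
  by rewrite uphalf_half (negbTE ed) add0n big_ord_recr.
have -> : \sum_(k < N.+1) \sum_(j < uphalf (N.+1 - k)) H k j =
    \sum_(k < N.+1) (\sum_(j < uphalf (N - k)) H k j +
      (if ~~ odd (N - k) then H k (N - k)./2 else 0)).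
  by apply: eq_bigr => k _; rewrite subSn -1?ltnS// stepE.
rewrite big_split /= big_ord_recr /= subnn big_ord0 addr0 IH -big_mkcond.
rewrite (sum_parity (fun k => H k (N - k)./2)) [RHS]big_ord_recr; congr (_ + _).
apply: eq_bigr => j _; rewrite subKn; last by have := ltn_ord j; lia.
by rewrite mul2n doubleK.
Qed.

Lemma leq_add_uphalf_sub k N : (k <= N)%N -> (N <= k + 2 * uphalf (N - k))%N.
Proof.
move=> kN; rewrite -leq_subLR uphalf_half mulnDr [(2 * _./2)%N]mul2n.
rewrite -{1}[(N - k)%N]odd_double_half leq_add2r.
by case: odd.
Qed.

Variables (rho : R) (a : nat -> nat) (Y : forall k, 'I_(a k) -> mpoly n C).
Variables (f : 'rV[C]_n -> C) (F : nat -> mpoly n C).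
Hypotheses (m_gt0 : (0 < m)%N) (rho_gt0 : 0 < rho).
Hypothesis hY : forall k, orthonormal_harmonic_basis k (@Y k).
Hypothesis hf : holomorphic_on (@lie_ball R n rho) f.
Hypothesis hF : forall d, F d \is homog d.
Hypothesis F_expansion : forall z (r0 : R), 0 < r0 ->
  (forall l, nc l < r0 -> lie_ball rho (l *: z)) ->
  forall r M, 0 < r < r0 -> (forall l, nc l = r -> nc (f (l *: z)) <= M) ->
  (forall N l, nc l < r -> nc (f (l *: z) - \sum_(d < N) peval (F d) (l *: z)) <=
     2 * M * (nc l / r) ^+ N * (r / (r - nc l))) /\
  (forall d, nc (peval (F d) z) <= 2 * M / r ^+ d).

Lemma lie_ball_scale (z : 'rV[C]_n) (r : R) l : 0 < r -> lie_sq z <= r ^+ 2 ->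
  nc l < rho / r -> lie_ball rho (l *: z).
Proof.
move=> r0 zr lr; apply/lie_ballE; rewrite lie_sqZ.
apply: (@le_lt_trans _ _ (nc l ^+ 2 * r ^+ 2)); first by rewrite ler_wpM2l ?sqr_ge0.
rewrite -exprMn ltrXn2r ?nnegrE ?mulr_ge0 ?nc_ge0 ?(ltW r0) ?(ltW rho_gt0)//.
by rewrite -ltr_pdivlMr.
Qed.

Local Notation Yb k := (@Ybound R m a k).

Section Bounds.
Variables (s M : R).
Hypotheses (s_gt0 : 0 < s) (s_rho : s < rho).
Hypothesis hM : forall z, lie_sq z <= s ^+ 2 -> nc (f z) <= M.

Lemma M_ge0 : 0 <= M.
Proof.
apply: (le_trans (nc_ge0 (f 0))); apply: hM.
by rewrite -[0](scale0r 0) lie_sqZ nc0 expr0n mul0r sqr_ge0.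
Qed.

(** The expansion along the line through z at l = 1, with the circle |l| = s / r, on which L(l z) <=
    s. *)
Lemma expansion_error (z : 'rV[C]_n) r N : 0 < r < s -> lie_sq z <= r ^+ 2 ->
  nc (f z - \sum_(d < N) peval (F d) z) <= 2 * M * (r / s) ^+ N * (s / (s - r)).
Proof.
move=> /andP[r0 rs] zr.
have rn : r != 0 by rewrite gt_eqF.
have h1 : 0 < rho / r by rewrite divr_gt0.
have h2 l : nc l < rho / r -> lie_ball rho (l *: z) by exact: lie_ball_scale.
have h3 : 0 < s / r < rho / r by rewrite divr_gt0//= ltr_pM2r ?invr_gt0.
have h4 l : nc l = s / r -> nc (f (l *: z)) <= M.
  move=> hl; apply: hM; rewrite lie_sqZ hl expr_div_n -mulrA ler_piMr ?sqr_ge0//.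
  by rewrite ler_pdivrMl ?exprn_gt0// mulr1.
have [+ _] := F_expansion h1 h2 h3 h4.
move=> /(_ N 1); rewrite nc1 scale1r ltr_pdivlMr// !mul1r invf_div => /(_ rs).
suff -> : s / r / (s / r - 1) = s / (s - r) by [].
by field; rewrite subr_eq0 [s == r]gt_eqF// rn.
Qed.

Lemma component_bound (z : 'rV[C]_n) d : lie_sq z <= 1 ->
  nc (peval (F d) z) <= 2 * M / s ^+ d.
Proof.
move=> z1; have zr : lie_sq z <= 1 ^+ 2 by rewrite expr1n.
have h2 l : nc l < rho -> lie_ball rho (l *: z).
  by move=> lr; apply: (lie_ball_scale ltr01 zr); rewrite divr1.
have h3 : 0 < s < rho by rewrite s_gt0.
have h4 l : nc l = s -> nc (f (l *: z)) <= M.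
  by move=> hl; apply: hM; rewrite lie_sqZ hl ler_piMr ?sqr_ge0.
by have [_] := F_expansion rho_gt0 h2 h3 h4; apply.
Qed.

Lemma coefficient_bound d k l : nc (IS (F d * cpoly (@Y k l))) <=
  4 * M * Yb k * vol R m / s ^+ d.
Proof.
have -> : 4 * M * Yb k * vol R m / s ^+ d =
  2 * (2 * M / s ^+ d * Yb k) * vol R m by ring.
apply: IS_bound => x xs; rewrite pevalM peval_cpoly_real ncM nc_conj.
have x1 := lie_sq_real xs.
apply: ler_pM; rewrite ?nc_ge0//; first by rewrite component_bound ?x1.
have := @basis_norm _ _ m_gt0 _ _ hY k l (real_point x) 1 ler01.
by rewrite !expr1n mulr1; apply; rewrite x1.
Qed.

Lemma laplace_fourier_error k l r N : 0 < r < s ->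
  nc (laplace_fourier (fun x => f (real_point x)) (@Y k l) r -
      \sum_(d < N) r%:C ^+ d * IS (F d * cpoly (@Y k l))) <=
  4 * M * s / (s - r) * Yb k * vol R m * (r / s) ^+ N.
Proof.
move=> rs; have /andP[r0 r1] := rs.
pose Q N := (\sum_(d < N) r%:C ^+ d *: F d) * cpoly (@Y k l).
have ISQ K : IS (Q K) = \sum_(d < K) r%:C ^+ d * IS (F d * cpoly (@Y k l)).
  rewrite /Q mulr_suml IS_sum; apply: eq_bigr => d _.
  by rewrite -scalerAl ISZ.
pose G (x : 'rV[R]_n) := f (real_point (r *: x)) * (peval (@Y k l) (real_point x))^*.
have GQ K x : on_sphere x -> nc (G x - peval (Q K) (real_point x)) <=
    2 * M * s / (s - r) * Yb k * (r / s) ^+ K.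
  move=> xs; have x1 := lie_sq_real xs.
  rewrite /Q pevalM peval_cpoly_real /G -mulrBl ncM nc_conj.
  have -> : peval (\sum_(d < K) r%:C ^+ d *: F d) (real_point x) =
      \sum_(d < K) peval (F d) (real_point (r *: x)).
    rewrite peval_sum; apply: eq_bigr => d _.
    by rewrite pevalZ real_pointZ (peval_scale _ _ (hF d)).
  have -> : 2 * M * s / (s - r) * Yb k * (r / s) ^+ K =
    2 * M * (r / s) ^+ K * (s / (s - r)) * Yb k by ring.
  apply: ler_pM; rewrite ?nc_ge0//.
    apply: expansion_error => //.
    by rewrite real_pointZ lie_sqZ x1 mulr1 nc_real gtr0_norm.
  have := @basis_norm _ _ m_gt0 _ _ hY k l (real_point x) 1 ler01.
  by rewrite !expr1n mulr1; apply; rewrite x1.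
(* The estimate [GQ] itself shows that the integrand is a uniform limit of polynomials on the
   sphere. *)
have aG : capproximable G.
  move=> e e0.
  pose B := 2 * M * s / (s - r) * Yb k.
  have B0 : 0 <= B.
    rewrite mulr_ge0 ?(le_trans ler01 (Ybound_ge1 m_gt0 hY k))//.
    by rewrite divr_ge0 ?subr_ge0 ?(ltW r1)// !mulr_ge0 ?M_ge0 ?(ltW s_gt0).
  have B1 : 0 < 1 + B by rewrite ltr_pwDl.
  have [K hK] := pow_cvg0 (ratio_lt1 (ltW r0) r1) (divr_gt0 e0 B1).
  exists (Q K) => x xs; apply: (le_trans (GQ K x xs)); rewrite -/B.
  have := hK K (leqnn K); rewrite ltr_pdivlMr// => /ltW; apply: le_trans.
  by rewrite mulrC ler_wpM2l ?exprn_ge0 ?divr_ge0 ?(ltW r0) ?(ltW s_gt0)// lerDr.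
have := sphere_intC_dist aG (capproximable_peval (Q N)) (GQ N).
rewrite -/(IS _) ISQ => /le_trans; apply.
by apply: eqr_le; ring.
Qed.

End Bounds.

Lemma coefficient_vanish d k l : (forall j, d != k + 2 * j)%N ->
  IS (F d * cpoly (@Y k l)) = 0.
Proof. by have [_ h] := homogeneous_in_basis m_gt0 hY (hF d); exact: h. Qed.

Lemma peval_component d z : peval (F d) z = \sum_(j < (d./2).+1)
  quad z ^+ j * \sum_(l < a (d - 2 * j))
    IS (F d * cpoly (@Y (d - 2 * j) l)) * peval (@Y _ l) z.
Proof.
have [E _] := homogeneous_in_basis m_gt0 hY (hF d).
rewrite [in LHS]E peval_sum; apply: eq_bigr => j _; rewrite pevalM peval_sqpolyX peval_sum.
by congr (_ * _); apply: eq_bigr => l _; rewrite pevalZ.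
Qed.

Definition radial_coef k (l : 'I_(a k)) j : C := IS (F (k + 2 * j) * cpoly (@Y k l)).

Lemma partial_sum_by_degree z N : \sum_(d < N) peval (F d) z =
  \sum_(k < N) \sum_(l < a k)
    (\sum_(j < uphalf (N - k)) radial_coef l j * quad z ^+ j) * peval (@Y k l) z.
Proof.
pose H k j : C := quad z ^+ j *
  \sum_(l < a k) radial_coef l j * peval (@Y k l) z.
transitivity (\sum_(k < N) \sum_(j < uphalf (N - k)) H k j).
  rewrite sum_by_degree; apply: eq_bigr => d _; rewrite peval_component.
  apply: eq_bigr => j _; rewrite /H /radial_coef subnK//; have := ltn_ord j; lia.
apply: eq_bigr => k _; rewrite /H.
under eq_bigr do rewrite mulr_sumr.
rewrite exchange_big /=; apply: eq_bigr => l _; rewrite mulr_suml.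
by apply: eq_bigr => j _; ring.
Qed.

(** Degrees below k and degrees of the wrong parity drop out by [coefficient_vanish], so k + 2 J
    components leave J terms. *)
Lemma radial_coef_partial k (l : 'I_(a k)) (r : C) J :
  \sum_(d < k + 2 * J) r ^+ d * IS (F d * cpoly (@Y k l)) =
  r ^+ k * \sum_(j < J) radial_coef l j * (r ^+ 2) ^+ j.
Proof.
elim: J => [|J IH].
  rewrite muln0 addn0 big_ord0 mulr0 big1// => d _.
  by rewrite coefficient_vanish ?mulr0// => j; have := ltn_ord d; lia.
have -> : (k + 2 * J.+1 = (k + 2 * J).+2)%N by lia.
rewrite !big_ord_recr /= IH [IS (F (k + 2 * J).+1 * _)]coefficient_vanish ?mulr0 ?addr0 => [|j]; last by lia.
by rewrite mulrDr /radial_coef exprD exprM; ring.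
Qed.

Lemma larger_radius r : 0 < r -> r < rho -> exists s M,
  [/\ r < s, s < rho, 0 < s, 0 <= M & forall z, lie_sq z <= s ^+ 2 -> nc (f z) <= M].
Proof.
move=> r0 rr; have h : 0 <= (r + rho) / 2 < rho by lra.
have [M [M0 hM]] := holomorphic_bounded hf h.
by exists ((r + rho) / 2), M; split=> //; lra.
Qed.

Section BoundsOnBall.
Variables (s M : R).
Hypotheses (s_gt0 : 0 < s) (s_rho : s < rho).
Hypothesis hM : forall z, lie_sq z <= s ^+ 2 -> nc (f z) <= M.

Lemma radial_coef_bound k (l : 'I_(a k)) j :
  nc (radial_coef l j) <= 4 * M * Yb k * vol R m / s ^+ k / (s ^+ 2) ^+ j.
Proof.
apply: (le_trans (coefficient_bound s_gt0 s_rho hM (k + 2 * j) l)).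
by rewrite exprD exprM invfM mulrA.
Qed.

(** One factor [Ybound] comes from the coefficients and one from Y_(k, l)(z). Likewise 1 / s^k from
    the coefficients and r^k from Y combine with (r / s)^(2 J) from the tail. *)
Lemma term_error k (l : 'I_(a k)) P z r J : 0 < r < s -> lie_sq z <= r ^+ 2 ->
  sums_on (rho ^+ 2) (radial_coef l) P ->
  nc (P (quad z) * peval (@Y k l) z -
      (\sum_(j < J) radial_coef l j * quad z ^+ j) * peval (@Y k l) z) <=
  4 * M * vol R m / (1 - (r / s) ^+ 2) * Yb k ^+ 2 * (r / s) ^+ (k + 2 * J).
Proof.
move=> /andP[r0 rs] zr hP; rewrite -mulrBl ncM.
have qz : nc (quad z) <= r ^+ 2 := le_trans (nc_quad_le_lie z) zr.
have r2s2 : r ^+ 2 < s ^+ 2 by apply: ltr_sqr_pos => //; exact: ltW.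
have s2 : s ^+ 2 < rho ^+ 2 by apply: ltr_sqr_pos => //; exact: ltW.
have h1 := hP _ _ _ _ qz r2s2 s2 (radial_coef_bound l) J.
have h2 := basis_norm m_gt0 hY l (ltW r0) zr.
apply: (le_trans (ler_pM (nc_ge0 _) (nc_ge0 _) h1 h2)).
apply: eqr_le.
rewrite exprD exprM -!expr_div_n [(r / s) ^+ k]expr_div_n.
by ring.
Qed.

End BoundsOnBall.

Lemma radial_coef_subgeometric k (l : 'I_(a k)) : subgeometric (rho ^+ 2) (radial_coef l).
Proof.
move=> t /andP[t0 tr]; have sq : Num.sqrt t ^+ 2 = t by rewrite sqr_sqrtr// ltW.
have s0 : 0 < Num.sqrt t by rewrite sqrtr_gt0.
have sr : Num.sqrt t < rho by rewrite -(@ltr_pXn2r _ 2) ?nnegrE ?(ltW s0) ?(ltW rho_gt0)// sq.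
have [|M [_ hM]] := holomorphic_bounded hf (s := Num.sqrt t); first by rewrite ltW.
have := radial_coef_bound s0 sr hM l; rewrite sq => h.
by eexists; exact: h.
Qed.

Lemma sums_on_radial k (l : 'I_(a k)) P : sums_on (rho ^+ 2) (radial_coef l) P ->
  forall r : R, 0 < r < rho -> P (r ^+ 2)%:C =
    (r ^- k)%:C * laplace_fourier (fun x => f (real_point x)) (@Y k l) r.
Proof.
move=> hP r /andP[r0 rr].
have [s [M [rs sr s0 M0 hM]]] := larger_radius r0 rr.
have q01 := ratio_lt1 (ltW r0) rs; set q := r / s in q01.
have /andP[q0 q1] := q01.
have q201 : 0 <= q ^+ 2 < 1 by rewrite sqr_ge0 expr_lt1.
have r2s2 : r ^+ 2 < s ^+ 2 by apply: ltr_sqr_pos => //; exact: ltW.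
have s2 : s ^+ 2 < rho ^+ 2 by apply: ltr_sqr_pos => //; exact: ltW.
have r2 : nc ((r ^+ 2)%:C : C) <= r ^+ 2 by rewrite nc_real ger0_norm ?sqr_ge0.
set LF := laplace_fourier _ _ _.
(* The two summands bound the distances of both members to the same partial sum, the one of degree
   below k + 2 J; each decays like q^(2 J). *)
pose K := 4 * M * Yb k * vol R m / s ^+ k / (1 - r ^+ 2 / s ^+ 2) +
  r ^- k * (4 * M * s / (s - r) * Yb k * vol R m * q ^+ k).
apply/eqP; rewrite -subr_eq0 -nc_eq0; apply/eqP.
apply: (le_geom_eq0 (C := K) q201 (nc_ge0 _)) => J.
have h1 := hP _ _ _ _ r2 r2s2 s2 (radial_coef_bound s0 sr hM l) J.
have h2 : nc (LF - _) <= _ :=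
  @laplace_fourier_error s M s0 sr hM k l r (k + 2 * J) (introT andP (conj r0 rs)).
rewrite radial_coef_partial in h2.
have -> : P (r ^+ 2)%:C - (r ^- k)%:C * LF =
    (P (r ^+ 2)%:C - \sum_(j < J) radial_coef l j * (r ^+ 2)%:C ^+ j) -
    (r ^- k)%:C * (LF - r%:C ^+ k *
      \sum_(j < J) radial_coef l j * ((r%:C : C) ^+ 2) ^+ j).
  have rk : (r ^- k)%:C * r%:C ^+ k = 1 :> C.
    by rewrite -rcX -rcM mulVf// expf_neq0// gt_eqF.
  by rewrite mulrBr [_ * (_ * \sum_(j < J) _)]mulrA rk mul1r rcX; ring.
apply: (le_trans (ncB _ _)); rewrite ncM nc_real ger0_norm ?invr_ge0 ?exprn_ge0 ?(ltW r0)//.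
apply: (le_trans (lerD h1 (ler_wpM2l _ h2))); first by rewrite invr_ge0 exprn_ge0 ?(ltW r0).
rewrite -/q /K mulrDl le_eqVlt; apply/orP; left; apply/eqP.
by rewrite exprD exprM /q !expr_div_n; ring.
Qed.

Lemma radial_extension_exists k (l : 'I_(a k)) : exists P,
  radial_extension rho k (laplace_fourier (fun x => f (real_point x)) (@Y k l)) P.
Proof.
have hb := radial_coef_subgeometric l.
have [P hP] := power_series_exists hb; exists P; split; last exact: sums_on_radial.
by move=> z zr; apply/cdiff_differentiable/(power_series_cdiff hb hP).
Qed.

(** The second half of the theorem concerns arbitrary extensions Q. Their values at positive reals
    are prescribed, which forces agreement with the power series on the whole disc. *)
Lemma radial_extension_sums k (l : 'I_(a k)) Q :
  radial_extension rho k (laplace_fourier (fun x => f (real_point x)) (@Y k l)) Q ->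
  sums_on (rho ^+ 2) (radial_coef l) Q.
Proof.
move=> [dQ hQ]; have hb := radial_coef_subgeometric l.
have rho2 : 0 < rho ^+ 2 by rewrite exprn_gt0.
have [P hP] := power_series_exists hb.
have cQ z : nc z < rho ^+ 2 -> cdiff Q z.
  move=> zr; have E (w : C) : (0 : C) + w *: (1 : C) = w by rewrite add0r; exact: mulr1.
  have := @differentiable_line R C Q 0 1 z; rewrite E => /(_ (dQ z zr)).
  by under eq_fun do rewrite E.
have QP : forall z, nc z < rho ^+ 2 -> Q z = P z.
  apply: (power_series_unique rho2 hb hP cQ) => t /andP[t0 tr].
  (* The prescribed values are indexed by r with t = r^2. *)
  have sq : Num.sqrt t ^+ 2 = t by rewrite sqr_sqrtr// ltW.
  have s0 : 0 < Num.sqrt t by rewrite sqrtr_gt0.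
  have sr : Num.sqrt t < rho by rewrite -(@ltr_pXn2r _ 2) ?nnegrE ?(ltW s0) ?(ltW rho_gt0)// sq.
  rewrite -sq hQ; last by rewrite s0.
  by rewrite (sums_on_radial hP)// s0.
move=> z s0 s K zs ss sr hK J; rewrite QP; first exact: hP zs ss sr hK J.
by apply: (le_lt_trans zs); exact: lt_trans sr.
Qed.

(** The exponent is n for the dimension plus twice n + 1 for [Ybound], which is the dimension bound
    times a further factor linear in k. *)
Lemma dim_Ybound : exists A, 0 <= A /\
  forall k, (a k)%:R * Yb k ^+ 2 <= A * k.+1%:R ^+ (n + n.+1 * 2).
Proof.
have v0 := vol_gt0 m_gt0 hY; pose c := 1 + 4 / vol R m.
have c0 : 0 <= c by rewrite addr_ge0// divr_ge0// ltW.
exists (c ^+ 2); split; first exact: sqr_ge0.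
move=> k; set x : R := k.+1%:R.
have x1 : 1 <= x by rewrite /x ler1n.
have x0 : 0 <= x by exact: le_trans x1.
have ax : (a k)%:R <= x ^+ n.
  by rewrite /x -natrX ler_nat; exact: dim_bound hY k.
have Y0 : 0 <= Yb k by apply: le_trans (Ybound_ge1 m_gt0 hY k).
have Yx : Yb k <= c * x ^+ n.+1.
  have -> : c * x ^+ n.+1 = x ^+ n.+1 + 2 * x * (2 * (x ^+ n / vol R m)).
    by rewrite /c exprSr; ring.
  apply: lerD; first by rewrite exprn_ege1.
  apply: ler_pM => //.
  - by rewrite mulr_ge0// divr_ge0// ltW.
  - by rewrite /x -natrM ler_nat; lia.
  - by rewrite ler_wpM2l// ler_wpM2r// invr_ge0 ltW.
apply: (@le_trans _ _ (x ^+ n * (c * x ^+ n.+1) ^+ 2)).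
  apply: ler_pM; rewrite ?sqr_ge0//.
  by have Y2 := le_trans Y0 Yx; apply: lerXn2r; rewrite ?nnegrE.
by rewrite exprMn exprD exprM le_eqVlt; apply/orP; left; apply/eqP; ring.
Qed.

Variable P : forall k, 'I_(a k) -> C -> C.
Hypothesis hP : forall k l,
  radial_extension rho k (laplace_fourier (fun x => f (real_point x)) (@Y k l)) (@P k l).

Lemma tail_constant_ge0 (M q : R) : 0 <= M -> 0 <= q < 1 ->
  0 <= 4 * M * vol R m / (1 - q ^+ 2).
Proof.
move=> M0 /andP[q0 q1].
by rewrite divr_ge0 ?mulr_ge0 ?(ltW (vol_gt0 m_gt0 hY))// subr_ge0 expr_le1// ltW.
Qed.

Lemma series_absolute_cvg z : lie_ball rho z ->
  cvgn (series (fun k => \sum_(l < a k) nc (lf_term Y P l z) : R)).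
Proof.
move=> zrho; have [|r /andP[r0 rr] hr] := compact_in_lie_ball rho_gt0 (@compact_set1 _ z).
  by move=> _ ->.
have zr := hr z erefl.
have [s [M [rs sr s0 M0 hM]]] := larger_radius r0 rr.
have q01 := ratio_lt1 (ltW r0) rs; set q := r / s in q01.
have /andP[q0 q1] := q01.
pose B := 4 * M * vol R m / (1 - q ^+ 2).
have B0 : 0 <= B by exact: tail_constant_ge0.
have [A [A0 hA]] := dim_Ybound.
have [A' [q' [A'0 /andP[q'0 q'1] hA']]] := polynomial_geometric (n + n.+1 * 2) q01.
apply: (@series_le_cvg _ _ (geometric (B * A * A') q')) => [k|k|k|].
- by rewrite sumr_ge0// => l _; exact: nc_ge0.
- by rewrite /geometric /= mulr_ge0 ?exprn_ge0// mulr_ge0// mulr_ge0.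
- apply: (@le_trans _ _ (\sum_(l < a k) B * Yb k ^+ 2 * q ^+ k)).
    apply: ler_sum => l _.
    (* With J = 0 the partial sum is empty, so the error is the term itself. *)
    have := term_error s0 sr hM 0 (introT andP (conj r0 rs)) zr (radial_extension_sums (hP l)).
    by rewrite big_ord0 mul0r subr0 muln0 addn0.
  rewrite sumr_const card_ord -[leLHS]mulr_natl.
  have -> : (a k)%:R * (B * Yb k ^+ 2 * q ^+ k) = B * ((a k)%:R * Yb k ^+ 2 * q ^+ k) by ring.
  have -> : geometric (B * A * A') q' k = B * (A * (A' * q' ^+ k)).
    by rewrite /geometric /=; ring.
  rewrite ler_wpM2l//.
  apply: (@le_trans _ _ (A * k.+1%:R ^+ (n + n.+1 * 2) * q ^+ k)).
    by rewrite ler_wpM2r ?exprn_ge0.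
  by rewrite -mulrA ler_wpM2l.
- by apply: is_cvg_geometric_series; rewrite ger0_norm.
Qed.

Lemma series_uniform_cvg (K : set 'rV[C]_n) : compact K -> K `<=` lie_ball rho ->
  {uniform K, (fun N z => \sum_(0 <= k < N) \sum_(l < a k) lf_term Y P l z) @ \oo --> f}.
Proof.
move=> cK sK; have [r /andP[r0 rr] hr] := compact_in_lie_ball rho_gt0 cK sK.
have [s [M [rs sr s0 M0 hM]]] := larger_radius r0 rr.
have q01 := ratio_lt1 (ltW r0) rs; set q := r / s in q01.
have /andP[q0 q1] := q01.
pose B := 4 * M * vol R m / (1 - q ^+ 2).
have B0 : 0 <= B by exact: tail_constant_ge0.
have [A [A0 hA]] := dim_Ybound; set D := (n + n.+1 * 2)%N in hA.
(* The exponent [D.+1] accounts for the summation over the N values of k. *)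
have [A' [q' [A'0 q'01 hA']]] := polynomial_geometric D.+1 q01.
have /andP[q'0 q'1] := q'01.
pose E := 2 * M * (s / (s - r)).
have BA0 := mulr_ge0 B0 A0.
have E0 : 0 <= E by rewrite !mulr_ge0 ?invr_ge0 ?subr_ge0 ?(ltW s0) ?(ltW rs).
pose W := (E + B * A) * A'.
have main N z : K z ->
    nc (f z - \sum_(0 <= k < N) \sum_(l < a k) lf_term Y P l z) <= W * q' ^+ N.
  move=> Kz; have zr := hr z Kz; have rs' : 0 < r < s by rewrite r0.
  have e1 := expansion_error s0 sr hM N rs' zr.
  rewrite partial_sum_by_degree in e1.
  (* In the k-th block the two sums differ by the tails of p_(k, l) from j = [uphalf (N - k)] on,
     where the degree k + 2 j is at least N; hence the common factor q^N. *)
  have e2 k : (k < N)%N -> nc (\sum_(l < a k) lf_term Y P l z -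
      \sum_(l < a k) (\sum_(j < uphalf (N - k)) radial_coef l j * quad z ^+ j) *
         peval (@Y k l) z) <= B * A * N.+1%:R ^+ D * q ^+ N.
    move=> kN; rewrite -sumrB; apply: (le_trans (nc_sum _ _ _)).
    apply: (@le_trans _ _ (\sum_(l < a k) B * Yb k ^+ 2 * q ^+ N)).
      apply: ler_sum => l _.
      apply: (le_trans (term_error s0 sr hM (uphalf (N - k)) rs' zr
        (radial_extension_sums (hP l)))).
      rewrite -/q -/B; apply: ler_wpM2l; first exact: (mulr_ge0 B0 (sqr_ge0 _)).
      by apply: (ler_wiXn2l q0 (ltW q1)); exact: leq_add_uphalf_sub (ltnW kN).
    rewrite sumr_const card_ord -[leLHS]mulr_natl.
    have -> : (a k)%:R * (B * Yb k ^+ 2 * q ^+ N) = B * ((a k)%:R * Yb k ^+ 2 * q ^+ N).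
      by ring.
    have -> : B * A * N.+1%:R ^+ D * q ^+ N = B * (A * N.+1%:R ^+ D * q ^+ N) by ring.
    rewrite ler_wpM2l// ler_wpM2r ?exprn_ge0//.
    apply: (le_trans (hA k)); rewrite ler_wpM2l//.
    by apply: lerXn2r; rewrite ?nnegrE// ler_nat ltnW.
  rewrite big_mkord.
  set S1 := \sum_(k < N) _ in e1; set S2 := \sum_(k < N) _.
  have e3 : nc (S2 - S1) <= B * A * N.+1%:R ^+ D.+1 * q ^+ N.
    rewrite /S2 /S1 -sumrB; apply: (le_trans (nc_sum _ _ _)).
    apply: (@le_trans _ _ (\sum_(k < N) B * A * N.+1%:R ^+ D * q ^+ N)).
      by apply: ler_sum => k _; exact: e2.
    rewrite sumr_const card_ord -[leLHS]mulr_natl.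
    rewrite mulrA ler_wpM2r ?exprn_ge0// exprS.
    rewrite [_%:R * (B * A * _)]mulrCA (ler_wpM2l BA0)//.
    by rewrite ler_wpM2r ?exprn_ge0// ler_nat.
  have -> : f z - S2 = (f z - S1) - (S2 - S1) by ring.
  apply: (le_trans (ncB _ _)); apply: (le_trans (lerD e1 e3)); rewrite -/q.
  have hN := hA' N.
  have -> : 2 * M * q ^+ N * (s / (s - r)) + B * A * N.+1%:R ^+ D.+1 * q ^+ N =
    E * q ^+ N + B * A * (N.+1%:R ^+ D.+1 * q ^+ N) by rewrite /E; ring.
  have -> : W * q' ^+ N = E * (A' * q' ^+ N) + B * A * (A' * q' ^+ N) by rewrite /W; ring.
  apply: lerD (ler_wpM2l E0 _) (ler_wpM2l BA0 hN).
  by apply: le_trans hN; rewrite ler_peMl ?exprn_ge0// exprn_ege1// ler1n.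
have W0 : 0 <= W by rewrite mulr_ge0// addr_ge0.
apply: uniform_cvg_eps => e e0.
have W1 : 0 < W + 1 by rewrite ltr_wpDl.
have [N hN] := pow_cvg0 q'01 (divr_gt0 e0 W1).
exists N => k Nk z Kz; apply: (le_lt_trans (main k z Kz)).
have := hN k Nk; rewrite ltr_pdivlMr//; apply: le_lt_trans.
by rewrite mulrC ler_wpM2l ?exprn_ge0// lerDl.
Qed.

End Expansion.

Theorem theorem2 (R : realType) (n : nat) (hn : (2 <= n)%N)
    (rho : R) (hrho : 0 < rho)
    (a : nat -> nat) (Y : forall k, 'I_(a k) -> mpoly.mpoly n R[i])
    (hY : forall k, orthonormal_harmonic_basis k (Y k))
    (f : 'rV[R[i]]_n -> R[i]) (hf : holomorphic_on (@lie_ball R n rho) f) :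
  let fkl k (l : 'I_(a k)) :=
    laplace_fourier (fun x : 'rV[R]_n => f (real_point x)) (Y k l) in
  (forall k l, exists P : R[i] -> R[i],
     radial_extension rho k (fkl k l) P) /\
  (forall P : forall k, 'I_(a k) -> R[i] -> R[i],
     (forall k l, radial_extension rho k (fkl k l) (P k l)) ->
     (forall z, lie_ball rho z ->
        cvgn (series (fun k : nat =>
          \sum_(l < a k) Normc.normc (lf_term Y P l z) : R))) /\
     (forall K : set 'rV[R[i]]_n, compact K -> K `<=` lie_ball rho ->
        {uniform K,
          (fun (N : nat) (z : 'rV[R[i]]_n) =>
             \sum_(0 <= k < N) \sum_(l < a k) lf_term Y P l z)
          @ \oo --> f})).
Proof.
(* With n = m + 1 the hypothesis 2 <= n is convertible to 0 < m. *)
case: n hn Y hY f hf => [//|m] m_gt0 Y hY f hf.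
have [F [hF F_expansion]] := homogeneous_expansion hrho hf.
split=> [k l|P hP].
  exact: radial_extension_exists m_gt0 hrho hY hf hF F_expansion k l.
split=> [z|K].
  exact: (series_absolute_cvg m_gt0 hrho hY hf hF F_expansion hP).
exact: (series_uniform_cvg m_gt0 hrho hY hf hF F_expansion hP).
Qed.
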